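(* There exists a $3$-generator polynomial semigroup $G=\langle h_1,h_2,h_3\rangle$ in $\mathcal{G}_{dis}$ such that $\bigcup_{j=1}^{2}(h_j)^{-1}(J_{\max}(G))\subset J_{\min}(G)$, $J_{\max}(G)=J(h_3)$, $\sharp(\hat{\mathcal{J}}_G)=\aleph_0$, there exists a superattracting fixed point $z_0$ of some element of $G$ with $z_0\in J(G)$, and $\mathrm{int}(J_{\min}(G))\neq\emptyset$.
   Context: $\hat{\mathbb{C}}$ is the Riemann sphere. A polynomial semigroup is a semigroup, under composition, generated by a non-empty family of non-constant polynomial maps $\hat{\mathbb{C}}\to\hat{\mathbb{C}}$; $\langle h_1,h_2,h_3\rangle$ is the semigroup generated by $h_1,h_2,h_3$. The Fatou set $F(G)$ is the set of $z\in\hat{\mathbb{C}}$ having a neighborhood on which $G$ is a normal family; the Julia set is $J(G)=\hat{\mathbb{C}}\setminus F(G)$; for a single map $g$, $J(g)=J(\langle g\rangle)$. $CV(g)$ is the set of critical values of $g:\hat{\mathbb{C}}\to\hat{\mathbb{C}}$, $P(G)=\overline{\bigcup_{g\in G}CV(g)}$ (closure in $\hat{\mathbb{C}}$), and $P^{\ast}(G)=P(G)\setminus\{\infty\}$. $\mathcal{G}$ is the set of all polynomial semigroups $G$ such that each element of $G$ has degree at least two and $P^{\ast}(G)$ is bounded in $\mathbb{C}$; $\mathcal{G}_{dis}$ is the set of $G\in\mathcal{G}$ with $J(G)$ disconnected. $\hat{\mathcal{J}}_G$ is the set of all connected components of $J(G)$; for $G\in\mathcal{G}_{dis}$ all of them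 are contained in $\mathbb{C}$. Surrounding order: for connected sets $K_1,K_2\subset\mathbb{C}$, $K_1\leq K_2$ means that $K_1=K_2$ or $K_1$ is included in a bounded component of $\mathbb{C}\setminus K_2$. For $G\in\mathcal{G}_{dis}$, $J_{\min}(G)$ and $J_{\max}(G)$ denote the (existing, unique) elements of $\hat{\mathcal{J}}_G$ with $J_{\min}(G)\leq J\leq J_{\max}(G)$ for all $J\in\hat{\mathcal{J}}_G$. $\mathrm{int}$ denotes the set of interior points. *)

(* Defs.v *)
From HB Require Import structures.
From mathcomp Require Import all_boot all_order all_algebra.
From mathcomp Require Import all_classical all_reals all_analysis.
From mathcomp Require Import complex.

Set Implicit Arguments.
Unset Strict Implicit.
Unset Printing Implicit Defensive.

Import Order.TTheory GRing.Theory Num.Theory.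
Import numFieldNormedType.Exports.

Local Open Scope classical_set_scope.
Local Open Scope ring_scope.

(* [R[i]^o] is [R[i]] with the topology of its norm. *)
Notation Cplane R := ((complex R)^o).

(* Inverse stereographic projection onto the unit sphere of R^3; [None] is the
   point at infinity, sent to the north pole. *)
Definition stereographic (R : realType) (x : option (Cplane R)) : R * R * R :=
  if x is Some (Complex a b) then
    let m := a ^+ 2 + b ^+ 2 in
    (2 * a / (m + 1), 2 * b / (m + 1), (m - 1) / (m + 1))
  else (0, 0, 1).

(* The topology and the uniform structure are those of the chordal metric (up to
   replacing the Euclidean norm of R^3 by the equivalent maximum norm). *)
Definition sphere (R : realType) : Type := initial_topology (@stereographic R).

HB.instance Definition _ (R : realType) := Pointed.on (sphere R).
HB.instance Definition _ (R : realType) := PseudoMetric.on (sphere R).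

Definition fin_pt (R : realType) (z : Cplane R) : sphere R := Some z.
Definition inf_pt (R : realType) : sphere R := None.

Definition planar (R : realType) (K : set (sphere R)) : set (Cplane R) :=
  @fin_pt R @^-1` K.

(* The formula at infinity is the right one for non-constant [p] only. *)
Definition poly_map (R : realType) (p : {poly complex R}) (x : sphere R) :
    sphere R :=
  if x is Some z then fin_pt p.[z] else inf_pt R.

(* Polynomials are identified with the maps they induce: the field is infinite,
   so [poly_map] is injective and it turns [\Po] into composition. *)
Inductive semigroup_gen (R : realType) (A : set {poly complex R}) :
    set {poly complex R} :=
| semigroup_gen_in p : A p -> semigroup_gen A p
| semigroup_gen_comp p q :
    semigroup_gen A p -> semigroup_gen A q -> semigroup_gen A (p \Po q).

Definition polynomial_semigroup (R : realType) (G : set {poly complex R}) :=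
  exists A : set {poly complex R},
    [/\ A !=set0, (forall p, A p -> (1 < size p)%N) & G = semigroup_gen A].

Definition normal_on (R : realType) (U : set (sphere R))
    (F : set (sphere R -> sphere R)) :=
  forall f : nat -> sphere R -> sphere R, (forall n, F (f n)) ->
  exists phi : nat -> nat, {homo phi : m n / (m < n)%N} /\
  exists g : sphere R -> sphere R,
    {family compactly_in U, f \o phi @ \oo --> g}.

Definition Fatou (R : realType) (G : set {poly complex R}) : set (sphere R) :=
  [set x | exists2 U, open_nbhs x U & normal_on U (@poly_map R @` G)].

Definition Julia (R : realType) (G : set {poly complex R}) : set (sphere R) :=
  ~` Fatou G.

(* In the coordinate 1/z, a non-constant [p] has local degree [deg p] at
   infinity, so infinity is critical exactly when [deg p >= 2]. *)
Definition critical_points (R : realType) (p : {poly complex R}) :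
    set (sphere R) :=
  [set x | if x is Some z then root p^`() z else (2 < size p)%N].

Definition critical_values (R : realType) (p : {poly complex R}) :
    set (sphere R) :=
  poly_map p @` critical_points p.

Definition postcritical (R : realType) (G : set {poly complex R}) :
    set (sphere R) :=
  closure (\bigcup_(g in G) critical_values g).

Definition classG (R : realType) (G : set {poly complex R}) :=
  [/\ polynomial_semigroup G,
      (forall g, G g -> (2 < size g)%N) &
      bounded_set (planar (postcritical G))].

Definition classG_dis (R : realType) (G : set {poly complex R}) :=
  classG G /\ ~ connected (Julia G).

Definition components (T : topologicalType) (A : set T) : set (set T) :=
  connected_component A @` A.

Definition surround_le (R : realType) (K1 K2 : set (Cplane R)) :=
  K1 = K2 \/
  exists D, [/\ components (~` K2) D, bounded_set D & K1 `<=` D].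

(* [planar] loses nothing on the components of [Julia G] when [classG_dis G]
   holds, since they avoid infinity. *)
Definition is_Jmin (R : realType) (G : set {poly complex R})
    (K : set (sphere R)) :=
  components (Julia G) K /\
  forall J, components (Julia G) J -> surround_le (planar K) (planar J).

Definition is_Jmax (R : realType) (G : set {poly complex R})
    (K : set (sphere R)) :=
  components (Julia G) K /\
  forall J, components (Julia G) J -> surround_le (planar J) (planar K).

(* A fixed point of a rational map has multiplier 0 iff it is critical. *)
Definition superattracting (R : realType) (g : {poly complex R})
    (x : sphere R) :=
  poly_map g x = x /\ critical_points g x.

(* Main.v *)
Require Import Defs.
From mathcomp Require Import all_boot all_order all_algebra.
From mathcomp Require Import all_classical all_reals all_analysis.
From mathcomp Require Import complex ring lra.
Import Order.TTheory GRing.Theory Num.Theory.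
Import numFieldNormedType.Exports.
Local Open Scope classical_set_scope.
Local Open Scope card_scope.
Local Open Scope ring_scope.

Set Implicit Arguments.
Unset Strict Implicit.
Unset Printing Implicit Defensive.

(* The generators are h1 = 3z^2 - 2z^3, h2 = z^2 and h3 = z^8 / rho^7, where
   rho = 49/16.  Both critical points 0 and 1 of h1 are fixed by h1; the disc
   |z| <= 1/4 is mapped into itself by the three maps and h3 sends 1 into it, so
   the finite postcritical set stays in {1} together with this disc.

   J(h3) is the circle |z| = rho.  As h3 maps |z| <= 2 into the disc |z| < 1/4,
   which lies in the Fatou set, while h1 and h2 map |z| >= 2 beyond the circle,
   where all orbits escape, J(G) misses the circle |z| = 2.  With
   M = J(G) /\ {|z| < 2} it follows that J(G) is the disjoint union of the sets
   h3^-n(M), which accumulate at J(h3), and of J(h3).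

   M is connected: by Montel's theorem for families of polynomials avoiding the
   circle of radius rho, the backward orbit of that circle is dense in J(G); and
   by induction on the length of words each of its points is linked inside J(G)
   to one of the circles h3^-n{|z| = sqrt rho}.  This works because the preimages
   under h1 and h2 of the circles |z| = L with sqrt rho <= L <= rho are connected
   and intersect each other.

   Finally J(G) contains a disc around the superattracting fixed point 1 of h1:
   near 1, iterates of h1 send neighbouring points to points whose distances to 1
   have a ratio tending to 0, and iterates of the repelling map h2 then magnify
   the larger distance to unit size, so that no subsequence can converge to a
   continuous limit. *)

(** * The topology of the complex plane *)

(** Only polynomials occur, so complex analysis is reduced to one fact about roots: a polynomial
    that is small at a point has a root nearby, at a distance controlled by its leading coefficient.
    This makes polynomial maps open and closed and gives a maximum principle for quotients of
    polynomials, hence Lipschitz estimates. With Ascoli they yield Montel's theorem in two cases,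
    uniformly bounded families and families bounded away from 0. A family avoiding a circle about 0
    splits into these two, since on a disc each member stays on one side of the circle.

    The value rho = (7/4)^2 keeps sqrt rho rational, and sqrt rho < 2 < rho < 4: the circle of
    radius sqrt rho, which h2 maps to J(h3), lies in M, while h1 and h2 throw |z| >= 2 past J(h3).
    The exponent 8 is large enough for h3 to crush |z| <= 2, and it is a power of 2, so the radii of
    preimage circles come from iterated square roots. The level curves of |h1| that occur have
    levels at least 7/4; there each ray from 0 meets the curve exactly once. *)

Notation cmod := (@ComplexField.Normc.normc _).

Section Modulus.
Context (R : realType).
Implicit Types (z w : complex R) (x : R).

Lemma normE z : `|z| = (cmod z)%:C%C.
Proof. by []. Qed.

Lemma cmod_sqr z : cmod z ^+ 2 = complex.Re z ^+ 2 + complex.Im z ^+ 2.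
Proof. by case: z => a b /=; rewrite sqr_sqrtr // addr_ge0 // sqr_ge0. Qed.

Lemma cmod_ge0 z : 0 <= cmod z.
Proof. by case: z => a b; exact: sqrtr_ge0. Qed.

Lemma cmod_eq0 z : (cmod z == 0) = (z == 0).
Proof.
apply/eqP/eqP => [/ComplexField.Normc.eq0_normc //|->].
exact: ComplexField.Normc.normc0.
Qed.

Lemma cmod0 : cmod (0 : complex R) = 0.
Proof. exact: ComplexField.Normc.normc0. Qed.

Lemma cmod1 : cmod (1 : complex R) = 1.
Proof. exact: ComplexField.Normc.normc1. Qed.

Lemma cmod_gt0 z : (0 < cmod z) = (z != 0).
Proof. by rewrite lt_def cmod_ge0 andbT cmod_eq0. Qed.

Lemma cmodM z w : cmod (z * w) = cmod z * cmod w.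
Proof. exact: ComplexField.Normc.normcM. Qed.

Lemma cmodV z : cmod z^-1 = (cmod z)^-1.
Proof. exact: ComplexField.Normc.normcV. Qed.

Lemma cmodX z n : cmod (z ^+ n) = cmod z ^+ n.
Proof. by elim: n => [|n IH]; rewrite ?expr0 ?cmod1 // !exprS cmodM IH. Qed.

Lemma cmodN z : cmod (- z) = cmod z.
Proof. exact: normcN. Qed.

Lemma cmodD z w : cmod (z + w) <= cmod z + cmod w.
Proof. exact: le_normcD. Qed.

Lemma cmod_distC z w : cmod (z - w) = cmod (w - z).
Proof. by rewrite -cmodN opprB. Qed.

Lemma cmod_real x : cmod (x%:C%C) = `|x|.
Proof. by rewrite /= expr0n /= addr0 sqrtr_sqr. Qed.

Lemma cmod_nat n : cmod (n%:R : complex R) = n%:R.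
Proof. by rewrite -(rmorph_nat (real_complex R)) cmod_real normr_nat. Qed.

Lemma cmodB_le w z : cmod (z - w) <= cmod z + cmod w.
Proof. by apply: le_trans (cmodD _ _) _; rewrite cmodN. Qed.

Lemma cmod_sub_le z w : cmod z - cmod w <= cmod (z - w).
Proof. by have := cmodD (z - w) w; rewrite subrK; lra. Qed.

Lemma cmod_dist_triangle u z w : cmod (z - w) <= cmod (z - u) + cmod (u - w).
Proof. by apply: le_trans (cmodD _ _); rewrite addrA subrK. Qed.

Lemma ReB z w : complex.Re (z - w) = complex.Re z - complex.Re w.
Proof. by case: z w => ? ? []. Qed.

Lemma ImB z w : complex.Im (z - w) = complex.Im z - complex.Im w.
Proof. by case: z w => ? ? []. Qed.

Lemma normr_Re_le z : `|complex.Re z| <= cmod z.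
Proof.
rewrite -(ler_pXn2r (n := 2)) // ?nnegrE ?cmod_ge0 // cmod_sqr real_normK ?num_real //.
by rewrite lerDl sqr_ge0.
Qed.

Lemma normr_Im_le z : `|complex.Im z| <= cmod z.
Proof.
rewrite -(ler_pXn2r (n := 2)) // ?nnegrE ?cmod_ge0 // cmod_sqr real_normK ?num_real //.
by rewrite lerDr sqr_ge0.
Qed.

Lemma cmod_le_ReIm z : cmod z <= `|complex.Re z| + `|complex.Im z|.
Proof.
rewrite -(ler_pXn2r (n := 2)) // ?nnegrE ?cmod_ge0 ?addr_ge0 //.
rewrite cmod_sqr sqrrD !real_normK ?num_real //.
by have := mulr_ge0 (normr_ge0 (complex.Re z)) (normr_ge0 (complex.Im z)); lra.
Qed.

End Modulus.

(** The balls of [Cplane R] have radii in [complex R], where its norm takes values; a real radius is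
    easier to handle, and [nbhs_disc] links the two. *)
Definition disc (R : realType) (z : Cplane R) (e : R) : set (Cplane R) :=
  [set y | cmod (y - z) < e].

Section PlaneTopology.
Context (R : realType).
Implicit Types (z w : Cplane R) (A : set (Cplane R)) (e : R).

Lemma nbhs_disc z A : nbhs z A <-> exists2 e, 0 < e & disc z e `<=` A.
Proof.
split.
  move=> /nbhs_ballP[e /= e0 eA].
  have [ie re] : complex.Im e = 0 /\ 0 < complex.Re e.
    by move: e0; rewrite ltcE /= => /andP[/eqP -> ->].
  exists (complex.Re e) => // y yz; apply: eA.
  rewrite -ball_normE /= normE ltcE /= ie eqxx /=.
  by rewrite cmod_distC.
move=> [e e0 eA]; apply/nbhs_ballP; exists (e%:C%C) => /=.
  by rewrite ltcR.
move=> y; rewrite -ball_normE /= normE ltcR => yz.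
by apply: eA; rewrite /disc /= cmod_distC.
Qed.

Lemma disc_open z e : open (disc z e).
Proof.
rewrite openE => y /= yz; apply/nbhs_disc; exists (e - cmod (y - z)).
  by rewrite subr_gt0.
move=> w; rewrite /disc /= => wy.
by have := cmod_dist_triangle y w z; lra.
Qed.

Lemma disc_center z e : 0 < e -> disc z e z.
Proof. by rewrite /disc /= subrr cmod0. Qed.

Lemma nbhs_disc_center z e : 0 < e -> nbhs z (disc z e).
Proof. by move=> e0; apply/nbhs_disc; exists e. Qed.

Lemma cmod_continuous : continuous (cmod : Cplane R -> R).
Proof.
move=> z A /nbhs_ballP[e /= e0 eA]; apply/nbhs_disc; exists e => // y yz.
apply: eA; rewrite -ball_normE /= ltr_norml.
move: yz; rewrite /disc /= => yz.
have := cmod_sub_le y z; have := cmod_sub_le z y; rewrite (cmod_distC z) => *.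
by apply/andP; split; lra.
Qed.

Lemma continuous_complex (T : topologicalType) (f g : T -> R) :
  continuous f -> continuous g ->
  continuous ((fun t => Complex (f t) (g t)) : T -> Cplane R).
Proof.
move=> cf cg t A /nbhs_disc[e e0 eA].
have e2 : 0 < e / 2 by lra.
have := cg t _ (nbhsx_ballx (g t) (e / 2) e2).
have := cf t _ (nbhsx_ballx (f t) (e / 2) e2).
rewrite !near_simpl => F1 F2; near=> s.
apply: eA; rewrite /disc /=.
apply: le_lt_trans (cmod_le_ReIm (Complex (f s) (g s) - Complex (f t) (g t))) _ => /=.
have : `|f t - f s| < e / 2 by near: s; move: F1; rewrite -ball_normE.
have : `|g t - g s| < e / 2 by near: s; move: F2; rewrite -ball_normE.
by rewrite (distrC (f t)) (distrC (g t)); lra.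
Unshelve. all: by end_near. Qed.

Lemma codisc_open z e : open [set y : Cplane R | e < cmod (y - z)].
Proof.
rewrite openE => y /= yz; apply/nbhs_disc; exists (cmod (y - z) - e).
  by rewrite subr_gt0.
move=> w; rewrite /disc /= => wy.
by have := cmod_dist_triangle w y z; rewrite (cmod_distC y w); lra.
Qed.

Lemma closed_disc_closed z e : closed [set y : Cplane R | cmod (y - z) <= e].
Proof.
rewrite -openC (_ : ~` _ = [set y | e < cmod (y - z)]); first exact: codisc_open.
by apply/seteqP; split=> y /=; rewrite ltNge => /negP.
Qed.

Lemma closed_disc_compact z e : compact [set y : Cplane R | cmod (y - z) <= e].
Proof.
have [a [b zE]] : exists a b, z = Complex a b by case: z => a b; exists a, b.
pose f (p : R * R) : Cplane R := Complex p.1 p.2.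
have fc : continuous f.
  by apply: continuous_complex => p; [exact: cvg_fst|exact: cvg_snd].
pose K : set (R * R) := `[a - e, a + e] `*` `[b - e, b + e].
have cK : compact (f @` K).
  apply: continuous_compact; first exact: continuous_subspaceT.
  by apply: compact_setX; exact: segment_compact.
apply: (subclosed_compact _ cK).
  exact: closed_disc_closed.
move=> y /= ye; exists (complex.Re y, complex.Im y); last by case: (y).
have := le_trans (normr_Re_le (y - z)) ye.
have := le_trans (normr_Im_le (y - z)) ye.
rewrite ReB ImB zE !ler_norml /K /= !in_itv /= => /andP[h1 h2] /andP[h3 h4].
by split; apply/andP; split; lra.
Qed.

Lemma poly_bounded (p : {poly complex R}) (r : R) :
  exists2 B, 0 < B & forall z, cmod z <= r -> cmod p.[z] <= B.
Proof.
elim/poly_ind: p => [|p c [B B0 IH]].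
  by exists 1 => // z _; rewrite horner0 cmod0.
exists (B * (`|r| + 1) + cmod c).
  by have := cmod_ge0 c; have := normr_ge0 r; nra.
move=> z zr; rewrite hornerMXaddC; apply: le_trans (cmodD _ _) _.
rewrite cmodM lerD2r; apply: ler_pM => //; try exact: cmod_ge0.
  exact: IH.
by have := ler_norm r; lra.
Qed.

(** Factor theorem for [p - p.[z]%:P]. The polynomial [q] is the difference quotient at [z]; bounds
    on it replace bounds on a derivative. *)
Lemma poly_increment (p : {poly complex R}) z :
  exists q : {poly complex R}, forall w, p.[w] - p.[z] = (w - z) * q.[w].
Proof.
have /factor_theorem[q qE] : root (p - p.[z]%:P) z.
  by rewrite /root hornerD hornerN hornerC subrr.
exists q => w.
have := congr1 (fun u => u.[w]) qE.
by rewrite hornerM hornerD hornerN hornerC hornerXsubC mulrC.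
Qed.

Lemma horner_continuous (p : {poly complex R}) :
  continuous (fun z : Cplane R => p.[z] : Cplane R).
Proof.
move=> z A /nbhs_disc[e e0 eA].
have [q qE] := poly_increment p z.
have [B B0 HB] := poly_bounded q (cmod z + 1).
apply/nbhs_disc; exists (Num.min 1 (e / B)).
  by rewrite lt_min ltr01 divr_gt0.
move=> y; rewrite /disc /= lt_min ltr_pdivlMr // => /andP[y1 ye].
apply: eA; rewrite /disc /= qE cmodM; apply: le_lt_trans ye.
apply: ler_wpM2l; first exact: cmod_ge0.
by apply: HB; have := cmodD (y - z) z; rewrite subrK; lra.
Qed.

End PlaneTopology.

(** * The Riemann sphere *)

Section Sphere.
Context (R : realType).
Implicit Types (z w c : Cplane R) (x y : sphere R) (e d : R).

Lemma ball3E (p q : R * R * R) e :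
  ball p e q <-> [/\ `|p.1.1 - q.1.1| < e, `|p.1.2 - q.1.2| < e & `|p.2 - q.2| < e].
Proof.
case: p q => [[p1 p2] p3] [[q1 q2] q3]; split; first by move=> [[? ?] ?]; split.
by move=> [? ? ?]; split => //; split.
Qed.

Lemma stereographicE z : stereographic (Some z) =
  (2 * complex.Re z / (cmod z ^+ 2 + 1), 2 * complex.Im z / (cmod z ^+ 2 + 1),
   (cmod z ^+ 2 - 1) / (cmod z ^+ 2 + 1)).
Proof. by rewrite cmod_sqr; case: z. Qed.

(** The classical formula for the chordal distance, cleared of denominators. Both comparisons with
    the plane distance rest on it: [stereographic_lipschitz] bounds the two factors below by 1,
    [chordal_plane] bounds them above. *)
Lemma chordal_identity z w p q :
  p = stereographic (Some z) -> q = stereographic (Some w) ->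
  ((p.1.1 - q.1.1) ^+ 2 + (p.1.2 - q.1.2) ^+ 2 + (p.2 - q.2) ^+ 2)
    * ((cmod z ^+ 2 + 1) * (cmod w ^+ 2 + 1)) = 4 * cmod (z - w) ^+ 2.
Proof.
rewrite !stereographicE => -> -> /=; rewrite !cmod_sqr ReB ImB.
case: z w => a b [c d] /=.
have h1 : a ^+ 2 + b ^+ 2 + 1 != 0.
  by rewrite gt_eqF // ltr_wpDl // addr_ge0 // sqr_ge0.
have h2 : c ^+ 2 + d ^+ 2 + 1 != 0.
  by rewrite gt_eqF // ltr_wpDl // addr_ge0 // sqr_ge0.
by field; rewrite h1 h2.
Qed.

Lemma stereographic_lipschitz z w e : 2 * cmod (z - w) < e ->
  ball (stereographic (Some z)) e (stereographic (Some w)).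
Proof.
move=> zw; set p := stereographic _; set q := stereographic _.
have H := chordal_identity (erefl p) (erefl q).
have e0 : 0 <= e by have := cmod_ge0 (z - w); lra.
have D : (p.1.1 - q.1.1) ^+ 2 + (p.1.2 - q.1.2) ^+ 2 + (p.2 - q.2) ^+ 2 < e ^+ 2.
  have := cmod_ge0 (z - w); have := sqr_ge0 (cmod z); have := sqr_ge0 (cmod w).
  have := sqr_ge0 (p.1.1 - q.1.1); have := sqr_ge0 (p.1.2 - q.1.2).
  have := sqr_ge0 (p.2 - q.2); move: H.
  set u := _ ^+ 2 + _ + _; move=> H h1 h2 h3 h4 h5 h6.
  have u0 : 0 <= u by rewrite /u; lra.
  have : u <= 4 * cmod (z - w) ^+ 2.
    by rewrite -H; apply: ler_peMr => //; nra.
  by move=> /le_lt_trans; apply; nra.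
have := sqr_ge0 (p.1.1 - q.1.1); have := sqr_ge0 (p.1.2 - q.1.2).
have := sqr_ge0 (p.2 - q.2) => h1 h2 h3.
by apply/ball3E; split;
  rewrite -(ltr_pXn2r (n := 2)) // ?nnegrE // real_normK ?num_real //; lra.
Qed.

Lemma fin_pt_lipschitz z w e : 2 * cmod (z - w) < e -> ball (fin_pt z) e (fin_pt w).
Proof. exact: stereographic_lipschitz. Qed.

Lemma fin_pt_continuous : continuous (@fin_pt R : Cplane R -> sphere R).
Proof.
move=> z A /nbhs_ballP[e /= e0 eA]; apply/nbhs_disc; exists (e / 2); first by lra.
move=> y; rewrite /disc /= => yz; apply: eA; apply: fin_pt_lipschitz.
by rewrite cmod_distC; lra.
Qed.

Lemma chordal_plane c e : 0 < e -> exists2 d, 0 < d &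
  forall x, ball (fin_pt c) d x -> exists2 w, x = fin_pt w & cmod (w - c) < e.
Proof.
move=> e0; pose k := cmod c ^+ 2 + 1.
have k1 : 1 <= k by rewrite /k lerDr sqr_ge0.
exists (Num.min 1 (e / 2) / k).
  by rewrite divr_gt0 ?lt_min ?ltr01 /=; lra.
move=> [w|]; last first.
  move=> /ball3E; rewrite [stereographic (fin_pt c)]stereographicE /= -/k => -[_ _].
  have -> : (cmod c ^+ 2 - 1) / k - 1 = - (2 / k).
    by rewrite /k; field; rewrite -/k gt_eqF //; lra.
  rewrite normrN gtr0_norm ?divr_gt0 //; last by lra.
  rewrite ltr_pM2r ?invr_gt0; last by lra.
  by rewrite lt_min => /andP[? _]; lra.
move=> /ball3E; pose p := stereographic (Some c); pose q := stereographic (Some w).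
rewrite -[stereographic (fin_pt c)]/p -[stereographic (Some w)]/q => -[h1 h2 h3].
have H := chordal_identity (erefl p) (erefl q).
exists w => //.
(* The third coordinate is [1 - 2 / j] with [j = |w|^2 + 1]; lying within [1 / k] of [1 - 2 / k], it
   keeps [w] away from infinity. *)
have wk : cmod w ^+ 2 + 1 < 2 * k.
  move: h3; rewrite /p /q !stereographicE /= -/k.
  set j := cmod w ^+ 2 + 1; have j1 : 1 <= j by rewrite /j lerDr sqr_ge0.
  have -> : (cmod c ^+ 2 - 1) / k - (cmod w ^+ 2 - 1) / j = 2 / j - 2 / k.
    by rewrite /k /j; field; rewrite -/k -/j !gt_eqF //; lra.
  move=> h; have {h} : `|2 / j - 2 / k| < 1 / k.
    by apply: lt_le_trans h _; rewrite ler_pM2r ?invr_gt0 ?ge_min ?lexx //; lra.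
  rewrite ltr_norml => /andP[+ _]; rewrite ltrBrDr.
  rewrite (_ : - (1 / k) + 2 / k = 1 / k); last by lra.
  rewrite ltr_pdivrMr; last by lra.
  rewrite mulrAC ltr_pdivlMr; lra.
rewrite -(ltr_pXn2r (n := 2)) // ?nnegrE ?cmod_ge0 //; last by lra.
have sq (t : R) : `|t| < Num.min 1 (e / 2) / k -> t ^+ 2 * k ^+ 2 < e ^+ 2 / 4.
  move=> tk; have : `|t| < e / 2 / k.
    by apply: lt_le_trans tk _; rewrite ler_pM2r ?invr_gt0 ?ge_min ?lexx ?orbT //; lra.
  rewrite ltr_pdivlMr; last by lra.
  move=> tk2; rewrite -[t ^+ 2]real_normK ?num_real // -exprMn.
  have u0 : 0 <= `|t| * k by rewrite mulr_ge0 ?normr_ge0 //; lra.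
  by move: tk2 u0; set u := _ * k => tk2 u0; nra.
have := sq _ h1; have := sq _ h2; have := sq _ h3.
move: H; rewrite (cmod_distC c) -/k.
set u1 := (_ - _) ^+ 2; set u2 := (_ - _) ^+ 2; set u3 := (_ - _) ^+ 2.
move: wk; set j := cmod w ^+ 2 + 1 => jk H s3 s2 s1.
have u0 : 0 <= u1 + u2 + u3 by rewrite !addr_ge0 ?sqr_ge0.
have : (u1 + u2 + u3) * (k * j) <= (u1 + u2 + u3) * (k * (2 * k)).
  by apply: ler_wpM2l => //; apply: ler_wpM2l; lra.
by move=> HH; rewrite H in HH; nra.
Qed.

Lemma open_fin_image (A : set (Cplane R)) : open A -> open (@fin_pt R @` A).
Proof.
rewrite !openE => oA _ [z Az <-] /=.
have /nbhs_disc[e e0 eA] := oA _ Az.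
have [d d0 H] := chordal_plane z e0.
apply/nbhs_ballP; exists d => // x /H[w -> wz].
by exists w => //; exact: eA.
Qed.

Lemma fin_pt_inj : injective (@fin_pt R).
Proof. by move=> z w []. Qed.

Lemma planar_image (A : set (Cplane R)) : planar (@fin_pt R @` A) = A.
Proof.
apply/seteqP; split=> z; first by move=> [w Aw /fin_pt_inj <-].
by move=> Az; exists z.
Qed.

Lemma ball_infinity e : 0 < e -> exists2 r, 0 < r &
  forall z, r <= cmod z -> ball (inf_pt R) e (fin_pt z).
Proof.
move=> e0; exists (1 + 4 / e); first by rewrite addr_gt0 // divr_gt0.
move=> z zr.
have z1 : 1 < cmod z by apply: lt_le_trans zr; rewrite ltrDl divr_gt0.
have ze : 4 < e * cmod z.
  rewrite mulrC -ltr_pdivrMr //; apply: lt_le_trans zr.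
  by rewrite ltrDr.
have m0 : 0 < cmod z ^+ 2 + 1 by nra.
apply/ball3E; rewrite [stereographic (fin_pt z)]stereographicE /=.
have small (t : R) : `|t| <= cmod z -> `|0 - 2 * t / (cmod z ^+ 2 + 1)| < e.
  move=> tz; rewrite sub0r normrN normrM normfV (gtr0_norm m0) ltr_pdivrMr //.
  rewrite normrM gtr0_norm //; nra.
split; [exact/small/normr_Re_le|exact/small/normr_Im_le|].
have -> : 1 - (cmod z ^+ 2 - 1) / (cmod z ^+ 2 + 1) = 2 / (cmod z ^+ 2 + 1).
  by field; rewrite gt_eqF.
by rewrite gtr0_norm ?divr_gt0 // ltr_pdivrMr //; nra.
Qed.

Lemma open_exterior (r : R) :
  open [set x : sphere R | if x is Some z then r < cmod z else True].
Proof.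
rewrite openE => -[z /= rz|_].
  have O := open_fin_image (@codisc_open _ (0 : Cplane R) r).
  have : nbhs (fin_pt z) (@fin_pt R @` [set y | r < cmod (y - 0)]).
    by apply: open_nbhs_nbhs; split => //; exists z => //; rewrite /= subr0.
  by apply: filterS => _ [w + <-]; rewrite /= subr0.
apply/nbhs_ballP; pose k := r ^+ 2 + 2.
have k2 : 2 <= k by rewrite /k lerDr sqr_ge0.
exists (1 / k); first by rewrite /= divr_gt0 //; lra.
move=> [w|//] /ball3E[_ _]; rewrite [stereographic (Some w)]stereographicE /=.
set j := cmod w ^+ 2 + 1; have j1 : 1 <= j by rewrite /j lerDr sqr_ge0.
have -> : 1 - (cmod w ^+ 2 - 1) / j = 2 / j.
  by rewrite /j; field; rewrite -/j gt_eqF //; lra.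
rewrite gtr0_norm ?divr_gt0 //; last by lra.
rewrite ltr_pdivrMr; last by lra.
rewrite mulrAC mul1r ltr_pdivlMr; last by lra.
rewrite /j /k => H; have w0 := cmod_ge0 w.
have [r0|r0] := ltP r 0; first by apply: lt_le_trans w0.
rewrite -(ltr_pXn2r (n := 2)) // ?nnegrE //.
by nra.
Qed.

Lemma stereographic_norm x : 
  let p := stereographic x in p.1.1 ^+ 2 + p.1.2 ^+ 2 + p.2 ^+ 2 = 1.
Proof.
case: x => [z|]; last by rewrite /= expr0n /= !add0r expr1n.
rewrite stereographicE /= !cmod_sqr; case: z => a b /=.
have h1 : a ^+ 2 + b ^+ 2 + 1 != 0.
  by rewrite gt_eqF // ltr_wpDl // addr_ge0 // sqr_ge0.
by field; rewrite h1.
Qed.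

(** The north pole comes from infinity, any other point from its stereographic projection
    [(a + ib) / (1 - c)]. *)
Lemma stereographic_surj (p : R * R * R) :
  p.1.1 ^+ 2 + p.1.2 ^+ 2 + p.2 ^+ 2 = 1 -> exists x, stereographic x = p.
Proof.
case: p => [[a b] c] /= H; have [c1|c1] := eqVneq c 1.
  have : a ^+ 2 + b ^+ 2 = 0 by move: H; rewrite c1; lra.
  move=> /eqP; rewrite paddr_eq0 ?sqr_ge0 // !expf_eq0 /= => /andP[/eqP -> /eqP ->].
  by exists None; rewrite c1.
have d0 : 1 - c != 0 by rewrite subr_eq0 eq_sym.
have mE : (a / (1 - c)) ^+ 2 + (b / (1 - c)) ^+ 2 = (1 + c) / (1 - c).
  rewrite !expr_div_n -mulrDl (_ : a ^+ 2 + b ^+ 2 = (1 + c) * (1 - c)).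
    by field.
  by move: H; lra.
exists (Some (Complex (a / (1 - c)) (b / (1 - c)))); rewrite /= mE.
have -> : (1 + c) / (1 - c) + 1 = 2 / (1 - c) by field.
have -> : (1 + c) / (1 - c) - 1 = 2 * c / (1 - c) by field.
by congr (_, _, _); field; rewrite d0.
Qed.

End Sphere.

(** * Polynomials as maps of the plane *)

Section PolynomialMaps.
Context (R : realType).
Implicit Types (z w : complex R) (p q k : {poly complex R}) (e d : R).

(* The modulus of [p] at [z] is that of the leading coefficient times the
   distances from [z] to the roots. *)
Lemma root_near p z e : 0 < e -> (1 < size p)%N ->
  cmod p.[z] < cmod (lead_coef p) * e ^+ (size p).-1 ->
  exists2 w, root p w & cmod (w - z) < e.
Proof.
move=> e0 p1; have [s sE] := closed_field_poly_normal p.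
have p0 : p != 0 by rewrite -size_poly_gt0; apply: leq_trans p1.
have l0 : lead_coef p != 0 by rewrite lead_coef_eq0.
have szE : (size p).-1 = size s.
  by rewrite sE size_scale // size_prod_XsubC.
rewrite szE => small.
case: (pselect (exists2 w, w \in s & cmod (w - z) < e)) => [[w ws wz]|far].
  exists w => //; rewrite sE rootZ // root_prod_XsubC //.
exfalso; move: small; apply/negP; rewrite -leNgt.
rewrite {2}sE hornerZ cmodM ler_wpM2l ?cmod_ge0 // horner_prod.
have : forall w, w \in s -> e <= cmod (w - z).
  by move=> w ws; rewrite leNgt; apply/negP => wz; apply: far; exists w.
elim: (s) => [|a t IH] at_; first by rewrite big_nil cmod1.
rewrite big_cons cmodM exprS; apply: ler_pM; rewrite ?exprn_ge0 ?(ltW e0) //.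
  by rewrite hornerXsubC cmod_distC; apply: at_; rewrite mem_head.
by apply: IH => w wt; apply: at_; rewrite in_cons wt orbT.
Qed.

Lemma lead_coefBC p (c : complex R) : (1 < size p)%N ->
  size (p - c%:P) = size p /\ lead_coef (p - c%:P) = lead_coef p.
Proof.
move=> p1; have sc : (size (- c%:P) < size p)%N.
  by rewrite size_polyN size_polyC; apply: leq_ltn_trans p1; exact: leq_b1.
by rewrite size_polyDl // lead_coefDl.
Qed.

Lemma lead_pow_gt0 p e : 0 < e -> (1 < size p)%N ->
  0 < cmod (lead_coef p) * e ^+ (size p).-1.
Proof.
move=> e0 p1; rewrite mulr_gt0 ?exprn_gt0 // cmod_gt0 lead_coef_eq0.
by rewrite -size_poly_gt0; apply: leq_trans p1.
Qed.

Lemma poly_surj p w : (1 < size p)%N -> exists z, p.[z] = w.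
Proof.
move=> p1; have [sz _] := lead_coefBC w p1.
have /closed_rootP[z] : size (p - w%:P) != 1%N by rewrite sz gtn_eqF.
by rewrite /root hornerD hornerN hornerC subr_eq0 => /eqP zw; exists z.
Qed.

Lemma poly_preimage_near p z w e : 0 < e -> (1 < size p)%N ->
  cmod (p.[z] - w) < cmod (lead_coef p) * e ^+ (size p).-1 ->
  exists2 y, p.[y] = w & cmod (y - z) < e.
Proof.
move=> e0 p1 H; have [sz lz] := lead_coefBC w p1.
have [||y] := @root_near (p - w%:P) z e e0; rewrite ?sz ?lz //.
  by rewrite hornerD hornerN hornerC.
rewrite /root hornerD hornerN hornerC subr_eq0 => /eqP yw yz.
by exists y.
Qed.

(** An open mapping theorem with explicit radius: the roots of [p - w] show that every [w] close
    enough to [p.[z]] has a preimage within [e] of [z]. *)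
Lemma poly_open p (A : set (Cplane R)) : (1 < size p)%N -> open A ->
  open ((fun z : Cplane R => p.[z] : Cplane R) @` A).
Proof.
move=> p1; rewrite !openE => oA _ [z Az <-].
have /nbhs_disc[e e0 eA] := oA _ Az.
apply/nbhs_disc; exists (cmod (lead_coef p) * e ^+ (size p).-1).
  exact: lead_pow_gt0.
move=> w; rewrite /disc /= cmod_distC => /(poly_preimage_near e0 p1)[y yw yz].
by exists y => //; exact: eA.
Qed.

(** A value [w] outside the image has finitely many preimages, all with discs of a common radius
    outside [A]. If [p.[z]] were too close to [w] for some [z] in [A], then [z] would lie in one of
    these discs by [root_near]. *)
Lemma poly_closed p (A : set (Cplane R)) : (1 < size p)%N -> closed A ->
  closed ((fun z : Cplane R => p.[z] : Cplane R) @` A).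
Proof.
move=> p1 cA; rewrite -openC openE => w nw.
have [sz _] := lead_coefBC w p1.
have pn0 : p - w%:P != 0 by rewrite -size_poly_gt0 sz (leq_trans _ p1).
have [s sE] := closed_field_poly_normal (p - w%:P).
have oA : open (~` A) by rewrite openC.
have [e e0 He] : exists2 e, 0 < e & forall z, z \in s -> disc (z : Cplane R) e `<=` ~` A.
  have ns z : z \in s -> ~ A z.
    move=> zs Az; apply: nw; exists z => //.
    have : root (p - w%:P) z.
      by rewrite sE rootZ ?lead_coef_eq0 // root_prod_XsubC.
    by rewrite /root hornerD hornerN hornerC subr_eq0 => /eqP.
  elim: (s) ns => [|a t IH] ns; first by exists 1.
  have [|e e0 He] := IH; first by move=> z zt; apply: ns; rewrite in_cons zt orbT.
  have : nbhs (a : Cplane R) (~` A).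
    by apply: open_nbhs_nbhs; split => //; apply: ns; rewrite mem_head.
  move=> /nbhs_disc[d d0 Hd]; exists (Num.min e d); first by rewrite lt_min e0.
  move=> z; rewrite in_cons => /orP[/eqP ->|zt] y; rewrite /disc /= lt_min => /andP[ye yd].
    exact: Hd.
  exact: (He z zt).
apply/nbhs_disc; exists (cmod (lead_coef p) * e ^+ (size p).-1).
  exact: lead_pow_gt0.
move=> _ /[swap] -[z Az <-]; rewrite /disc /= => H.
have lz : lead_coef (p - w%:P) = lead_coef p by have [_ ->] := lead_coefBC w p1.
have [||y yr yz] := @root_near (p - w%:P) z e e0; rewrite ?sz ?lz //.
  by rewrite hornerD hornerN hornerC.
move: yr; rewrite sE rootZ ?lead_coef_eq0 // root_prod_XsubC => ys.
by apply: (He y ys z) Az; rewrite /disc /= cmod_distC.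
Qed.

(** Maximum principle for [k / p]. At an interior maximum [y1] with value [w1 != 0], the polynomial
    [k - (1 + t) w1 p] takes the small value [- t k.[y1]], so it has a root near [y1]; there [k / p]
    equals [(1 + t) w1], which is too large. *)
Lemma max_modulus k p z e (B : R) : 0 < e -> 0 <= B -> size k != size p ->
  (forall y, cmod (y - z) <= e -> p.[y] != 0) ->
  (forall y, cmod (y - z) = e -> cmod k.[y] <= B * cmod p.[y]) ->
  forall y, cmod (y - z) <= e -> cmod k.[y] <= B * cmod p.[y].
Proof.
move=> e0 B0 kp pn0 HB.
pose D := [set y : Cplane R | cmod (y - z) <= e].
have D0 : D !=set0 by exists z; rewrite /D /= subrr cmod0 ltW.
pose f (y : Cplane R) : R := cmod k.[y] / cmod p.[y].
have cf : {within D, continuous f}.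
  apply: continuous_in_subspaceT => y /set_mem Dy.
  have cm q (x : Cplane R) :
      {for x, continuous (fun y : Cplane R => cmod (q : {poly complex R}).[y] : R)}.
    apply: (@continuous_comp _ _ _ (fun y : Cplane R => q.[y] : Cplane R)
      (cmod : Cplane R -> R)); first exact: horner_continuous.
    exact: cmod_continuous.
  rewrite /f; apply: (@continuousM _ _ (fun y : Cplane R => cmod k.[y])
    (fun y : Cplane R => (cmod p.[y])^-1)); first exact: cm.
  apply: (@continuousV _ _ (fun y : Cplane R => cmod p.[y])); last exact: cm.
  by rewrite cmod_eq0; exact: pn0.
have [y1 Dy1 max1] : exists2 y1 : complex R, cmod (y1 - z) <= e &
    forall t : complex R, cmod (t - z) <= e -> f t <= f y1.
  have [y1 /set_mem Dy1 max1] := compact_EVT_max D0 (@closed_disc_compact R z e) cf.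
  by exists y1 => // t te; apply: max1; rewrite inE.
suff fB : f y1 <= B.
  move=> y ye; have p0 : 0 < cmod p.[y] by rewrite cmod_gt0 pn0.
  rewrite -ler_pdivrMr //; apply: le_trans fB.
  exact: max1.
have p1 : 0 < cmod p.[y1] by rewrite cmod_gt0 pn0.
have [y1e|y1e] := eqVneq (cmod (y1 - z)) e.
  by rewrite /f ler_pdivrMr //; exact: HB.
have y1e' : cmod (y1 - z) < e by rewrite lt_neqAle y1e.
have [k0|k0] := eqVneq k.[y1] 0; first by rewrite /f k0 cmod0 mul0r.
exfalso.
have K0 : 0 < cmod k.[y1] by rewrite cmod_gt0.
have kn0 : k != 0 by apply: contra_neq k0 => ->; rewrite horner0.
have qn0 : p != 0 by apply: contraTneq p1 => ->; rewrite horner0 cmod0 ltxx.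
pose w1 := k.[y1] / p.[y1].
have w1n0 : w1 != 0.
  by rewrite /w1 mulf_neq0 // invr_eq0 -cmod_eq0 gt_eqF.
pose d := e - cmod (y1 - z).
have d0 : 0 < d by rewrite /d subr_gt0.
(* As the sizes differ, the leading coefficient of [k - (1 + t) w1 p] comes from [k] alone or from
   [p] alone, so it does not degenerate as [t] tends to 0. *)
have [c c0 Hc] : exists2 c, 0 < c & forall t : R, 0 <= t ->
    let q := k - ((1 + t)%:C%C * w1) *: p in
    (1 < size q)%N /\ c <= cmod (lead_coef q) * d ^+ (size q).-1.
  have wt t : 0 <= t -> (1 + t)%:C%C * w1 != 0.
    move=> t0; rewrite mulf_neq0 // -cmod_eq0 cmod_real gt_eqF // normr_gt0.
    by rewrite gt_eqF // ltr_wpDr.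
  move: kp; rewrite neq_ltn => /orP[kp|kp].
    exists (cmod (w1 * lead_coef p) * d ^+ (size p).-1).
      by rewrite mulr_gt0 ?exprn_gt0 // cmod_gt0 mulf_neq0 // lead_coef_eq0.
    move=> t t0 q; have szE : size (- (((1 + t)%:C%C * w1) *: p)) = size p.
      by rewrite size_polyN size_scale // wt.
    rewrite /q addrC size_polyDl ?szE // lead_coefDl ?szE //; split.
      by rewrite (leq_ltn_trans _ kp) // size_poly_gt0.
    rewrite lead_coefN lead_coefZ cmodN !cmodM cmod_real ger0_norm; last by lra.
    apply: ler_wpM2r; first by rewrite exprn_ge0 // ltW.
    apply: ler_wpM2r; first exact: cmod_ge0.
    by rewrite -[leLHS]mul1r; apply: ler_wpM2r; [rewrite ?mulr_ge0 ?cmod_ge0|lra].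
  exists (cmod (lead_coef k) * d ^+ (size k).-1).
    by rewrite mulr_gt0 ?exprn_gt0 // cmod_gt0 lead_coef_eq0.
  move=> t t0 q; have szE : size (- (((1 + t)%:C%C * w1) *: p)) = size p.
    by rewrite size_polyN size_scale // wt.
  rewrite /q size_polyDl ?szE // lead_coefDl ?szE //; split => //.
  by rewrite (leq_ltn_trans _ kp) // size_poly_gt0.
(* With this [t] the value at [y1] has modulus [c / 2], below the threshold [c] of [root_near]. *)
pose t := c / (2 * cmod k.[y1]).
have t0 : 0 < t by rewrite divr_gt0 // mulr_gt0.
have [sq lq] := Hc t (ltW t0).
have py1 : p.[y1] != 0 by rewrite -cmod_eq0 gt_eqF.
have [|y] := @root_near _ y1 d d0 sq.
  apply: lt_le_trans lq.
  rewrite hornerD hornerN hornerZ /w1 -mulrA divfK //.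
  rewrite rmorphD rmorph1 mulrDl mul1r opprD addrA subrr add0r cmodN cmodM cmod_real.
  rewrite gtr0_norm // (_ : t * _ = c / 2); first by lra.
  by rewrite /t; field; rewrite gt_eqF.
rewrite /root hornerD hornerN hornerZ subr_eq0 => /eqP ky yy1.
have Dy : cmod (y - z) <= e.
  apply: le_trans (cmod_dist_triangle y1 y z) _; rewrite -lerBrDr; exact: ltW.
have := max1 y Dy; apply/negP; rewrite -ltNge.
rewrite /f ky cmodM -mulrA divff ?mulr1; last by rewrite cmod_eq0 pn0.
rewrite cmodM cmod_real /w1 cmodM cmodV ltr_pMl; last by rewrite divr_gt0.
by rewrite gtr0_norm ?ltrDl // addr_gt0.
Qed.

(** The change of size is what [max_modulus] asks of the quotient [q / p] in [inv_lipschitz]. *)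
Lemma poly_increment_size p z : (0 < size p)%N ->
  exists2 q : {poly complex R}, size q != size p & forall w, p.[w] - p.[z] = (w - z) * q.[w].
Proof.
move=> p0; have /factor_theorem[q qE] : root (p - p.[z]%:P) z.
  by rewrite /root hornerD hornerN hornerC subrr.
exists q => [|w]; last first.
  have := congr1 (fun u => u.[w]) qE.
  by rewrite hornerM hornerD hornerN hornerC hornerXsubC mulrC.
apply/eqP => qp; have q0 : q != 0 by rewrite -size_poly_gt0 qp.
have := congr1 (size \o polyseq) qE; rewrite /= size_Mmonic ?monicXsubC // size_XsubC addn2 /= qp => H.
have : (size (p - p.[z]%:P)%R <= size p)%N.
  apply: leq_trans (size_polyD _ _) _; rewrite geq_max leqnn /=.
  by rewrite size_polyN size_polyC; apply: leq_trans p0; exact: leq_b1.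
by rewrite H ltnn.
Qed.

(** As in Schwarz's lemma: the difference quotient is at most [2 B / e] on the boundary circle,
    hence inside by the maximum principle with denominator 1. *)
Lemma bounded_lipschitz p z e (B : R) : 0 < e ->
  (forall y, cmod (y - z) <= e -> cmod p.[y] <= B) ->
  forall y, cmod (y - z) <= e -> cmod (p.[y] - p.[z]) <= 2 * B / e * cmod (y - z).
Proof.
move=> e0 HB.
have B0 : 0 <= B.
  by apply: le_trans (HB z _); rewrite ?cmod_ge0 // subrr cmod0 ltW.
have [q qE] := poly_increment p z.
have bd y : cmod (y - z) = e -> cmod q.[y] <= 2 * B / e.
  move=> ye; rewrite ler_pdivlMr // mulrC -{1}ye -cmodM -qE.
  apply: le_trans (cmodB_le _ _) _.
  have := HB y; rewrite ye => /(_ (lexx _)).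
  have := HB z; rewrite subrr cmod0 => /(_ (ltW e0)); lra.
have BB : 0 <= 2 * B / e by rewrite divr_ge0 ?mulr_ge0 // ltW.
have Q y : cmod (y - z) <= e -> cmod q.[y] <= 2 * B / e.
  (* A constant [q] has the same size as the denominator 1, so [max_modulus] does not cover it; its
     value is read off at a boundary point. *)
  have [/eqP q1 ye|q1 ye] := boolP (size q == 1%N).
    have /size_poly1P[c _ qc] : size q == 1%N by apply/eqP.
    have := bd (z + e%:C%C); rewrite addrAC subrr add0r cmod_real gtr0_norm //.
    by rewrite qc !hornerC; apply.
  have := @max_modulus q 1 z e (2 * B / e) e0 BB.
  rewrite size_polyC oner_neq0 => /(_ q1) H.
  have := H _ _ y ye; rewrite hornerC cmod1 mulr1; apply.
    by move=> *; rewrite hornerC oner_neq0.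
  by move=> x xe; rewrite hornerC cmod1 mulr1; exact: bd.
move=> y ye; rewrite qE cmodM mulrC; apply: ler_wpM2r; first exact: cmod_ge0.
exact: Q.
Qed.

(** The difference quotient of [1 / p] is [- q / (p p.[z])], so the maximum principle for [q / p]
    plays the part it has in [bounded_lipschitz]. *)
Lemma inv_lipschitz p z e d : 0 < e -> 0 < d ->
  (forall y, cmod (y - z) <= e -> d <= cmod p.[y]) ->
  forall y, cmod (y - z) <= e ->
    cmod (p.[y]^-1 - p.[z]^-1) <= 2 / (d * e) * cmod (y - z).
Proof.
move=> e0 d0 Hd.
have zz : cmod (z - z) <= e by rewrite subrr cmod0 ltW.
have pn0 y : cmod (y - z) <= e -> p.[y] != 0.
  by move=> /Hd yd; rewrite -cmod_gt0; apply: lt_le_trans yd.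
have p0 : (0 < size p)%N.
  by rewrite size_poly_gt0; apply: contraNneq (pn0 z zz) => ->; rewrite horner0.
have [q qp qE] := poly_increment_size z p0.
have invE y : cmod (y - z) <= e ->
    cmod (p.[y]^-1 - p.[z]^-1) = cmod (y - z) * cmod q.[y] / (cmod p.[y] * cmod p.[z]).
  move=> ye; rewrite -!cmodM -cmodV -cmodM -qE -cmodN; congr cmod.
  by field; rewrite !pn0.
have inv_le y : cmod (y - z) <= e -> cmod (p.[y]^-1 - p.[z]^-1) <= 2 / d.
  move=> ye; apply: le_trans (cmodB_le _ _) _; rewrite !cmodV.
  have h x : cmod (x - z) <= e -> (cmod p.[x])^-1 <= d^-1.
    by move=> /Hd xd; rewrite lef_pV2 ?posrE //; apply: lt_le_trans xd.
  by have := h y ye; have := h z zz; lra.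
have pz0 : 0 < cmod p.[z] by rewrite cmod_gt0 pn0.
pose B := 2 / (d * e) * cmod p.[z].
have B0 : 0 <= B by rewrite mulr_ge0 ?cmod_ge0 // divr_ge0 // mulr_ge0 // ltW.
have H := @max_modulus q p z e B e0 B0 qp pn0.
move=> y ye; rewrite invE // -mulrA [leRHS]mulrC.
apply: ler_wpM2l; first exact: cmod_ge0.
have py0 : 0 < cmod p.[y] by rewrite cmod_gt0 pn0.
rewrite ler_pdivrMr ?mulr_gt0 //.
rewrite [leRHS](_ : _ = B * cmod p.[y]); last by rewrite /B; ring.
apply: H => // x xe; have xle : cmod (x - z) <= e by rewrite xe.
have := inv_le x xle; rewrite invE // xe.
have px0 : 0 < cmod p.[x] by rewrite cmod_gt0 pn0.
rewrite ler_pdivrMr ?mulr_gt0 // => HH.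
rewrite -(ler_pM2l e0); apply: le_trans HH _.
by rewrite /B le_eqVlt; apply/orP; left; apply/eqP; field; rewrite !gt_eqF.
Qed.

End PolynomialMaps.

(** * Normal families *)

Lemma diagonal_extraction (P : nat -> nat -> Prop) :
  (forall k N, exists2 n, (N <= n)%N & P k n) ->
  exists phi : nat -> nat, {homo phi : m n / (m < n)%N} /\ forall k, P k (phi k).
Proof.
move=> H.
have /choice[s Hs] (kN : nat * nat) : exists n, (kN.2 <= n)%N /\ P kN.1 n.
  by have [n ? ?] := H kN.1 kN.2; exists n.
pose phi := fix phi k := if k is k'.+1 then s (k, (phi k').+1) else s (0, 0)%N.
exists phi; split; last by case=> [|k]; [exact: (Hs (0, 0)%N).2|exact: (Hs (k.+1, (phi k).+1)).2].
by apply: homo_ltn => [? ? ?|k]; [exact: ltn_trans|exact: (Hs (k.+1, (phi k).+1)).1].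
Qed.

Lemma extraction (P : nat -> Prop) : (forall N, exists2 n, (N <= n)%N & P n) ->
  exists phi : nat -> nat, {homo phi : m n / (m < n)%N} /\ forall k, P (phi k).
Proof. by move=> H; apply: (@diagonal_extraction (fun=> P)). Qed.

Lemma homo_geq_id (phi : nat -> nat) :
  {homo phi : m n / (m < n)%N} -> forall n, (n <= phi n)%N.
Proof. by move=> hp; elim=> // n IH; apply: leq_ltn_trans IH (hp _ _ _). Qed.

Section Normality.
Context (R : realType).
Implicit Types (z w c : Cplane R) (x y : sphere R) (e d : R).
Implicit Types (p h : {poly complex R}) (F G : set {poly complex R}) (K L : set (sphere R)).

Definition unif_cvg (K : set (sphere R)) (f : nat -> sphere R -> sphere R)
    (g : sphere R -> sphere R) :=
  forall e, 0 < e -> exists N, forall n, (N <= n)%N ->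
    forall x, K x -> ball (g x) e (f n x).

Lemma unif_cvgP (K : set (sphere R)) f g :
  {uniform K, f @ \oo --> g} <-> unif_cvg K f g.
Proof.
split=> [H e e0|H].
  have [|N _ HN] := H [set h | forall y, K y -> ball (g y) e (h y)].
    apply/uniform_nbhs; exists [set xy | ball xy.1 e xy.2]; split => //.
    by rewrite -entourage_ballE; exists e.
  by exists N => n /HN.
move=> P /uniform_nbhs[E [+ EP]]; rewrite -entourage_ballE => -[e /= e0 eE].
have [N HN] := H e e0; exists N => // n /= Nn.
by apply: EP => y /(HN n Nn) gf; exact: eE.
Qed.

Lemma unif_cvg_sub (K L : set (sphere R)) f g :
  K `<=` L -> unif_cvg L f g -> unif_cvg K f g.
Proof. by move=> KL H e /H[N HN]; exists N => n /HN fn x /KL/fn. Qed.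

(** Working form of [normal_on]: uniform convergence on one fixed set, along sequences of
    polynomials instead of maps. [normal_on_seq] and [seq_normal_on] pass between the two. *)
Definition seq_normal (K : set (sphere R)) F :=
  forall f : nat -> {poly complex R}, (forall n, F (f n)) ->
  exists phi : nat -> nat, {homo phi : m n / (m < n)%N} /\
  exists g, unif_cvg K (fun n => poly_map (f (phi n))) g.

Lemma seq_normal_sub (K L : set (sphere R)) F G :
  K `<=` L -> F `<=` G -> seq_normal L G -> seq_normal K F.
Proof.
move=> KL FG H f Ff; have [phi [hp [g Hg]]] := H f (fun n => FG _ (Ff n)).
by exists phi; split => //; exists g; exact: unif_cvg_sub KL Hg.
Qed.

Lemma seq_normalU K F G : seq_normal K F -> seq_normal K G -> seq_normal K (F `|` G).
Proof.
move=> HF HG f FGf.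
have sub A : seq_normal K A -> (forall N, exists2 n, (N <= n)%N & A (f n)) ->
    exists phi : nat -> nat, {homo phi : m n / (m < n)%N} /\ exists l : sphere R -> sphere R,
    unif_cvg K (fun n => poly_map (f (phi n))) l.
  move=> HA /extraction[phi [hphi Aphi]].
  have [psi [hpsi [g Hg]]] := HA _ Aphi.
  exists (phi \o psi); split; first by move=> m n mn; apply/hphi/hpsi.
  by exists g.
have [HN|] := pselect (forall N, exists2 n, (N <= n)%N & F (f n)).
  exact: (sub F).
move=> /existsNP[N HN]; apply: (sub G) => // M.
exists (maxn N M); first exact: leq_maxr.
have [Ff|//] := FGf (maxn N M).
by exfalso; apply: HN; exists (maxn N M) => //; exact: leq_maxl.
Qed.

Lemma seq_normal1 K p : seq_normal K [set p].
Proof.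
move=> f fp; exists id; split => //; exists (poly_map p) => e e0.
by exists 0%N => n _ x _; rewrite fp; exact: ballxx.
Qed.

Lemma seq_normal_comp K L F h : poly_map h @` K `<=` L ->
  seq_normal L F -> seq_normal K [set g \Po h | g in F].
Proof.
move=> hKL H f Ff.
have /choice[g Hg] n : exists g, F g /\ g \Po h = f n.
  by have [g ? ?] := Ff n; exists g.
have [phi [hp [l Hl]]] := H g (fun n => (Hg n).1).
exists phi; split => //; exists (l \o poly_map h).
move=> r r0; have [N HN] := Hl r r0; exists N => n Nn x Kx.
have -> : poly_map (f (phi n)) x = poly_map (g (phi n)) (poly_map h x).
  by rewrite -(Hg (phi n)).2; case: x {Kx} => [z|] //=; rewrite horner_comp.
by apply: HN => //; apply: hKL; exists x.
Qed.

Lemma seq_normal_tail K F (f : nat -> {poly complex R}) N : seq_normal K F ->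
  (forall n, (N <= n)%N -> F (f n)) ->
  exists phi : nat -> nat, {homo phi : m n / (m < n)%N} /\ exists l : sphere R -> sphere R,
    unif_cvg K (fun n => poly_map (f (phi n))) l.
Proof.
move=> H Ff; have [|phi [hp Hg]] := H (fun n => f (N + n)%N).
  by move=> n; apply: Ff; exact: leq_addr.
by exists (fun n => N + phi n)%N; split => // m n mn; rewrite ltn_add2l hp.
Qed.

Lemma normal_on_seq (U : set (sphere R)) F :
  seq_normal U F -> normal_on U (@poly_map R @` F).
Proof.
move=> H f Ff; have /choice[p Hp] n : exists p, F p /\ poly_map p = f n.
  by have [p ? ?] := Ff n; exists p.
have [phi [hp [g Hg]]] := H p (fun n => (Hp n).1).
exists phi; split => //; exists g; apply/fam_cvgP => K [KU _].
apply/unif_cvgP; apply: unif_cvg_sub KU _.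
suff -> : f \o phi = fun n => poly_map (p (phi n)) by [].
by apply/funext => n /=; rewrite (Hp _).2.
Qed.

Lemma seq_normal_on (U K : set (sphere R)) F : K `<=` U -> compact K ->
  normal_on U (@poly_map R @` F) -> seq_normal K F.
Proof.
move=> KU cK H f Ff.
have [|phi [hp [g Hg]]] := H (fun n => poly_map (f n)).
  by move=> n; exists (f n).
exists phi; split => //; exists g; apply/unif_cvgP.
by move/fam_cvgP : Hg; apply.
Qed.

Definition locally_normal F z := exists2 e, 0 < e & seq_normal (@fin_pt R @` disc z e) F.

(** Halving the radius puts a compact closed disc inside the given neighbourhood, where locally
    uniform convergence becomes uniform. *)
Lemma Fatou_locally_normal G z : Fatou G (fin_pt z) <-> locally_normal G z.
Proof.
split.
  move=> [U [oU Uz] HU].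
  have /nbhs_disc[e e0 eU] : nbhs z (@fin_pt R @^-1` U).
    by apply: fin_pt_continuous; exact: open_nbhs_nbhs.
  exists (e / 2); first by lra.
  pose K := @fin_pt R @` [set y | cmod (y - z) <= e / 2].
  apply: (@seq_normal_sub _ K _ G) => //.
    by move=> _ [y yz <-]; exists y => //; exact: ltW.
  apply: seq_normal_on HU.
    move=> _ [y /= yz <-]; apply: eU; rewrite /disc /=; apply: le_lt_trans yz _.
    by lra.
  apply: continuous_compact; last exact: closed_disc_compact.
  exact/continuous_subspaceT/fin_pt_continuous.
move=> [e e0 H]; exists (@fin_pt R @` disc z e); last exact: normal_on_seq.
split; first exact/open_fin_image/disc_open.
by exists z => //; exact: disc_center.
Qed.

Lemma Fatou_open G : open (Fatou G).
Proof.
rewrite openE => x [U [oU Ux] HU]; rewrite /interior.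
apply: (filterS (P := U)); last exact: open_nbhs_nbhs.
by move=> y Uy; exists U.
Qed.

Lemma Julia_closed G : closed (Julia G).
Proof. by rewrite /Julia; apply: open_closedC; exact: Fatou_open. Qed.

Lemma locally_normalS F G z : F `<=` G -> locally_normal G z -> locally_normal F z.
Proof. by move=> FG [e e0 H]; exists e => //; exact: seq_normal_sub FG H. Qed.

Lemma locally_normal1 p z : locally_normal [set p] z.
Proof. by exists 1 => //; exact: seq_normal1. Qed.

Lemma locally_normalU F G z : locally_normal F z -> locally_normal G z ->
  locally_normal (F `|` G) z.
Proof.
move=> [e e0 HF] [d d0 HG]; exists (Num.min e d); first by rewrite lt_min e0.
by apply: seq_normalU; [move: HF|move: HG]; apply: seq_normal_sub => //;
  apply: image_subset => y; rewrite /disc /= lt_min => /andP[].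
Qed.

Lemma locally_normal_comp F (h : {poly complex R}) z :
  locally_normal F h.[z] -> locally_normal [set g \Po h | g in F] z.
Proof.
move=> [e e0 H].
have /nbhs_disc[d d0 Hd] :
    nbhs z ((fun y : Cplane R => h.[y] : Cplane R) @^-1` disc (h.[z] : Cplane R) e).
  by apply: horner_continuous; exact: nbhs_disc_center.
exists d => //; apply: seq_normal_comp H => _ [_ [y yz <-] <-].
by exists h.[y] => //; exact: Hd.
Qed.

(** [h] maps the disc onto a neighbourhood of [h.[z]]. The limit at [w] is defined as the limit of
    the [g \Po h] at a chosen preimage of [w]; uniformity carries over for any choice. *)
Lemma locally_normal_image F G (h : {poly complex R}) z : (1 < size h)%N ->
  (forall g, G g -> F (g \Po h)) -> locally_normal F z -> locally_normal G h.[z].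
Proof.
move=> h1 GF [e e0 H].
have /nbhs_disc[d d0 Hd] : nbhs (h.[z] : Cplane R)
    ((fun y : Cplane R => h.[y] : Cplane R) @` disc z e).
  apply: open_nbhs_nbhs; split; first by apply: (@poly_open R h (disc z e) h1); exact: disc_open.
  by exists z => //; exact: disc_center.
exists d => // f Gf.
have [phi [hp [l Hl]]] := H _ (fun n => GF _ (Gf n)).
exists phi; split => //.
have /choice[s Hs] (w : Cplane R) : exists y : Cplane R, disc (h.[z] : Cplane R) d w ->
    disc z e y /\ h.[y] = w.
  have [/Hd[y ye yw]|nw] := pselect (disc (h.[z] : Cplane R) d w); last by exists 0.
  by exists y.
exists (fun x => if x is Some w then l (fin_pt (s w)) else x).
move=> r r0; have [N HN] := Hl r r0; exists N => n Nn _ [w wd <-] /=.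
have [ye yw] := Hs w wd.
have := HN n Nn (fin_pt (s w)); rewrite /= horner_comp yw; apply.
by exists (s w).
Qed.

(** Let [g] be a uniform limit near [z] and fix a late term [f (phi N)]. For [x] close to [z], four
    short chordal steps lead from [c] to a later value at [x], to [g] at [x], to [(f (phi N)).[x]]
    and to [(f (phi N)).[z]], which stays far from [c]. *)
Lemma not_normal_at F z c d (f : nat -> {poly complex R}) : 0 < d ->
  (forall n, F (f n)) -> (forall n, d <= cmod ((f n).[z] - c)) ->
  (forall e, 0 < e -> exists2 x, cmod (x - z) < e &
     forall r, 0 < r -> exists N, forall n, (N <= n)%N -> cmod ((f n).[x] - c) < r) ->
  ~ locally_normal F z.
Proof.
move=> d0 Ff far near [e e0 H].
have [phi [hp [g Hg]]] := H f Ff.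
have [r r0 Hr] := chordal_plane c d0.
have r4 : 0 < r / 4 by lra.
have [N HN] := Hg _ r4.
have ztop : disc z e z by exact: disc_center.
have /nbhs_disc[s s0 Hs] : nbhs z (fun y : Cplane R =>
    ball (fin_pt (f (phi N)).[z]) (r / 4) (fin_pt (f (phi N)).[y])).
  have := @nbhsx_ballx _ _ (fin_pt (f (phi N)).[z]) _ r4.
  by move=> /(fin_pt_continuous (x := (f (phi N)).[z] : Cplane R)) /horner_continuous.
have se0 : 0 < Num.min s e by rewrite lt_min s0.
have [x xz fx] := near _ se0.
have xs : disc z s x by move: xz; rewrite lt_min => /andP[].
have xe : disc z e x by move: xz; rewrite lt_min => /andP[].
have [M HM] := fx (r / 8) ltac:(by lra).
pose n := maxn N M.
have b1 : ball (fin_pt c) (r / 4) (fin_pt (f (phi n)).[x]).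
  apply: fin_pt_lipschitz; rewrite cmod_distC.
  have := HM (phi n) (leq_trans (leq_maxr _ _) (homo_geq_id hp n)).
  by set u := cmod _ => ?; lra.
have b2 : ball (g (fin_pt x)) (r / 4) (fin_pt (f (phi n)).[x]).
  by apply: (HN n (leq_maxl _ _) (fin_pt x)); exists x.
have b3 : ball (g (fin_pt x)) (r / 4) (fin_pt (f (phi N)).[x]).
  by apply: (HN N (leqnn _) (fin_pt x)); exists x.
have b4 : ball (fin_pt (f (phi N)).[z]) (r / 4) (fin_pt (f (phi N)).[x]) by exact: Hs.
have : ball (fin_pt c) r (fin_pt (f (phi N)).[z]).
  have -> : r = (r / 4 + r / 4) + (r / 4 + r / 4) by lra.
  apply: (ball_triangle (y := g (fin_pt x))).
    by apply: (ball_triangle b1); exact: ball_sym.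
  by apply: (ball_triangle b3); exact: ball_sym.
move=> /Hr[w [<-]]; apply/negP; rewrite -leNgt.
exact: far.
Qed.

End Normality.

(** * Montel's theorem *)

Section Montel.
Context (R : realType).
Implicit Types (z w c : Cplane R) (x y : Cplane R) (e d : R).
Implicit Types (F G : set {poly complex R}).

Definition clamp (a e t : R) : R := Num.max (a - e) (Num.min (a + e) t).

Lemma clamp_lipschitz (a e s t : R) : `|clamp a e s - clamp a e t| <= `|s - t|.
Proof.
have key (u v : R) : - `|s - t| <= u - v <= `|s - t| -> `|u - v| <= `|s - t|.
  by rewrite ler_norml.
have := ler_norm (s - t); have := ler_norm (t - s); rewrite (distrC t) => h1 h2.
apply: key; rewrite /clamp; move: (`|s - t|) h1 h2 (normr_ge0 (s - t)) => n h1 h2 n0.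
case: (leP (a + e) s) => h3; case: (leP (a + e) t) => h4;
  do ?[case: (leP (a - e) (a + e)) => h5|case: (leP (a - e) s) => h6
      |case: (leP (a - e) t) => h7]; apply/andP; split; lra.
Qed.

Lemma clamp_id (a e t : R) : `|t - a| <= e -> clamp a e t = t.
Proof.
rewrite ler_norml => /andP[? ?]; rewrite /clamp.
by rewrite min_r ?max_r //; lra.
Qed.

Lemma clamp_in (a e t : R) : 0 <= e -> `|clamp a e t - a| <= e.
Proof.
move=> e0; rewrite ler_norml /clamp; apply/andP.
case: (leP (a + e) t) => h1; last case: (leP (a - e) t) => h2; last by split; lra.
  by rewrite max_r; [split; lra|lra].
by split; lra.
Qed.

(** Nearest-point projection onto the square of half-side [e] about [z], which contains the disc of
    radius [e] and lies in that of radius [2 * e]. Composition with it extends maps controlled near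
    [z] to the whole plane, where Ascoli's theorem is applied. *)
Definition retraction z e x : Cplane R :=
  Complex (clamp (complex.Re z) e (complex.Re x)) (clamp (complex.Im z) e (complex.Im x)).

Lemma retraction_id z e x : cmod (x - z) <= e -> retraction z e x = x.
Proof.
move=> xz; have := le_trans (normr_Re_le _) xz; have := le_trans (normr_Im_le _) xz.
by rewrite ReB ImB /retraction => /clamp_id -> /clamp_id ->; case: x {xz}.
Qed.

Lemma retraction_in z e x : 0 <= e -> cmod (retraction z e x - z) <= 2 * e.
Proof.
move=> e0; apply: le_trans (cmod_le_ReIm _) _; rewrite ReB ImB /=.
by rewrite mulr2n mulrDl mul1r; apply: lerD; exact: clamp_in.
Qed.

Lemma retraction_lipschitz z e x y :
  cmod (retraction z e x - retraction z e y) <= 2 * cmod (x - y).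
Proof.
apply: le_trans (cmod_le_ReIm _) _; rewrite ReB ImB /= mulr2n mulrDl mul1r.
apply: lerD; apply: le_trans (clamp_lipschitz _ _ _ _) _.
  by rewrite -ReB; exact: normr_Re_le.
by rewrite -ImB; exact: normr_Im_le.
Qed.

Lemma locally_compact_plane : locally_compact [set: Cplane R].
Proof.
move=> z _; rewrite withinET.
exists [set y : Cplane R | cmod (y - z) <= 1].
  by apply/nbhs_disc; exists 1 => // y; rewrite /disc /= => /ltW.
by split; [exact: closed_disc_compact|exact: closed_disc_closed].
Qed.

Lemma stereographic_bound (x : sphere R) : let p := stereographic x in
  [/\ -1 <= p.1.1 <= 1, -1 <= p.1.2 <= 1 & -1 <= p.2 <= 1].
Proof.
have := stereographic_norm x => /=; case: (stereographic x) => [[a b] c] /= H.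
have := sqr_ge0 a; have := sqr_ge0 b; have := sqr_ge0 c => *.
by split; apply/andP; split; nra.
Qed.

Lemma unit_sphere_closed (p : R * R * R) :
  (forall d, 0 < d -> exists x : sphere R, ball p d (stereographic x)) ->
  exists x : sphere R, stereographic x = p.
Proof.
move=> H; apply: stereographic_surj.
apply/eqP; rewrite -subr_eq0 -normr_le0; apply/ler_addgt0Pr => e e0.
have m0 : 0 < Num.min 1 (e / 9) by rewrite lt_min ltr01 divr_gt0.
have [x /ball3E] := H _ m0.
have := stereographic_norm x; have := stereographic_bound x => /=.
case: (stereographic x) p {H} => [[a b] c] [[a' b'] c'] /=.
move=> [/andP[? ?] /andP[? ?] /andP[? ?]] N [].
have sq (t t' : R) : -1 <= t -> t <= 1 -> `|t' - t| < Num.min 1 (e / 9) ->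
    `|t' ^+ 2 - t ^+ 2| <= e / 3.
  rewrite lt_min !ltr_norml => t1 t2 /andP[/andP[? ?] /andP[? ?]].
  by rewrite ler_norml; apply/andP; split; nra.
move=> /sq h1 /sq h2 /sq h3; rewrite add0r -N.
have -> : a' ^+ 2 + b' ^+ 2 + c' ^+ 2 - (a ^+ 2 + b ^+ 2 + c ^+ 2) =
  (a' ^+ 2 - a ^+ 2) + (b' ^+ 2 - b ^+ 2) + (c' ^+ 2 - c ^+ 2) by ring.
apply: le_trans (ler_normD _ _) _; apply: le_trans (lerD (ler_normD _ _) (lexx _)) _.
have := h1 _ _; have := h2 _ _; have := h3 _ _.
by do 3 (move=> /(_ ltac:(assumption) ltac:(assumption)) ?); lra.
Qed.

Lemma sphere_hausdorff : hausdorff_space (sphere R).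
Proof.
move=> x y xy.
have H (e : R) : 0 < e -> ball (stereographic x) e (stereographic y).
  move=> e0; have e2 : 0 < e / 2 by lra.
  have [z [xz yz]] := xy _ _ (nbhsx_ballx x _ e2) (nbhsx_ballx y _ e2).
  rewrite (_ : e = e / 2 + e / 2); last by lra.
  exact: ball_triangle xz (ball_sym yz).
have E : stereographic x = stereographic y.
  have close (s t : R) : (forall e, 0 < e -> `|s - t| < e) -> s = t.
    move=> st; apply/eqP; rewrite -subr_eq0 -normr_le0; apply/ler_addgt0Pr => e e0.
    by rewrite add0r ltW // st.
  move: H; case: (stereographic x) (stereographic y) => [[a b] c] [[a' b'] c'] H.
  by congr (_, _, _); apply: close => e /H/ball3E[].
have aux (c : Cplane R) (u : sphere R) :
    stereographic (fin_pt c) = stereographic u -> fin_pt c = u.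
  move=> cu; have near (e : R) : 0 < e -> exists2 w, u = fin_pt w & cmod (w - c) < e.
    move=> e0; have [d d0 Hd] := chordal_plane c e0; apply: Hd.
    by rewrite /ball /= /initial_ball -cu; exact: ballxx.
  have [w uw _] := near 1 ltr01; rewrite uw; congr fin_pt; apply/eqP.
  rewrite eq_sym -subr_eq0 -cmod_eq0 eq_le cmod_ge0 andbT.
  apply/ler_addgt0Pr => e e0; rewrite add0r.
  by have [w'] := near e e0; rewrite uw => -[<-] /ltW.
case: x y E {xy H} => [z|] [w|] E //; first exact: aux.
  exact: aux.
by apply/esym; exact: aux.
Qed.

(** The filter is pushed into the compact cube. Its cluster point there is a limit of points of the
    unit sphere, hence itself a stereographic image. *)
Lemma sphere_compact : compact [set: sphere R].
Proof.
have cK : compact (((`[-1, 1] `*` `[-1, 1]) `*` `[-1, 1]) : set (R * R * R)).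
  by apply: compact_setX; [apply: compact_setX|]; exact: segment_compact.
move=> F FF _; pose F' : set_system (R * R * R) := (@stereographic R) @ F.
have F'E (A : set (R * R * R)) : F (@stereographic R @^-1` A) -> F' A by [].
have [|p [_ pF]] := cK F' (fmap_proper_filter _ FF).
  apply: F'E; apply: filterS filterT => x _ /=.
  by have [? ? ?] := stereographic_bound x; rewrite !in_itv.
have FR : F' (range (@stereographic R)).
  by apply: F'E; apply: filterS filterT => x _; exists x.
have [d d0|x xp] := @unit_sphere_closed p.
  by have [_ [[x _ <-] px]] := pF _ _ FR (nbhsx_ballx p _ d0); exists x.
exists x; split => // A B FA /nbhs_ballP[e /= e0 eB].
have FA' : F' (@stereographic R @` A).
  by apply: F'E; apply: filterS FA => y Ay; exists y.
have [_ [[y Ay <-] py]] := pF _ _ FA' (nbhsx_ballx p _ e0).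
by exists y; split => //; apply: eB; rewrite /ball /= /initial_ball xp.
Qed.

(** Ascoli's theorem: the common chordal Lipschitz constant gives equicontinuity, and the compact
    sphere gives pointwise precompactness. *)
Lemma seq_normal_lipschitz z e (L : R) F : 0 < e -> 0 < L ->
  (forall p x y r, F p -> cmod (x - z) <= 2 * e -> cmod (y - z) <= 2 * e ->
     L * cmod (x - y) < r -> ball (fin_pt p.[x]) r (fin_pt p.[y])) ->
  seq_normal (@fin_pt R @` disc z e) F.
Proof.
move=> e0 L0 lip f Ff.
pose h (n : nat) : Cplane R -> sphere R := fun x => fin_pt (f n).[retraction z e x].
pose W : set {family compact, Cplane R -> sphere R} := range h.
have eW : @equicontinuous (Cplane R) (sphere R) _ W id.
  move=> x E; rewrite -entourage_ballE => -[r /= r0 rE].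
  apply/nbhs_disc; exists (r / (2 * L)); first by rewrite divr_gt0 // mulr_gt0.
  move=> y; rewrite /disc /= ltr_pdivlMr ?mulr_gt0 // => yx _ [n _ <-].
  apply: rE; apply: (lip (f n)) => //; try exact: retraction_in (ltW _).
  apply: le_lt_trans yx; rewrite (mulrC (cmod _)) (mulrC 2) -mulrA ler_pM2l //.
  by rewrite (cmod_distC y); exact: retraction_lipschitz.
have pW : @pointwise_precompact (Cplane R) (sphere R) _ W id.
  move=> x; exists setT => //; split; first exact: sphere_compact.
  exact: closedT.
have [_ cW] : (forall g, W g -> continuous (g : Cplane R -> sphere R)) /\ precompact W.
  apply/(@Ascoli (Cplane R) (sphere R)) => //; first exact: sphere_hausdorff.
  exact: locally_compact_plane.
pose hF : set_system {family compact, Cplane R -> sphere R} :=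
  (h : nat -> {family compact, Cplane R -> sphere R}) @ \oo.
have [g gW] : cluster hF !=set0.
  rewrite precompactE in cW.
  have [|g [_ ?]] := cW hF (fmap_proper_filter _ _).
    by exists 0%N => // n _ /=; apply: subset_closure; exists n.
  by exists g.
pose K := [set y : Cplane R | cmod (y - z) <= e].
(* The cluster point [g] has arbitrarily late terms close to it on the closed disc; taking the
   [k]-th one within [1 / (k + 1)] produces the subsequence. *)
have close r N : 0 < r ->
    exists2 n, (N <= n)%N & forall x, K x -> ball (g x) r (h n x).
  move=> r0.
  have [||u [[n Nn <-] Hn]] := gW (h @` [set n | (N <= n)%N])
      [set u | forall y, K y -> ball (g y) r (u y)].
  - by exists N => // n /= Nn; exists n.
  - apply: (@fam_nbhs _ _ compact K [set xy | ball xy.1 r xy.2]).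
      by rewrite -entourage_ballE; exists r.
    exact: closed_disc_compact.
  by exists n.
have rk0 k : 0 < (k.+1%:R : R)^-1 by rewrite invr_gt0 ltr0n.
have [phi [hphi Hphi]] : exists phi : nat -> nat, {homo phi : m n / (m < n)%N} /\
    forall k x, K x -> ball (g x) (k.+1%:R)^-1 (h (phi k) x).
  apply: (@diagonal_extraction (fun k n => forall x, K x -> ball (g x) (k.+1%:R)^-1 (h n x))).
  by move=> k N; exact: close.
exists phi; split => //.
exists (fun x : sphere R => if x is Some w then g w else x) => r r0.
exists (Num.truncn r^-1) => n Nn _ [x xz <-] /=.
have Kx : K x by exact: ltW.
have -> : fin_pt (f (phi n)).[x] = h (phi n) x by rewrite /h retraction_id.
apply: le_ball (Hphi n x Kx).
rewrite -[leRHS]invrK lef_pV2 ?posrE ?invr_gt0 //.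
apply: le_trans (ltW (truncnS_gt _)) _.
by rewrite ler_nat ltnS.
Qed.

Lemma locally_normal_bounded F z e (B : R) : 0 < e ->
  (forall p, F p -> forall y, cmod (y - z) <= e -> cmod p.[y] <= B) ->
  locally_normal F z.
Proof.
move=> e0 HB; exists (e / 8); first by lra.
pose L := `|2 * (2 * B / (e / 2))| + 1.
have L0 : 0 < L by rewrite ltr_wpDl.
apply: (@seq_normal_lipschitz z (e / 8) L) => //; first by lra.
move=> p x y r Fp xz yz xyr; apply: fin_pt_lipschitz.
apply: le_lt_trans xyr; rewrite (cmod_distC p.[x]).
have e2 : 0 < e / 2 by lra.
have H : cmod (p.[y] - p.[x]) <= 2 * B / (e / 2) * cmod (y - x).
  apply: bounded_lipschitz => // [u ux|].
    apply: (HB p Fp); apply: le_trans (cmod_dist_triangle x u z) _.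
    by apply: le_trans (lerD ux xz) _; lra.
  apply: le_trans (cmod_dist_triangle z y x) _.
  by rewrite cmod_distC in xz; apply: le_trans (lerD yz xz) _; lra.
apply: le_trans (ler_wpM2l _ H) _ => //.
rewrite mulrA (cmod_distC y); apply: ler_wpM2r; first exact: cmod_ge0.
by apply: le_trans (ler_norm _) _; rewrite /L lerDl.
Qed.

(* The flip of the unit sphere that corresponds to [z |-> 1/z]. *)
Lemma stereographic_inv (z : complex R) (p q : R * R * R) : z != 0 ->
  p = stereographic (Some z) -> q = stereographic (Some z^-1) ->
  [/\ p.1.1 = q.1.1, p.1.2 = - q.1.2 & p.2 = - q.2].
Proof.
move=> z0; rewrite !stereographicE !cmod_sqr => -> -> /=.
have m0 : complex.Re z ^+ 2 + complex.Im z ^+ 2 != 0.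
  by rewrite -cmod_sqr expf_eq0 /= cmod_eq0.
have m1 : 1 + (complex.Re z ^+ 2 + complex.Im z ^+ 2) != 0.
  by rewrite gt_eqF // ltr_pwDl // addr_ge0 // sqr_ge0.
case: z z0 m0 m1 => a b _ /= m0 m1.
have k1 : a ^+ 2 + b ^+ 2 + 1 != 0 by rewrite addrC.
set m := a ^+ 2 + b ^+ 2 in m0 m1 k1 *.
have -> : (a / m) ^+ 2 + (- (b / m)) ^+ 2 = 1 / m.
  by rewrite /m; field.
have e1 : 1 / m + 1 = (1 + m) / m by field.
rewrite e1; split; by field; rewrite ?m0 ?m1 ?k1.
Qed.

(** Inversion is an isometry of the sphere, so the Lipschitz estimate for the bounded functions
    [1 / p] holds for [p] itself. This handles families that may tend to infinity. *)
Lemma locally_normal_away F z e d : 0 < e -> 0 < d ->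
  (forall p, F p -> forall y, cmod (y - z) <= e -> d <= cmod p.[y]) ->
  locally_normal F z.
Proof.
move=> e0 d0 Hd; exists (e / 8); first by lra.
have e2 : 0 < e / 2 by lra.
pose L := 2 * (2 / (d * (e / 2))).
have L0 : 0 < L by rewrite mulr_gt0 // divr_gt0 // mulr_gt0.
apply: (@seq_normal_lipschitz z (e / 8) L) => //; first by lra.
move=> p x y r Fp xz yz xyr.
have pn0 (u : complex R) : cmod (u - z) <= 2 * (e / 8) -> p.[u] != 0.
  move=> uz; rewrite -cmod_gt0; apply: lt_le_trans d0 _; apply: (Hd p Fp).
  by apply: le_trans uz _; lra.
have [h1 h2 h3] := stereographic_inv (pn0 x xz) (erefl _) (erefl _).
have [k1 k2 k3] := stereographic_inv (pn0 y yz) (erefl _) (erefl _).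
have : ball (stereographic (Some (p.[x])^-1)) r (stereographic (Some (p.[y])^-1)).
  apply: stereographic_lipschitz; apply: le_lt_trans xyr.
  rewrite (cmod_distC _ p.[y]^-1).
  have H : cmod (p.[y]^-1 - p.[x]^-1) <= 2 / (d * (e / 2)) * cmod (y - x).
    apply: inv_lipschitz => // [u ux|].
      apply: (Hd p Fp); apply: le_trans (cmod_dist_triangle x u z) _.
      by apply: le_trans (lerD ux xz) _; lra.
    apply: le_trans (cmod_dist_triangle z y x) _.
    by rewrite cmod_distC in xz; apply: le_trans (lerD yz xz) _; lra.
  apply: le_trans (ler_wpM2l _ H) _ => //.
  by rewrite /L (cmod_distC y x) -[leRHS]mulrA lexx.
move=> /ball3E[b1 b2 b3]; apply/ball3E; split.
- by rewrite [X in X - _]h1 [X in _ - X]k1.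
- by rewrite [X in X - _]h2 [X in _ - X]k2 -opprD normrN.
- by rewrite [X in X - _]h3 [X in _ - X]k3 -opprD normrN.
Qed.

End Montel.

(** * Fatou and Julia sets of polynomial semigroups *)

Section Semigroups.
Context (R : realType).
Implicit Types (z w c : complex R) (e d r : R) (p q g h : {poly complex R}).
Implicit Types (A F G : set {poly complex R}) (K L : set (sphere R)).

Lemma semigroup_gen_rcons A g : semigroup_gen A g ->
  A g \/ exists g' h, [/\ semigroup_gen A g', A h & g = g' \Po h].
Proof.
elim=> {g} [p Ap|p q Gp _ Gq IH]; first by left.
right; case: IH => [Aq|[q' [h [Gq' Ah ->]]]]; first by exists p, q.
by exists (p \Po q'), h; split; rewrite ?comp_polyA //; exact: semigroup_gen_comp.
Qed.

(** [semigroup_gen] composes arbitrary pairs. The stronger claim, that composing with [g] on the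
    right preserves [P], allows peeling off one generator at a time, the one applied first. *)
Lemma semigroup_gen_ind_right A (P : {poly complex R} -> Prop) :
  (forall h, A h -> P h) -> (forall g h, semigroup_gen A g -> P g -> A h -> P (g \Po h)) ->
  forall g, semigroup_gen A g -> P g.
Proof.
move=> PA Pc; suff H g : semigroup_gen A g ->
    P g /\ forall q, semigroup_gen A q -> P q -> P (q \Po g).
  by move=> g /H[].
elim=> {g} [h Ah|p q Gp [Pp Hp] Gq [Pq Hq]].
  by split => [|q Gq Pq]; [exact: PA|exact: Pc].
split; first exact: Hq.
move=> u Gu Pu; rewrite comp_polyA; apply: Hq; first exact: semigroup_gen_comp.
exact: Hp.
Qed.

Lemma semigroup_gen_stable A (B : set (complex R)) :
  (forall h, A h -> forall z, B z -> B h.[z]) ->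
  forall g, semigroup_gen A g -> forall z, B z -> B g.[z].
Proof.
move=> HA g; elim=> {g} [h /HA//|p q _ Hp _ Hq z Bz].
by rewrite horner_comp; exact/Hp/Hq.
Qed.

Lemma semigroup_gen_size A : (forall h, A h -> (2 < size h)%N) ->
  forall g, semigroup_gen A g -> (2 < size g)%N.
Proof.
move=> HA g; elim=> {g} [h /HA//|p q _ Hp _ Hq].
have := size_comp_poly p q.
case: (size p) Hp => [|[|[|n]]] // _; case: (size q) Hq => [|[|[|m]]] // _ /=.
by case: (size (p \Po q)) => [|[|[|k]]].
Qed.

Section ThreeGenerators.
Variables h1 h2 h3 : {poly complex R}.
Let A : set {poly complex R} := [set h1; h2; h3].
Let G := semigroup_gen A.

Let A1 : A h1. Proof. by left; left. Qed.
Let A2 : A h2. Proof. by left; right. Qed.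
Let A3 : A h3. Proof. by right. Qed.

(** Contrapositive of the inclusion of J(G) in the union of the [h_j^-1(J(G))]: each element of [G]
    is a generator or has one as its first applied factor, so [G] is covered by six families normal
    near [z]. *)
Lemma Fatou_of_images z : Fatou G (fin_pt h1.[z]) -> Fatou G (fin_pt h2.[z]) ->
  Fatou G (fin_pt h3.[z]) -> Fatou G (fin_pt z).
Proof.
move=> /Fatou_locally_normal N1 /Fatou_locally_normal N2 /Fatou_locally_normal N3.
apply/Fatou_locally_normal.
have key h : locally_normal G h.[z] -> locally_normal ([set h] `|` [set g \Po h | g in G]) z.
  by move=> N; apply: locally_normalU; [exact: locally_normal1|exact: locally_normal_comp].
apply: locally_normalS (locally_normalU (locally_normalU (key _ N1) (key _ N2)) (key _ N3)).
move=> g /semigroup_gen_rcons[[[->|->]|->]|[g' [h [Gg' [[->|->]|->] ->]]]].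
- by left; left; left.
- by left; right; left.
- by right; left.
- by left; left; right; exists g'.
- by left; right; right; exists g'.
- by right; right; exists g'.
Qed.

(** Index [k] stands for word length [k + 1]: there is no empty word. *)
Fixpoint words (k : nat) : set {poly complex R} :=
  if k is k'.+1 then \bigcup_(h in A) [set g \Po h | g in words k'] else A.

Lemma semigroup_gen_words g : G g -> exists k, words k g.
Proof.
elim/semigroup_gen_ind_right => {g} [h Ah|g h _ [k kg] Ah]; first by exists 0%N.
by exists k.+1; exists h => //; exists g.
Qed.

(* Long words send the neighbourhood uniformly close to infinity and there are
   finitely many short words. *)
Lemma Fatou_infinity r (kappa : R) : 0 < r -> 1 < kappa ->
  (forall h z, A h -> r < cmod z -> kappa * cmod z <= cmod h.[z]) ->
  Fatou G (inf_pt R).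
Proof.
move=> r0 k1 HA.
pose U := [set x : sphere R | if x is Some z then r < cmod z else True].
exists U; first by split; [exact: open_exterior|].
apply: normal_on_seq.
have stab h : A h -> poly_map h @` U `<=` U.
  move=> Ah _ [[z|] /= Uz <-] //=; apply: lt_le_trans (HA h z Ah Uz).
  have := cmod_ge0 z; move: Uz; set m := cmod z => *; nra.
have Nw k : seq_normal U (words k).
  elim: k => [|k IH].
    by do !apply: seq_normalU; exact: seq_normal1.
  have -> : words k.+1 = [set g \Po h1 | g in words k] `|` [set g \Po h2 | g in words k]
      `|` [set g \Po h3 | g in words k].
    by rewrite /= /A !bigcup_setU !bigcup_set1.
  by do !apply: seq_normalU; apply: seq_normal_comp IH; exact: stab.
have Nk k : seq_normal U (\bigcup_(j in [set j | (j < k)%N]) words j).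
  elim: k => [|k IH].
    by move=> f /(_ 0%N)[].
  apply: seq_normal_sub (seq_normalU IH (Nw k)) => // g [j /=].
  by rewrite ltnS leq_eqVlt => /orP[/eqP ->|jk] gj; [right|left; exists j].
have growth k g : words k g -> forall z, r < cmod z -> kappa ^+ k.+1 * cmod z <= cmod g.[z].
  elim: k g => [|k IH] g /=; first by move=> Ag z zr; rewrite expr1; exact: HA.
  move=> [h Ah [g' wg' <-]] z zr; rewrite horner_comp exprSr -mulrA.
  have hz := HA h z Ah zr.
  apply: le_trans (IH g' wg' h.[z] _); first by rewrite ler_pM2l // exprn_gt0 //; lra.
  have := stab h Ah; move=> /(_ (fin_pt h.[z])); apply.
  by exists (fin_pt z).
move=> f Gf; have /choice[k Hk] n : exists k, words k (f n) by exact: semigroup_gen_words.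
have [unb|] := pselect (forall j N, exists2 n, (N <= n)%N & (j <= k n)%N).
  have [phi [hphi Hphi]] := diagonal_extraction unb.
  exists phi; split => //; exists (fun=> inf_pt R) => e e0.
  have [s s0 Hs] := ball_infinity e0.
  have [N HN] : exists N, forall n, (N <= n)%N -> s <= kappa ^+ n.+1 * r.
    have kap0 : 0 < (kappa - 1) * r by rewrite mulr_gt0 //; lra.
    exists (Num.truncn (s / ((kappa - 1) * r))) => n Nn.
    (* Bernoulli's inequality gives an explicit rank after which the chosen words send [U] into the
       [e]-ball about infinity. *)
    have bern (m : nat) : 1 + m%:R * (kappa - 1) <= kappa ^+ m.
      elim: m => [|m IH]; first by rewrite mul0r addr0 expr0.
      rewrite exprS; apply: (le_trans _ (ler_wpM2l _ IH)); last by lra.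
      rewrite -natr1; have := mulr_ge0 (ler0n R m) (sqr_ge0 (kappa - 1)).
      by rewrite expr2; set t := m%:R; lra.
    apply: le_trans (ler_wpM2r (ltW r0) (bern n.+1)).
    rewrite mulrDl mul1r -mulrA.
    have : s / ((kappa - 1) * r) <= n.+1%:R.
      apply: le_trans (ltW (truncnS_gt _)) _.
      by rewrite ler_nat ltnS.
    rewrite ler_pdivrMr // => /le_trans; apply.
    by rewrite lerDr ltW.
  exists N => n Nn [z|] /= Uz; last exact: ballxx.
  apply: Hs; apply: le_trans (growth _ _ (Hk (phi n)) z Uz).
  apply: (@le_trans _ _ (kappa ^+ (k (phi n)).+1 * r)).
    by apply: HN; apply: leq_trans Nn (Hphi n).
  by rewrite ler_pM2l; [exact: ltW|rewrite exprn_gt0 //; lra].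
move=> /existsNP[j /existsNP[N HN]]; apply: (@seq_normal_tail _ _ _ f N (Nk j)).
move=> n Nn; exists (k n) => //=; rewrite ltnNge; apply/negP => jk.
by apply: HN; exists n.
Qed.

End ThreeGenerators.

Lemma Fatou_forward A h z : semigroup_gen A h -> (1 < size h)%N ->
  Fatou (semigroup_gen A) (fin_pt z) -> Fatou (semigroup_gen A) (fin_pt h.[z]).
Proof.
move=> Gh h1 /Fatou_locally_normal N; apply/Fatou_locally_normal.
by apply: locally_normal_image N => // g Gg; exact: semigroup_gen_comp.
Qed.

Lemma Julia_backward A h z : semigroup_gen A h -> (1 < size h)%N ->
  Julia (semigroup_gen A) (fin_pt h.[z]) -> Julia (semigroup_gen A) (fin_pt z).
Proof. by move=> Gh h1 Jz Fz; apply: Jz; exact: Fatou_forward. Qed.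

End Semigroups.

(** * Connected plane sets *)

Lemma connected_open_split (T : topologicalType) (E U V : set T) : connected E ->
  open U -> open V -> U `&` V = set0 -> E `<=` U `|` V -> E `<=` U \/ E `<=` V.
Proof.
move=> cE oU oV UV EUV; apply: connected_subset cE => //.
have disj (X Y : set T) : open Y -> X `&` Y = set0 -> closure X `&` Y = set0.
  move=> oY XY; rewrite -subset0 => x [cX Yx].
  have [y XYy] := cX Y (open_nbhs_nbhs (conj oY Yx)).
  by move: XYy; rewrite XY.
by split; [exact: disj|rewrite setIC; apply: disj => //; rewrite setIC].
Qed.

Lemma connected_component_eq (T : topologicalType) (A K : set T) x : K x -> K `<=` A ->
  connected K -> (forall E, connected E -> E `<=` A -> E x -> E `<=` K) ->
  connected_component A x = K.
Proof.
move=> Kx KA cK H; apply/seteqP; split; last exact: connected_component_max.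
by move=> y [E [Ex EA cE] Ey]; exact: (H E).
Qed.

(** Applied to moduli: a connected set that misses a circle, or whose image does, lies on one side
    of it. *)
Lemma connected_real_avoid (R : realType) (T : topologicalType) (f : T -> R) (a : R)
  (E : set T) : continuous f -> connected E -> (forall x, E x -> f x != a) ->
  (forall x, E x -> f x < a) \/ (forall x, E x -> a < f x).
Proof.
move=> cf cE Ea; apply: (@connected_open_split T E (f @^-1` [set t | t < a])
    (f @^-1` [set t | a < t])) => //.
- by move/continuousP : cf; apply; exact: open_lt.
- by move/continuousP : cf; apply; exact: open_gt.
- by rewrite -subset0 => x [/= h1 h2]; have := lt_trans h1 h2; rewrite ltxx.
- by move=> x /Ea; rewrite neq_lt => /orP[?|?]; [left|right].
Qed.

Section PlaneSets.
Context (R : realType).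
Implicit Types (z w : Cplane R) (r s e : R) (p : {poly complex R}).
Implicit Types (E C K : set (Cplane R)).

Definition plane_map p : Cplane R -> Cplane R := fun z => p.[z].

(** [p] is open and closed, so a nonempty relatively clopen part of the preimage of [E] maps onto
    [E] and therefore meets the preimage of [C]; the latter being connected, the part contains it.
    Two complementary parts cannot both do so. *)
Lemma connected_preimage p E C : (1 < size p)%N -> connected E -> C `<=` E -> C !=set0 ->
  connected (plane_map p @^-1` C) -> connected (plane_map p @^-1` E).
Proof.
move=> p1 cE CE C0 cC.
have CEp : plane_map p @^-1` C `&` plane_map p @^-1` E = plane_map p @^-1` C.
  by apply/setIidPl => y; exact: CE.
have onto B : B !=set0 -> (exists2 U, open U & B = (plane_map p @^-1` E) `&` U) ->
    (exists2 F, closed F & B = (plane_map p @^-1` E) `&` F) -> plane_map p @` B = E.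
  have img U : plane_map p @` ((plane_map p @^-1` E) `&` U) = E `&` (plane_map p @` U).
    apply/seteqP; split=> [_ [y [Ey Uy] <-]|w [Ew [y Uy yw]]].
      by split => //; exists y.
    by exists y => //; split => //; rewrite /= yw.
  move=> [b Bb] [U oU BU] [F cF BF]; apply: cE; first by exists (plane_map p b); exists b.
    by exists (plane_map p @` U); [exact: poly_open|rewrite BU img].
  by exists (plane_map p @` F); [exact: poly_closed|rewrite BF img].
have full B : B !=set0 -> (exists2 U, open U & B = (plane_map p @^-1` E) `&` U) ->
    (exists2 F, closed F & B = (plane_map p @^-1` E) `&` F) -> plane_map p @^-1` C `<=` B.
  move=> B0 [U oU BU] [F cF BF]; have BE := onto B B0 (ex_intro2 _ _ U oU BU)
    (ex_intro2 _ _ F cF BF).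
  suff <- : B `&` (plane_map p @^-1` C) = plane_map p @^-1` C by move=> y [].
  apply: cC.
  - have [c Cc] := C0; have : E c by exact: CE.
    by rewrite -BE => -[b Bb bc]; exists b; split => //=; rewrite bc.
  - by refine (ex_intro2 _ _ U oU _); rewrite BU setIC setIA CEp.
  - by refine (ex_intro2 _ _ F cF _); rewrite BF setIC setIA CEp.
move=> B B0 [U oU BU] [F cF BF].
apply/seteqP; split; first by rewrite BU => y [].
apply: contrapT => /existsNP[y /not_implyP[Ey nBy]].
have [c Cc] := C0; have [x xc] := poly_surj c p1.
have Cx : (plane_map p @^-1` C) x by rewrite /= /plane_map xc.
have Bx : B x by apply: (full B) => //; [exists U|exists F].
suff : ((plane_map p @^-1` E) `\` B) x by case.
apply: full Cx; first by exists y.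
- exists (~` F); first exact: closed_openC.
  by rewrite BF; apply/seteqP; split=> t [h1 h2]; split => // h; apply: h2 => //; case: h.
- exists (~` U); first exact: open_closedC.
  by rewrite BU; apply/seteqP; split=> t [h1 h2]; split => // h; apply: h2 => //; case: h.
Qed.

Definition circle r : set (Cplane R) := [set z | cmod z = r].

Lemma circle_connected r : 0 <= r -> connected (circle r).
Proof.
move=> r0.
(* The upper and lower half circles as graphs over [[-r, r]]; they share the point [r]. *)
pose f (sg : R) (x : R) : Cplane R := Complex x (sg * Num.sqrt (r ^+ 2 - x ^+ 2)).
have cf sg : continuous (f sg).
  apply: continuous_complex; first exact: (fun x => @cvg_id _ (nbhs x)).
  have cX : continuous (fun x : R => r ^+ 2 - x ^+ 2).
    move=> x; apply: (@continuousB _ _ _ (fun=> r ^+ 2) (fun x : R => x ^+ 2)).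
      exact: cst_continuous.
    exact: exprn_continuous.
  move=> x; apply: (@continuousM _ _ (fun=> sg) (fun x : R => Num.sqrt (r ^+ 2 - x ^+ 2))).
    exact: cst_continuous.
  apply: (@continuous_comp _ _ _ (fun x : R => r ^+ 2 - x ^+ 2) (@Num.sqrt R)).
    exact: cX.
  exact: sqrt_continuous.
have -> : circle r = (f 1 @` `[-r, r]) `|` (f (-1) @` `[-r, r]).
  apply/seteqP; split.
    move=> z zr; have := cmod_sqr z; rewrite zr => sq.
    have := normr_Re_le z; rewrite zr ler_norml => xr.
    have key (b : bool) : complex.Im z = (-1) ^+ b * `|complex.Im z| -> exists2 x, x \in `[- r, r] & f ((-1) ^+ b) x = z.
      move=> bE; exists (complex.Re z); first by rewrite in_itv.
      rewrite /f sq addrC addKr sqrtr_sqr -bE.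
      by case: (z).
    have [im|im] := leP 0 (complex.Im z).
      by left; have [|x xr' xz] := key false; [rewrite mul1r ger0_norm|exists x].
    right; have [|x xr' xz] := key true; [by rewrite mulN1r ltr0_norm // opprK|by exists x].
  have sqle x : x \in `[- r, r] -> 0 <= r ^+ 2 - x ^+ 2.
    by rewrite in_itv /= => /andP[h1 h2]; nra.
  have on sg x : sg ^+ 2 = 1 -> x \in `[-r, r] -> circle r (f sg x).
    move=> sg1 /sqle xr; rewrite /circle /f /= exprMn sg1 mul1r sqr_sqrtr //.
    by rewrite addrC subrK sqrtr_sqr ger0_norm.
  by move=> _ [[x xr <-]|[x xr <-]]; apply: on; rewrite ?expr1n ?sqrrN ?expr1n.
apply: connectedU.
- exists (r%:C%C : Cplane R); split; exists r;
    by rewrite /= ?in_itv /= ?lexx ?andbT ?ge0_cp // /f subrr sqrtr0 mulr0.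
- apply: connected_continuous_connected; first exact: segment_connected.
  exact: continuous_subspaceT.
- apply: connected_continuous_connected; first exact: segment_connected.
  exact: continuous_subspaceT.
Qed.

Lemma disc_connected z e : 0 < e -> connected (disc z e).
Proof.
move=> e0; pose seg (w : Cplane R) (t : R) : Cplane R := z + t%:C%C * (w - z).
have cseg w : continuous (seg w).
  move=> t A /nbhs_disc[d d0 dA].
  apply/nbhs_ballP; exists (d / (cmod (w - z) + 1)) => /=.
    by rewrite divr_gt0 // ltr_wpDl // cmod_ge0.
  move=> s; rewrite -ball_normE /= ltr_pdivlMr; last by rewrite ltr_wpDl // cmod_ge0.
  move=> ts; apply: dA; rewrite /disc /= /seg.
  have -> : z + s%:C%C * (w - z) - (z + t%:C%C * (w - z)) = (s - t)%:C%C * (w - z).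
    by rewrite rmorphB /= mulrBl; ring.
  rewrite cmodM cmod_real distrC; apply: le_lt_trans ts.
  by rewrite ler_wpM2l // lerDl.
have -> : disc z e = \bigcup_(w in disc z e) (seg w @` `[0, 1]).
  apply/seteqP; split=> [w we|_ [w we] [t t01 <-]].
    exists w => //; exists 1; first by rewrite /= in_itv /= ler01 lexx.
    by rewrite /seg mul1r addrC subrK.
  rewrite /disc /= /seg addrAC subrr add0r cmodM cmod_real.
  move: t01; rewrite /= in_itv /= => /andP[t0 t1].
  rewrite ger0_norm //; apply: le_lt_trans we.
  by rewrite ler_piMl // cmod_ge0.
apply: bigcup_connected.
  exists z => w _; exists 0; first by rewrite /= in_itv /= ler01 lexx.
  by rewrite /seg mul0r addr0.
move=> w _; apply: connected_continuous_connected; first exact: segment_connected.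
exact: continuous_subspaceT.
Qed.

Lemma bounded_disc r E : (forall z, E z -> cmod z <= r) -> bounded_set E.
Proof.
move=> Er; exists (r%:C%C); split; first by rewrite complex_real.
move=> x rx z Ez /=; rewrite normE.
apply: le_trans (ltW rx); rewrite lecR; exact: Er.
Qed.

(** The bounded component is that of 0: it contains the disc of radius [r] and cannot cross the
    circle of radius [s], which lies in [K2]. *)
Lemma surround_circle K1 K2 r s : 0 < r -> K1 `<=` disc 0 r -> K2 `&` disc 0 r = set0 ->
  circle s `<=` K2 -> 0 < s -> surround_le K1 K2.
Proof.
move=> r0 K1r K2r sK2 s0.
have D0 : disc 0 r (0 : Cplane R) by exact: disc_center.
have dK : disc 0 r `<=` ~` K2.
  by move=> z zr K2z; rewrite -[False]/(set0 z) -K2r.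
right; exists (connected_component (~` K2) 0); split.
- by exists 0 => //; exact: dK.
- apply: (@bounded_disc s) => z Dz; apply: ltW.
  have [|||H|H] := @connected_real_avoid R _ (cmod : Cplane R -> R) s
    (connected_component (~` K2) (0 : Cplane R)).
  + exact: cmod_continuous.
  + exact: component_connected.
  + move=> y /connected_component_sub nK2; apply/eqP => ys; apply: nK2.
    exact: sK2.
  + exact: H.
  + have := H 0 (connected_component_refl (dK _ D0)).
    by rewrite cmod0 ltNge ltW.
- move=> z /K1r; apply: connected_component_max => //.
  exact: disc_connected.
Qed.

End PlaneSets.

(** * The three generators *)

Section Generators.
Context (R : realType).
Implicit Types (z w u : complex R) (r s t L : R).

Definition outer_radius : R := 49 / 16.
(** The square root of [outer_radius], so that [square] maps the circle of this radius into
    J(h3). *)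
Definition inner_radius : R := 7 / 4.
Local Notation rho := outer_radius.
Local Notation tau := inner_radius.

Definition cubic : {poly complex R} := 3 *: 'X^2 - 2 *: 'X^3.
Definition square : {poly complex R} := 'X^2.
Definition shrink : {poly complex R} := (rho ^- 7)%:C%C *: 'X^8.

Lemma rho_gt0 : 0 < rho. Proof. by rewrite /outer_radius; lra. Qed.

Lemma rho_neq0 : rho != 0. Proof. by rewrite gt_eqF // rho_gt0. Qed.

Lemma cubicE z : cubic.[z] = z ^+ 2 * (3 - 2 * z).
Proof. by rewrite /cubic hornerD hornerN !hornerZ !hornerXn; ring. Qed.

Lemma squareE z : square.[z] = z ^+ 2.
Proof. by rewrite /square hornerXn. Qed.

Lemma cmod_cubic z : cmod cubic.[z] = cmod z ^+ 2 * cmod (3 - 2 * z).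
Proof. by rewrite cubicE cmodM cmodX. Qed.

Lemma cmod_square z : cmod square.[z] = cmod z ^+ 2.
Proof. by rewrite squareE cmodX. Qed.

Lemma cmod_shrink z : cmod shrink.[z] = rho * (cmod z / rho) ^+ 8.
Proof.
rewrite /shrink hornerZ hornerXn cmodM cmodX cmod_real ger0_norm; last first.
  by rewrite invr_ge0 exprn_ge0 // ltW // rho_gt0.
by field; rewrite gt_eqF // rho_gt0.
Qed.

Lemma size_cubic : size cubic = 4%N.
Proof.
rewrite /cubic addrC size_polyDl size_polyN size_scale ?pnatr_eq0 // size_polyXn //.
by rewrite size_scale ?pnatr_eq0 // size_polyXn.
Qed.

Lemma size_square : size square = 3%N.
Proof. by rewrite /square size_polyXn. Qed.

Lemma size_shrink : size shrink = 9%N.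
Proof.
rewrite /shrink size_scale ?size_polyXn // -cmod_eq0 cmod_real normr_eq0.
by rewrite invr_eq0 expf_eq0 /= gt_eqF // rho_gt0.
Qed.

Lemma factor_le z : cmod (3 - 2 * z) <= 3 + 2 * cmod z.
Proof.
apply: le_trans (cmodB_le _ _) _.
by rewrite cmodM !cmod_nat.
Qed.

Lemma factor_ge z : 2 * cmod z - 3 <= cmod (3 - 2 * z).
Proof.
rewrite cmod_distC; apply: le_trans (cmod_sub_le _ _).
by rewrite cmodM !cmod_nat.
Qed.

(** On a circle about 0 the modulus of [cubic] thus depends on the real part only; all the
    level-curve computations use this. *)
Lemma factor_sqr z : cmod (3 - 2 * z) ^+ 2 = 9 - 12 * complex.Re z + 4 * cmod z ^+ 2.
Proof.
rewrite !cmod_sqr; case: z => a b.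
have -> : (3 - 2 * Complex a b : complex R) = Complex (3 - 2 * a) (- (2 * b)).
  rewrite -[3]/(3%:R) -[2]/(2%:R) -!(rmorph_nat (real_complex R)).
  by apply/eqP; rewrite eq_complex /=; apply/andP; split; apply/eqP; ring.
by rewrite /=; ring.
Qed.

Lemma cubic_small z : cmod z <= 1 / 4 -> cmod cubic.[z] <= 1 / 4.
Proof.
rewrite cmod_cubic; have := factor_le z; have := cmod_ge0 z.
have := cmod_ge0 (3 - 2 * z).
move: (cmod z) (cmod (3 - 2 * z)) => m n n0 m0 nm m4.
have : m ^+ 2 <= 1 / 16 by nra.
by have := sqr_ge0 m; move: (m ^+ 2) => k; nra.
Qed.

Lemma square_small z : cmod z <= 1 / 4 -> cmod square.[z] <= 1 / 4.
Proof. by rewrite cmod_square; have := cmod_ge0 z; move: (cmod z) => m; nra. Qed.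

Lemma shrink_le z : cmod z <= rho -> cmod shrink.[z] <= cmod z * (cmod z / rho).
Proof.
rewrite cmod_shrink; have := rho_gt0; have := cmod_ge0 z.
move: (cmod z) => m m0 r0 mr; have q0 : 0 <= m / rho by rewrite divr_ge0 // ltW.
have q1 : m / rho <= 1 by rewrite ler_pdivrMr // mul1r.
have -> : m * (m / rho) = rho * (m / rho) ^+ 2 by field; exact: rho_neq0.
rewrite ler_pM2l // -[8%N]/(6 + 2)%N exprD ler_piMl ?sqr_ge0 //.
exact: exprn_ile1.
Qed.

Lemma shrink_small z : cmod z <= 2 -> cmod shrink.[z] <= 1 / 8.
Proof.
rewrite cmod_shrink => m2; have m0 := cmod_ge0 z.
have q : cmod z / rho <= 32 / 49 by rewrite ler_pdivrMr /outer_radius; lra.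
have q0 : 0 <= cmod z / rho by rewrite divr_ge0 // ltW // rho_gt0.
move: (cmod z / rho) q q0 => q q1 q0.
have sq (x a b : R) : 0 <= x -> x <= a -> a ^+ 2 <= b -> x ^+ 2 <= b.
  by move=> x0 xa; apply: le_trans; rewrite lerXn2r // nnegrE // (le_trans x0).
(* Rounding [(32/49)^2] up to [3/7] keeps the fractions small; the eighth power is then at most
   [81/2401], and [rho] times this is [81/784 < 1/8]. *)
have q2 : q ^+ 2 <= 3 / 7 by apply: sq q1 _ => //; lra.
have q4 : (q ^+ 2) ^+ 2 <= 9 / 49 by apply: sq q2 _; rewrite ?sqr_ge0 //; lra.
have q8 : ((q ^+ 2) ^+ 2) ^+ 2 <= 81 / 2401 by apply: sq q4 _; rewrite ?sqr_ge0 //; lra.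
rewrite -!exprM in q8.
by move: (q ^+ 8) q8 => k; rewrite /outer_radius; lra.
Qed.

Lemma cubic_large z : 2 <= cmod z -> cmod z ^+ 2 <= cmod cubic.[z].
Proof.
move=> z2; rewrite cmod_cubic; have := factor_ge z.
move: (cmod (3 - 2 * z)) => n; move: (cmod z) z2 => m m2 nm.
by have := sqr_ge0 m; nra.
Qed.

Lemma sqr_gt_rho r : 2 <= r -> rho < r ^+ 2.
Proof. by move=> r2; rewrite /outer_radius; nra. Qed.

Lemma shrink_large z : rho < cmod z -> cmod z < cmod shrink.[z].
Proof.
move=> zr; have r0 := rho_gt0; rewrite cmod_shrink.
have q1 : 1 < cmod z / rho by rewrite ltr_pdivlMr ?mul1r.
rewrite -{1}(divfK rho_neq0 (cmod z)) mulrC ltr_pM2l //.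
by rewrite -[X in X < _]expr1 ltr_eXn2l.
Qed.

Lemma shrink_expands z : 4 < cmod z -> 2 * cmod z <= cmod shrink.[z].
Proof.
move=> z4; have r0 := rho_gt0; rewrite cmod_shrink.
have q1 : 64 / 49 <= cmod z / rho by rewrite ler_pdivlMr /outer_radius; lra.
rewrite -{1}(divfK rho_neq0 (cmod z)) mulrA mulrC ler_pM2l //.
move: (cmod z / rho) q1 => q q1.
have q2 : 3 / 2 <= q ^+ 2 by nra.
have q4 : 2 <= q ^+ 4 by rewrite -[4%N]/(2 * 2)%N exprM; move: (q ^+ 2) q2 => k; nra.
have q3 : 1 <= q ^+ 3 by apply: exprn_ege1; lra.
rewrite -[8%N]/(4 + 3 + 1)%N !exprD expr1 ler_pM2r; last by lra.
by move: (q ^+ 4) (q ^+ 3) q4 q3 => k j; nra.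
Qed.

Lemma shrink_circle r : tau <= r -> r <= rho ->
  exists2 s, tau <= s <= rho & forall z, cmod shrink.[z] = r <-> cmod z = s.
Proof.
move=> tr rr; have r0 := rho_gt0; have t0 : 0 < tau by rewrite /inner_radius; lra.
pose q := r / rho.
have q0 : 0 < q by rewrite divr_gt0 // (lt_le_trans t0).
have q1 : q <= 1 by rewrite ler_pdivrMr // mul1r.
(* The eighth root of [q]. As [q <= 1], it is at least [q], which keeps the new radius [rho * k]
   above [r]. *)
pose k := Num.sqrt (Num.sqrt (Num.sqrt q)).
have k0 : 0 < k by rewrite !sqrtr_gt0.
have kE : k ^+ 8 = q.
  rewrite -[8%N]/(2 * (2 * 2))%N 2!exprM.
  by rewrite !sqr_sqrtr // ?sqrtr_ge0 // ltW.
have k1 : k <= 1.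
  by rewrite -(@expr_le1 _ 8) // ?kE // ltW.
have qk : q <= k.
  rewrite -kE -{2}(mulr1 k) exprS; apply: ler_wpM2l; first exact: ltW.
  exact: exprn_ile1 (ltW k0) k1.
exists (rho * k).
  apply/andP; split.
    apply: le_trans tr _; rewrite -(divfK rho_neq0 r) mulrC ler_pM2l //.
  by rewrite ler_piMr // ltW.
move=> z; rewrite cmod_shrink; split.
  move=> H; have : (cmod z / rho) ^+ 8 = k ^+ 8.
    by rewrite kE /q -H [rho * _]mulrC mulfK // rho_neq0.
  move/eqP; rewrite eqrXn2 ?divr_ge0 ?cmod_ge0 ?(ltW k0) ?(ltW r0) // => /eqP <-.
  by rewrite mulrC divfK // rho_neq0.
by move=> ->; rewrite [rho * k]mulrC mulfK ?rho_neq0 // kE /q mulrC divfK // rho_neq0.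
Qed.

(** The equation [t^4 (9 - 12 x + 4 t^2) = L^2] is solved for the real part [x]. The two bounds
    compare [L] with the values of [|cubic|] at [t] and [- t], and amount to [|x| <= t]. *)
Lemma cubic_on_circle t L : 0 < t -> 0 <= L ->
  (t ^+ 2 * (3 - 2 * t)) ^+ 2 <= L ^+ 2 -> L <= t ^+ 2 * (3 + 2 * t) ->
  exists2 z, cmod z = t & cmod cubic.[z] = L.
Proof.
move=> t0 L0 lo hi.
have t4 : 0 < t ^+ 4 by rewrite exprn_gt0.
pose x := (9 + 4 * t ^+ 2 - L ^+ 2 / t ^+ 4) / 12.
have xt : x <= t.
  rewrite /x ler_pdivrMr // lerBlDr -lerBlDl ler_pdivlMr //.
  apply: le_trans lo; rewrite le_eqVlt; apply/orP; left; apply/eqP; ring.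
have tx : - t <= x.
  rewrite /x ler_pdivlMr // lerBrDr -lerBrDl ler_pdivrMr //.
  have : L ^+ 2 <= (t ^+ 2 * (3 + 2 * t)) ^+ 2.
    by rewrite ler_pXn2r ?nnegrE // (le_trans L0 hi).
  move/le_trans; apply; rewrite le_eqVlt; apply/orP; left; apply/eqP; ring.
have y0 : 0 <= t ^+ 2 - x ^+ 2 by nra.
exists (Complex x (Num.sqrt (t ^+ 2 - x ^+ 2))).
  by rewrite /= sqr_sqrtr // addrC subrK sqrtr_sqr gtr0_norm.
have zt : cmod (Complex x (Num.sqrt (t ^+ 2 - x ^+ 2))) ^+ 2 = t ^+ 2.
  by rewrite cmod_sqr /= sqr_sqrtr // addrC subrK.
apply/eqP; rewrite -(eqrXn2 (n := 2)) ?cmod_ge0 // cmod_cubic exprMn factor_sqr zt /=.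
by apply/eqP; rewrite /x; field; rewrite gt_eqF.
Qed.

(* In polar form [r^4 (9 - 12 r c + 4 r^2) = L^2] reads
   [9/r + 4 r - L^2/r^5 = 12 c], with an increasing left-hand side. *)
Lemma cubic_level_inj z w L : 3 / 2 <= L -> cmod cubic.[z] = L -> cmod cubic.[w] = L ->
  complex.Re z * cmod w = complex.Re w * cmod z -> cmod z = cmod w.
Proof.
move=> L32 zL wL col.
have L0 : 0 < L by lra.
have pos (v : complex R) : cmod cubic.[v] = L -> 0 < cmod v.
  move=> vL; rewrite cmod_gt0; apply: contraTneq L0 => v0.
  by rewrite -vL cmod_cubic v0 cmod0 expr0n /= mul0r ltxx.
have polar v : cmod cubic.[v] = L ->
    cmod v ^+ 4 * (9 - 12 * complex.Re v + 4 * cmod v ^+ 2) = L ^+ 2.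
  by move=> <-; rewrite cmod_cubic exprMn factor_sqr -exprM.
wlog zw : z w zL wL col / cmod z <= cmod w.
  move=> H; have [zw|/ltW wz] := leP (cmod z) (cmod w); first exact: H.
  by apply/esym/H.
apply/eqP; rewrite eq_le zw leNgt; apply/negP => ltzw.
have := polar z zL; have := polar w wL; have := pos z zL; have := pos w wL.
move: col ltzw; move: (cmod z) (cmod w) (complex.Re z) (complex.Re w) => r s a b.
move=> col rs s0 r0 sE rE.
have E : r ^+ 5 * (9 * s ^+ 4 + 4 * s ^+ 6 - L ^+ 2) = s ^+ 5 * (9 * r ^+ 4 + 4 * r ^+ 6 - L ^+ 2).
  rewrite -{1}sE -rE.
  rewrite (_ : _ - _ = 12 * s ^+ 4 * b); last by ring.
  rewrite (_ : _ - _ = 12 * r ^+ 4 * a); last by ring.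
  rewrite (_ : r ^+ 5 * _ = 12 * (r * s) ^+ 4 * (b * r)); last by ring.
  by rewrite -col; ring.
have F : (s - r) * ((r * s) ^+ 4 * (4 * (r * s) - 9) +
    L ^+ 2 * (s ^+ 4 + s ^+ 3 * r + s ^+ 2 * r ^+ 2 + s * r ^+ 3 + r ^+ 4)) = 0.
  by move/eqP : E; rewrite -subr_eq0 => /eqP <-; ring.
move/eqP : F; rewrite mulf_eq0 subr_eq0 gt_eqF //= gt_eqF //.
have v0 : 0 < r * s by rewrite mulr_gt0.
have S : 5 * (r * s) ^+ 2 <= s ^+ 4 + s ^+ 3 * r + s ^+ 2 * r ^+ 2 + s * r ^+ 3 + r ^+ 4.
  rewrite -subr_ge0.
  rewrite (_ : _ - _ = (s ^+ 2 - r ^+ 2) ^+ 2 + (r * s) * (s - r) ^+ 2); last by ring.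
  by rewrite addr_ge0 ?sqr_ge0 // mulr_ge0 ?sqr_ge0 // ltW.
have L2 : 9 / 4 <= L ^+ 2 by nra.
apply: (@lt_le_trans _ _ ((r * s) ^+ 4 * (4 * (r * s) - 9) + 9 / 4 * (5 * (r * s) ^+ 2))).
  rewrite (_ : _ + _ = (r * s) ^+ 2 * (4 * (r * s) ^+ 3 - 9 * (r * s) ^+ 2 + 45 / 4)); last by field.
  rewrite mulr_gt0 ?exprn_gt0 //.
  (* The double root [3/2] is the minimum point of [4 v^3 - 9 v^2] for [v > 0], where
     [v = r * s]. *)
  rewrite (_ : _ + _ = (4 * (r * s) + 3) * (r * s - 3 / 2) ^+ 2 + 9 / 2); last by field.
  by rewrite ltr_wpDl // mulr_ge0 ?sqr_ge0 //; lra.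
rewrite lerD2l; apply: ler_pM => //; first by rewrite mulr_ge0 // sqr_ge0.
Qed.

End Generators.

(** * Radial projection of the level curves of [cubic] onto the unit circle *)

Section LevelCurve.
Context (R : realType).
Implicit Types (z w u : Cplane R) (r s t L : R).

Definition direction z : Cplane R := ((cmod z)^-1)%:C%C * z.

Lemma cmod_direction z : z != 0 -> cmod (direction z) = 1.
Proof.
move=> z0; have m0 : 0 < cmod z by rewrite cmod_gt0.
by rewrite cmodM cmod_real gtr0_norm ?invr_gt0 // mulVf // gt_eqF.
Qed.

Lemma directionK z : z != 0 -> (cmod z)%:C%C * direction z = z.
Proof.
move=> z0; rewrite /direction mulrA -rmorphM /= divff ?cmod_eq0 //.
by rewrite rmorph1 mul1r.
Qed.

Lemma direction_continuous z : z != 0 -> {for z, continuous direction}.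
Proof.
move=> z0 A /nbhs_disc[e e0 eA]; have m0 : 0 < cmod z by rewrite cmod_gt0.
apply/nbhs_disc; exists (Num.min (cmod z) (e * cmod z / 2)).
  by rewrite lt_min m0 divr_gt0 // mulr_gt0.
move=> w; rewrite /disc /= lt_min => /andP[w1 w2]; apply: eA; rewrite /disc /=.
have wn0 : w != 0.
  by apply: contraTneq w1 => ->; rewrite sub0r cmodN ltxx.
have mw0 : 0 < cmod w by rewrite cmod_gt0.
have -> : direction w - direction z =
    ((cmod z)^-1)%:C%C * ((w - z) + ((cmod z - cmod w) / cmod w)%:C%C * w).
  rewrite /direction mulrDr mulrA -rmorphM /= mulrBr addrAC -mulrDl; congr (_ * _ - _).
  rewrite -rmorphD /=; congr (_ %:C%C).
  by field; rewrite !gt_eqF.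
rewrite cmodM cmod_real gtr0_norm ?invr_gt0 // mulrC ltr_pdivrMr //.
apply: le_lt_trans (cmodD _ _) _.
rewrite cmodM cmod_real normrM normfV (gtr0_norm mw0) divfK ?gt_eqF //.
have : `|cmod z - cmod w| <= cmod (w - z).
  by rewrite ler_norml; have := cmod_sub_le z w; have := cmod_sub_le w z; rewrite (cmod_distC z);
    move: (cmod (w - z)) (cmod w) (cmod z) => a b c *; apply/andP; split; lra.
rewrite ltr_pdivlMr // in w2.
by move: w2; move: (cmod (w - z)) `|_| (e * _) => a b c *; lra.
Qed.

Definition cubic_level L : set (Cplane R) := [set z | cmod (cubic R).[z] = L].

Lemma cubic_level_neq0 L z : 0 < L -> cubic_level L z -> z != 0.
Proof.
move=> L0 zL; apply: contraTneq L0 => z0.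
by rewrite -zL cmod_cubic z0 cmod0 expr0n /= mul0r ltxx.
Qed.

Lemma cubic_level_closed L : closed (cubic_level L).
Proof.
have c : continuous (fun z : Cplane R => cmod (cubic R).[z]).
  move=> z; apply: (@continuous_comp _ _ _ (fun y : Cplane R => (cubic R).[y] : Cplane R)
    (cmod : Cplane R -> R)); first exact: horner_continuous.
  exact: cmod_continuous.
move/continuous_closedP : c => /(_ [set L]); apply.
exact: closed_eq.
Qed.

Lemma cubic_level_bounded L z : cubic_level L z -> cmod z <= 2 + L.
Proof.
move=> zL; have L0 : 0 <= L by rewrite -zL cmod_ge0.
rewrite leNgt; apply/negP => big.
have z2 : 2 <= cmod z by move: big; move: (cmod z) => m; lra.
have := cubic_large z2; rewrite zL.
by move: z2 big; move: (cmod z) => m z2 big; nra.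
Qed.

Lemma cubic_level_image_closed L (F : set (Cplane R)) : 0 < L -> closed F ->
  closed (direction @` (cubic_level L `&` F)).
Proof.
move=> L0 cF; apply: compact_closed; first exact: norm_hausdorff.
apply: continuous_compact.
  apply: continuous_in_subspaceT => z /set_mem[zL _].
  exact/direction_continuous/(cubic_level_neq0 L0 zL).
apply: (subclosed_compact _ (@closed_disc_compact R 0 (2 + L))).
  by apply: closedI => //; exact: cubic_level_closed.
by move=> z [zL _]; rewrite /= subr0; exact: cubic_level_bounded.
Qed.

(** Intermediate values along the ray: [|cubic|] vanishes at 0 and is at least [L] at distance
    [2 + L]. *)
Lemma cubic_level_ray L u : 0 < L -> cmod u = 1 ->
  exists2 z, cubic_level L z & direction z = u.
Proof.
move=> L0 u1; pose ray (x : R) : Cplane R := Complex (x * complex.Re u) (x * complex.Im u).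
have rayE x : ray x = x%:C%C * u.
  by rewrite /ray; case: (u) => a b; apply/eqP; rewrite eq_complex /=;
      apply/andP; split; apply/eqP; ring.
have mray x : 0 <= x -> cmod (ray x) = x.
  by move=> x0; rewrite rayE cmodM cmod_real u1 mulr1 ger0_norm.
have cray : continuous ray.
  apply: continuous_complex => x.
    by apply: (@continuousM _ _ id (fun=> complex.Re u)); [exact: cvg_id|exact: cst_continuous].
  by apply: (@continuousM _ _ id (fun=> complex.Im u)); [exact: cvg_id|exact: cst_continuous].
pose f x : R := cmod (cubic R).[ray x].
have cf : continuous f.
  move=> x; apply: (@continuous_comp _ _ _ ray (fun y : Cplane R => cmod (cubic R).[y])).
    exact: cray.
  apply: (@continuous_comp _ _ _ (fun y : Cplane R => (cubic R).[y] : Cplane R)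
    (cmod : Cplane R -> R)); first exact: horner_continuous.
  exact: cmod_continuous.
have f0 : f 0 = 0 by rewrite /f cmod_cubic mray // expr0n /= mul0r.
have fb : L <= f (2 + L).
  have b0 : 0 <= 2 + L by lra.
  have := @cubic_large R (ray (2 + L)); rewrite mray // => H.
  apply: le_trans (H _); last by lra.
  by nra.
have [|||x + fx] := @IVT R f 0 (2 + L) L.
- by lra.
- exact: continuous_subspaceT.
- by rewrite f0 ge_min le_max fb orbT ltW.
rewrite in_itv /= => /andP[x0 _].
have xn0 : x != 0 by apply: contraTneq L0 => xE; rewrite -fx xE f0 ltxx.
exists (ray x) => //.
by rewrite /direction mray // rayE mulrA -rmorphM /= mulVf // rmorph1 mul1r.
Qed.

Lemma cubic_level_direction_inj L z w : 3 / 2 <= L -> cubic_level L z -> cubic_level L w ->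
  direction z = direction w -> z = w.
Proof.
move=> L32 zL wL zw; have L0 : 0 < L by lra.
have z0 := cubic_level_neq0 L0 zL; have w0 := cubic_level_neq0 L0 wL.
suff mzw : cmod z = cmod w by rewrite -(directionK z0) -(directionK w0) mzw zw.
have ReE (v : complex R) : v != 0 -> complex.Re v = cmod v * complex.Re (direction v).
  move=> v0; rewrite -{1}(directionK v0); case: (direction v) => a b /=.
  by rewrite mul0r subr0.
apply: (cubic_level_inj L32 zL wL).
by rewrite (ReE z) // (ReE w) // zw; ring.
Qed.

(** [direction] is a continuous bijection from the compact curve onto the unit circle. It turns a
    clopen splitting of the curve into two disjoint closed sets covering the circle, so one of them
    is empty. *)
Lemma cubic_level_connected L : 3 / 2 <= L -> connected (cubic_level L).
Proof.
move=> L32; have L0 : 0 < L by lra.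
move=> B B0 [U oU BU] [F cF BF].
pose B' := cubic_level L `&` ~` U.
have BB' z : cubic_level L z -> B z \/ B' z.
  by move=> zL; have [Uz|nUz] := pselect (U z); [left; rewrite BU|right].
have disj z w : B z -> B' w -> direction z != direction w.
  move=> Bz [wL nUw]; apply/eqP => zw; apply: nUw.
  have zL : cubic_level L z by move: Bz; rewrite BU => -[].
  have <- := cubic_level_direction_inj L32 zL wL zw.
  by move: Bz; rewrite BU => -[].
have img1 z : cubic_level L z -> circle 1 (direction z).
  by move=> zL; apply: cmod_direction; exact: cubic_level_neq0 zL.
have full : direction @` B = circle 1.
  apply: (circle_connected ler01).
  - by have [b Bb] := B0; exists (direction b); exists b.
  - exists (~` (direction @` B')).
      by apply: closed_openC; apply: cubic_level_image_closed => //; exact: open_closedC.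
    apply/seteqP; split=> [_ [z Bz <-]|u [u1 nu]].
      split; first by apply: img1; move: Bz; rewrite BU => -[].
      by move=> [w B'w wz]; have := disj z w Bz B'w; rewrite wz eqxx.
    have [z zL zu] := cubic_level_ray L0 u1.
    have [Bz|B'z] := BB' z zL; first by exists z.
    by exfalso; apply: nu; exists z.
  - exists (direction @` B); first by rewrite BF; exact: cubic_level_image_closed.
    apply/esym/setIidPr => _ [z Bz <-]; apply: img1.
    by move: Bz; rewrite BU => -[].
apply/seteqP; split; first by rewrite BU => z [].
move=> z zL; have [//|B'z] := BB' z zL.
have : circle 1 (direction z) by exact: img1.
by rewrite -full => -[y By yz]; have := disj y z By B'z; rewrite yz eqxx.
Qed.

End LevelCurve.

(** * Failure of normality near the superattracting fixed point 1 *)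

Section SuperattractingPoint.
Context (R : realType).
Implicit Types (z w v : complex R) (e q t x : R).

Definition local_cubic w := - (w ^+ 2 * (3 + 2 * w)).

Lemma cubic_at_one w : (cubic R).[1 + w] = 1 + local_cubic w.
Proof. by rewrite cubicE /local_cubic; ring. Qed.

(* [tau] is the quotient of two orbits converging to the critical fixed point;
   up to a small error one step squares it, and the Stolz angle condition
   [|1 - tau| <= (2 - q) (1 - |tau|)] survives because the errors are summable. *)
Lemma stolz_step q w (tau : complex R) : 0 < q -> q <= 1 -> w != 0 -> cmod w <= q / 16 ->
  cmod tau <= 1 -> cmod (1 - tau) <= (2 - q) * (1 - cmod tau) ->
  exists tau' : complex R, [/\ local_cubic (tau * w) = tau' * local_cubic w,
    local_cubic w != 0, cmod (local_cubic w) <= q / 2 / 16,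
    cmod (1 - tau') <= (2 - q / 2) * (1 - cmod tau') &
    cmod tau' <= cmod tau ^+ 2 * (1 + (1 - cmod tau) / 8)].
Proof.
move=> q0 q1 w0 wq t1 st; have wpos : 0 < cmod w by rewrite cmod_gt0.
have f2 : 2 <= cmod (3 + 2 * w).
  have := cmod_sub_le 3 (- (2 * w)); rewrite opprK cmodN cmodM !cmod_nat => H.
  by apply: le_trans H; move: wq; move: (cmod w) => m; lra.
have f0 : 3 + 2 * w != 0 by rewrite -cmod_gt0; apply: lt_le_trans f2.
pose d := 2 * w / (3 + 2 * w).
have dw : cmod d <= cmod w.
  rewrite /d cmodM cmodV cmodM cmod_nat ler_pdivrMr; last by apply: lt_le_trans f2.
  by rewrite mulrC ler_pM2l.
(* The exact quotient of the two images, since [(3 + 2 tau w) / (3 + 2 w) = 1 - (1 - tau) d]. *)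
pose tau' := tau ^+ 2 * (1 - (1 - tau) * d).
exists tau'.
have x0 := cmod_ge0 tau; have D0 := cmod_ge0 (1 - tau); have d0 := cmod_ge0 d.
have t'le : cmod tau' <= cmod tau ^+ 2 * (1 + cmod (1 - tau) * cmod w).
  rewrite /tau' cmodM cmodX; apply: ler_wpM2l; first by rewrite exprn_ge0.
  apply: le_trans (cmodB_le _ _) _; rewrite cmod1 lerD2l cmodM.
  exact: ler_wpM2l.
have one_t' : cmod (1 - tau') <= cmod (1 - tau) * (1 + cmod tau + cmod tau ^+ 2 * cmod w).
  have -> : 1 - tau' = (1 - tau) * (1 + tau + tau ^+ 2 * d) by rewrite /tau'; ring.
  rewrite cmodM; apply: ler_wpM2l => //.
  apply: le_trans (cmodD _ _) _; apply: lerD.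
    by apply: le_trans (cmodD _ _) _; rewrite cmod1.
  by rewrite cmodM cmodX; apply: ler_wpM2l; rewrite ?exprn_ge0.
split.
- by rewrite /local_cubic /tau' /d; field.
- by rewrite /local_cubic oppr_eq0 mulf_neq0 // expf_neq0.
- rewrite /local_cubic cmodN cmodM cmodX.
  have : cmod (3 + 2 * w) <= 4.
    apply: le_trans (cmodD _ _) _; rewrite cmodM !cmod_nat.
    by move: wq; move: (cmod w) => m; lra.
  by move: wq wpos f2; move: (cmod w) (cmod _) => m n *; rewrite expr2; nra.
- move: t'le one_t' st wq wpos.
  move: (cmod tau') (cmod (1 - tau')) (cmod (1 - tau)) (cmod w) D0 (cmod tau) x0 t1.
  clear -q0 q1 => X Y D m D0 x x0 x1 Xle Yle Dle mq m0.
  have x20 : 0 <= x ^+ 2 by rewrite exprn_ge0.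
  have x21 : x ^+ 2 <= x by rewrite expr2 ler_piMr.
  have h1 : D * m <= (2 - q) * (1 - x) * m by rewrite ler_wpM2r // ltW.
  have h2 : 1 - x ^+ 2 * (1 + (2 - q) * (1 - x) * m) <= 1 - X.
    rewrite lerD2l lerN2; apply: le_trans Xle _.
    by apply: ler_wpM2l => //; rewrite lerD2l.
  have h3 : (2 - q / 2) * (1 - x ^+ 2 * (1 + (2 - q) * (1 - x) * m)) <= (2 - q / 2) * (1 - X).
    by apply: ler_wpM2l => //; lra.
  apply: le_trans h3; apply: le_trans Yle _.
  have h4 : D * (1 + x + x ^+ 2 * m) <= (2 - q) * (1 - x) * (1 + x + x ^+ 2 * m).
    by apply: ler_wpM2r => //; rewrite !addr_ge0 // mulr_ge0 // ltW.
  apply: le_trans h4 _; rewrite -subr_ge0.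
  have -> : (2 - q / 2) * (1 - x ^+ 2 * (1 + (2 - q) * (1 - x) * m)) -
      (2 - q) * (1 - x) * (1 + x + x ^+ 2 * m) =
      (1 - x) * (q / 2 * (1 + x) - x ^+ 2 * m * ((2 - q) * (3 - q / 2))) by field.
  apply: mulr_ge0; first by lra.
  have h5 : x ^+ 2 * m <= q / 16.
    have : x ^+ 2 * m <= 1 * (q / 16) by apply: ler_pM; lra.
    by rewrite mul1r.
  have h6 : (2 - q) * (3 - q / 2) <= 6 by nra.
  have h7 : x ^+ 2 * m * ((2 - q) * (3 - q / 2)) <= q / 16 * 6.
    apply: ler_pM => //; first by rewrite mulr_ge0 // ltW.
    by apply: mulr_ge0; lra.
  have h8 : 0 <= q * x by rewrite mulr_ge0 // ltW.
  by move: h7 h8; move: (x ^+ 2 * m * _) => u; lra.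
- apply: le_trans t'le _; apply: ler_wpM2l; first by rewrite exprn_ge0.
  rewrite lerD2l; move: st wq wpos.
  move: (cmod (1 - tau)) (cmod w) (cmod tau) D0 x0 t1.
  clear -q0 q1 => D m x D0 x0 x1 Dle mq m0.
  have : D * m <= (2 - q) * (1 - x) * (q / 16).
    by apply: ler_pM => //; lra.
  by have := mulr_ge0 (ltW q0) (_ : 0 <= 1 - x); nra.
Qed.

(** [stolz_step] is iterated with [q = 2^-n]: the Stolz constant grows from 1, valid for the real
    ratio [t], and stays below 2, while the orbit of [w] shrinks at the matching rate. The factor
    [t (9 - t) / 8] bounds [x (1 + (1 - x) / 8)] for [0 <= x <= t]. *)
Lemma stolz_orbit w t n : w != 0 -> cmod w <= 1 / 16 -> 0 < t -> t < 1 ->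
  exists tau : complex R,
  [/\ iter n local_cubic (t%:C%C * w) = tau * iter n local_cubic w,
    iter n local_cubic w != 0, cmod (iter n local_cubic w) <= 2 ^- n / 16,
    cmod (1 - tau) <= (2 - 2 ^- n) * (1 - cmod tau) &
    cmod tau <= t * (t * (9 - t) / 8) ^+ n].
Proof.
move=> w0 w16 t0 t1; have k0 : 0 <= t * (9 - t) / 8.
  by rewrite divr_ge0 // mulr_ge0 //; lra.
have k1 : t * (9 - t) / 8 <= 1 by nra.
elim: n => [|n [tau [E wn0 wn st tn]]].
  exists t%:C%C; split; rewrite ?expr0 ?invr1 ?mulr1 //.
  - rewrite -(rmorph1 (real_complex R)) -rmorphB !cmod_real.
    by rewrite !gtr0_norm ?subr_gt0 //; lra.
  - by rewrite cmod_real gtr0_norm.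
have q0 : 0 < 2 ^- n :> R by rewrite invr_gt0 exprn_gt0.
have q1 : 2 ^- n <= 1 :> R by rewrite invf_le1 ?exprn_gt0 // exprn_ege1 // ler1n.
have kn : (t * (9 - t) / 8) ^+ n <= 1 by exact: exprn_ile1.
have tt : cmod tau <= t by apply: le_trans tn _; rewrite ler_piMr // ltW.
have [|tau' [E' wn0' wn' st' tn']] := stolz_step q0 q1 wn0 wn _ st.
  by apply: le_trans tt _; exact: ltW.
have half : 2 ^- n / 2 = 2 ^- n.+1 :> R by rewrite exprS invfM mulrC.
exists tau'; rewrite -half !iterS E; split => //.
apply: le_trans tn' _.
have x0 := cmod_ge0 tau; move: (cmod tau) x0 tt tn => x x0 xt xn.
rewrite [in leRHS]exprSr [leRHS]mulrA.
have h : x * (1 + (1 - x) / 8) <= t * (9 - t) / 8 by nra.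
rewrite expr2 -mulrA; apply: ler_pM => //.
by apply: mulr_ge0 => //; lra.
Qed.

(** Iterates of [square] are powers with exponent [n = 2^k]. As long as [n |w| <= 1], they magnify
    the displacement [w] from 1 by [n], up to a quadratic error. *)
Lemma binomial_first_order w n : n%:R * cmod w <= 1 ->
  cmod ((1 + w) ^+ n - 1 - n%:R * w) <= (n%:R * cmod w) ^+ 2.
Proof.
have a0 := cmod_ge0 w; elim: n => [|n IH] nw.
  by rewrite expr0 subrr mul0r subr0 cmod0 mul0r expr0n.
have nw' : n%:R * cmod w <= 1.
  by apply: le_trans nw; rewrite ler_wpM2r // ler_nat.
have -> : (1 + w) ^+ n.+1 - 1 - n.+1%:R * w =
    (1 + w) * ((1 + w) ^+ n - 1 - n%:R * w) + n%:R * w ^+ 2.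
  by rewrite exprS -natr1; ring.
apply: le_trans (cmodD _ _) _; rewrite (cmodM (1 + w)) (cmodM n%:R) cmodX cmod_nat.
have h1 : cmod (1 + w) <= 1 + cmod w by apply: le_trans (cmodD _ _) _; rewrite cmod1.
have h2 := IH nw'.
apply: (@le_trans _ _ ((1 + cmod w) * (n%:R * cmod w) ^+ 2 + n%:R * cmod w ^+ 2)).
  by rewrite lerD2r; apply: ler_pM; rewrite ?cmod_ge0.
rewrite -natr1; have N0 : 0 <= n%:R :> R by [].
move: nw' a0; move: (cmod w) (n%:R : R) N0 => a N N0 Na a0.
rewrite -subr_ge0.
rewrite (_ : _ - _ = a ^+ 2 * (N + 1 - N * (N * a))); last by ring.
rewrite mulr_ge0 ?sqr_ge0 //.
by have : N * (N * a) <= N * 1 by [rewrite ler_wpM2l|]; lra.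
Qed.

Lemma geometric_small t r : 0 <= t -> t < 1 -> 0 < r ->
  exists N, forall n, (N <= n)%N -> t ^+ n < r.
Proof.
move=> t0 t1 r0; have /cvg_expr /cvgrPdist_lt /(_ _ r0) [N _ HN] : `|t| < 1.
  by rewrite ger0_norm.
exists N => n /HN; rewrite sub0r normrN ger0_norm //.
exact: exprn_ge0.
Qed.

(** The least exponent reaching [1/4] stays below [1/2], because the preceding value is below
    [1/4]. *)
Lemma doubling (a : R) : 0 < a -> a < 1 / 4 ->
  exists k, 1 / 4 <= 2 ^+ k.+1 * a < 1 / 2.
Proof.
move=> a0 a4.
have [k Hk] : exists k, 1 / 4 <= 2 ^+ k.+1 * a.
  exists (Num.truncn a^-1).
  have le2 (m : nat) : m%:R <= 2 ^+ m :> R.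
    by rewrite -natrX ler_nat ltnW // ltn_expl.
  have : a^-1 <= 2 ^+ (Num.truncn a^-1).+1.
    exact: le_trans (ltW (truncnS_gt _)) (le2 _).
  by rewrite -[a^-1]mul1r ler_pdivrMr //; lra.
have ex : exists k, 1 / 4 <= 2 ^+ k.+1 * a by exists k.
case: (ex_minnP ex) => -[|j] jmin minj.
  by exists 0%N; rewrite jmin /= expr1; lra.
exists j.+1; rewrite jmin /= exprS -mulrA.
have : ~~ (1 / 4 <= 2 ^+ j.+1 * a) by apply/negP => /minj; rewrite ltnn.
by rewrite -ltNge; lra.
Qed.

(** Index [n] means [n + 1] factors: the semigroup need not contain the identity. *)
Fixpoint iter_comp (p : {poly complex R}) n := if n is n'.+1 then iter_comp p n' \Po p else p.

Lemma iter_comp_gen (A : set {poly complex R}) p n : A p -> semigroup_gen A (iter_comp p n).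
Proof.
move=> Ap; elim: n => [|n IH] /=; first exact: semigroup_gen_in.
by apply: semigroup_gen_comp => //; exact: semigroup_gen_in.
Qed.

Lemma horner_iter_comp p n z : (iter_comp p n).[z] = iter n.+1 (horner p) z.
Proof.
by elim: n z => [|n IH] z //=; rewrite horner_comp IH /= -iterSr.
Qed.

Lemma iter_square n z : iter n (horner (square R)) z = z ^+ (2 ^ n).
Proof. by elim: n => [|n IH] /=; rewrite ?expr1 // IH squareE -exprM mulnC -expnS. Qed.

Lemma iter_cubic n w : iter n (horner (cubic R)) (1 + w) = 1 + iter n local_cubic w.
Proof. by elim: n => [|n IH] //=; rewrite IH cubic_at_one. Qed.

(** [f n] applies [cubic] [n + 1] times, then [square] until the orbit of [1 + w] is at a definite
    distance from 1. The orbit of [1 + (1 - s) w] is closer to 1 by a ratio tending to 0, so its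
    images under the [f n] tend to 1 although [s] is arbitrarily small. *)
Lemma punctured_disc_Julia (A : set {poly complex R}) w : A (cubic R) -> A (square R) ->
  w != 0 -> cmod w <= 1 / 16 -> Julia (semigroup_gen A) (fin_pt (1 + w)).
Proof.
move=> Ac As w0 w16 /Fatou_locally_normal.
have t0 : (0 : R) < 1 / 2 by lra.
have t1 : 1 / 2 < 1 :> R by lra.
have orb n : iter n.+1 local_cubic w != 0 /\ cmod (iter n.+1 local_cubic w) <= 1 / 16.
  have [tau [_ h1 h2 _ _]] := stolz_orbit n.+1 w0 w16 t0 t1.
  split => //; apply: le_trans h2 _; rewrite ler_pM2r //.
  by rewrite invf_le1 ?exprn_gt0 // exprn_ege1 // ler1n.
have /choice[k Hk] n : exists k, 1 / 4 <= 2 ^+ k.+1 * cmod (iter n.+1 local_cubic w) < 1 / 2.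
  have [h1 h2] := orb n; apply: doubling; first by rewrite cmod_gt0.
  by apply: le_lt_trans h2 _; lra.
pose f n := iter_comp (square R) (k n) \Po iter_comp (cubic R) n.
have fE n v : (f n).[1 + v] = (1 + iter n.+1 local_cubic v) ^+ (2 ^ (k n).+1).
  by rewrite /f horner_comp !horner_iter_comp iter_cubic iter_square.
have est n v : let x := 2 ^+ (k n).+1 * cmod (iter n.+1 local_cubic v) in x <= 1 ->
    cmod ((f n).[1 + v] - 1) <= x + x ^+ 2 /\ x - x ^+ 2 <= cmod ((f n).[1 + v] - 1).
  move=> x x1; rewrite fE; set p := iter n.+1 local_cubic v in x x1 *.
  have xE : (2 ^ (k n).+1)%:R * cmod p = x by rewrite natrX.
  have := @binomial_first_order p (2 ^ (k n).+1)%N; rewrite xE => /(_ x1).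
  set N := ((2 ^ (k n).+1)%:R : complex R).
  have Np : cmod (N * p) = x by rewrite cmodM cmod_nat.
  set u := _ - 1 => H; split.
    have := cmodD (u - N * p) (N * p); rewrite subrK Np.
    by move: H; move: (cmod (u - _)) (cmod u) => a b; lra.
  have H2 := cmod_sub_le (N * p) (N * p - u).
  rewrite (_ : N * p - (N * p - u) = u) in H2; last by ring.
  move: H H2; rewrite Np (cmod_distC (N * p)).
  by move: (cmod (u - _)) (cmod u) => a b; lra.
(* [3/16] is the minimum of [x - x^2] on [[1/4, 1/2]], attained at [1/4]. *)
apply: (@not_normal_at R _ _ 1 (3 / 16) f); first by lra.
- by move=> n; apply: semigroup_gen_comp; exact: iter_comp_gen.
- move=> n; have /andP[k1 k2] := Hk n.
  have [|_] := est n w; first by apply: le_trans (ltW k2) _; lra.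
  apply: le_trans; move: k1 k2; move: (2 ^+ _ * _) => y k1 k2.
  have : 0 <= (y - 1 / 4) * (1 / 2 - y) by apply: mulr_ge0; lra.
  lra.
move=> e e0; pose s := Num.min (1 / 2) (e / 2).
have s0 : 0 < s by rewrite lt_min; apply/andP; split; lra.
have s2 : s <= 1 / 2 by rewrite ge_min lexx.
have se : s < e by rewrite gt_min; apply/orP; right; lra.
have t'0 : 0 < 1 - s by lra.
have t'1 : 1 - s < 1 by lra.
exists (1 + (1 - s)%:C%C * w).
  rewrite (_ : _ - _ = (- s)%:C%C * w); last first.
    by rewrite rmorphB rmorphN rmorph1 /=; ring.
  rewrite cmodM cmod_real normrN gtr0_norm //; apply: le_lt_trans se.
  by apply: ler_piMr; [exact: ltW|apply: le_trans w16 _; lra].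
move=> r r0; pose kappa := (1 - s) * (9 - (1 - s)) / 8.
have kap0 : 0 <= kappa by rewrite /kappa; nra.
have kap1 : kappa < 1 by rewrite /kappa; nra.
have [N HN] := geometric_small kap0 kap1 r0.
exists N => n Nn.
have [tau' [E _ _ _ tn]] := stolz_orbit n.+1 w0 w16 t'0 t'1.
have /andP[k1 k2] := Hk n.
have tau0 := cmod_ge0 tau'.
have tle : cmod tau' < r.
  apply: le_lt_trans tn _; apply: le_lt_trans (HN n.+1 (leqW Nn)).
  by apply: ler_piMl; [exact: exprn_ge0|exact: ltW].
have tle1 : cmod tau' <= 1.
  apply: le_trans tn _; rewrite -[leRHS]mulr1; apply: ler_pM; rewrite ?exprn_ge0 //.
  - exact: ltW.
  - exact: ltW.
  - by apply: exprn_ile1 => //; exact: ltW.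
have := est n ((1 - s)%:C%C * w); rewrite E cmodM mulrCA.
move: k1 k2; set y := 2 ^+ _ * _ => k1 k2.
have yle : cmod tau' * y <= cmod tau' / 2 by apply: ler_wpM2l => //; lra.
have y0 : 0 <= cmod tau' * y by rewrite mulr_ge0 //; lra.
move=> [|H _]; first by apply: le_trans yle _; lra.
apply: le_lt_trans H _; apply: le_lt_trans tle.
move: yle y0 tle1 tau0; move: (cmod tau') (_ * y) => a b yle y0 a1 a0.
by rewrite expr2; nra.
Qed.

End SuperattractingPoint.

(** * The Julia set of the semigroup *)

Section JuliaSet.
Context (R : realType).
Implicit Types (z w : Cplane R) (r s t : R) (E : set (Cplane R)).

Local Notation rho := (outer_radius R).
Local Notation tau := (inner_radius R).
Local Notation cubic := (cubic R).
Local Notation square := (square R).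
Local Notation shrink := (shrink R).

Definition generators : set {poly complex R} := [set cubic; square; shrink].
Local Notation gens := generators.
Definition example_semigroup : set {poly complex R} := semigroup_gen gens.
Local Notation G := example_semigroup.
Definition Julia_plane : set (Cplane R) := planar (Julia G).
Local Notation J := Julia_plane.

Lemma gen_cubic : gens cubic. Proof. by left; left. Qed.
Lemma gen_square : gens square. Proof. by left; right. Qed.
Lemma gen_shrink : gens shrink. Proof. by right. Qed.

Lemma gens_case (P : {poly complex R} -> Prop) : P cubic -> P square -> P shrink ->
  forall h, gens h -> P h.
Proof. by move=> h1 h2 h3 h [[->|->]|->]. Qed.

Lemma gens_size h : gens h -> (2 < size h)%N.
Proof.
by move: h; apply: gens_case; rewrite ?size_cubic ?size_square ?size_shrink.
Qed.

Lemma gens_size1 h : gens h -> (1 < size h)%N.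
Proof. by move=> /gens_size; exact: ltnW. Qed.

Lemma Fatou_small z : cmod z < 1 / 4 -> Fatou G (fin_pt z).
Proof.
move=> z4; apply/Fatou_locally_normal.
have e0 : 0 < 1 / 4 - cmod z by rewrite subr_gt0.
apply: (@locally_normal_bounded R G z (1 / 4 - cmod z) (1 / 4) e0).
have stab h : gens h -> forall y, cmod y <= 1 / 4 -> cmod h.[y] <= 1 / 4.
  move: h; apply: gens_case => y y4; [exact: cubic_small|exact: square_small|].
  apply: le_trans (shrink_small _) _; last by lra.
  by apply: le_trans y4 _; lra.
move=> p Gp y yz; apply: (semigroup_gen_stable stab) => //=.
have := cmodD (y - z) z; rewrite subrK => /le_trans; apply.
by rewrite -lerBrDr.
Qed.

Lemma gens_large h : gens h -> forall z, rho < cmod z -> rho < cmod h.[z].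
Proof.
have two z : rho < cmod z -> 2 <= cmod z.
  by move=> /ltW /(le_trans _); apply; rewrite /outer_radius; lra.
move: h; apply: gens_case => z zr.
- apply: lt_le_trans (cubic_large (two z zr)); exact/sqr_gt_rho/two.
- by rewrite cmod_square; exact/sqr_gt_rho/two.
- by apply: lt_trans (shrink_large zr).
Qed.

Lemma Fatou_large z : rho < cmod z -> Fatou G (fin_pt z).
Proof.
move=> zr; apply/Fatou_locally_normal.
have e0 : 0 < (cmod z - rho) / 2 by rewrite divr_gt0 // subr_gt0.
apply: (@locally_normal_away R G z _ rho e0 (rho_gt0 R)) => p Gp y yz.
apply: ltW; apply: (semigroup_gen_stable gens_large) => //=.
have := cmodD (z - y) y; rewrite subrK (cmod_distC z).
by move: yz zr; move: (cmod (y - z)) (cmod z) (cmod y) => a b c *; lra.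
Qed.

Lemma Fatou_inf : Fatou G (inf_pt R).
Proof.
apply: (@Fatou_infinity R cubic square shrink 4 2) => //.
  by rewrite ltr1n.
move=> h z /(@gens_case (fun h => 4 < cmod z -> 2 * cmod z <= cmod h.[z])); apply.
- move=> z4; have z2 : 2 <= cmod z by move: z4; move: (cmod z) => m; lra.
  apply: le_trans (cubic_large z2).
  by move: z4; move: (cmod z) => m m4; rewrite expr2; nra.
- by move=> z4; rewrite cmod_square; move: z4; move: (cmod z) => m m4; rewrite expr2; nra.
- exact: shrink_expands.
Qed.

Lemma J_bounds z : J z -> 1 / 4 <= cmod z <= rho.
Proof.
move=> Jz; apply/andP; split; rewrite leNgt; apply/negP => H; apply: Jz.
  exact: Fatou_small.
exact: Fatou_large.
Qed.

Lemma J_backward h z : gens h -> J h.[z] -> J z.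
Proof.
by move=> Ah; apply: Julia_backward; [exact: semigroup_gen_in|exact: gens_size1].
Qed.

Lemma J_neq2 z : J z -> cmod z != 2.
Proof.
move=> Jz; apply/eqP => z2; apply: Jz; apply: Fatou_of_images.
- apply: Fatou_large; apply: lt_le_trans (cubic_large _); rewrite z2 //.
  exact: sqr_gt_rho.
- by apply: Fatou_large; rewrite cmod_square z2; exact: sqr_gt_rho.
- apply: Fatou_small; apply: le_lt_trans (shrink_small _) _; rewrite ?z2 //.
  by lra.
Qed.

(** Beyond radius 2 both [cubic] and [square] land in the escaping region, so only the [shrink]
    image can account for a Julia point. *)
Lemma J_outer z : J z -> 2 < cmod z -> J shrink.[z].
Proof.
move=> Jz z2 F3; apply: Jz; apply: Fatou_of_images => //; apply: Fatou_large.
  by apply: lt_le_trans (cubic_large (ltW z2)); exact/sqr_gt_rho/ltW.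
by rewrite cmod_square; exact/sqr_gt_rho/ltW.
Qed.

Lemma shrink_on_circle z : cmod shrink.[z] = rho <-> cmod z = rho.
Proof.
rewrite cmod_shrink; have r0 := rho_gt0 R; split; last first.
  by move=> ->; rewrite divff ?gt_eqF // expr1n mulr1.
move=> H; have : (cmod z / rho) ^+ 8 = 1.
  by apply: (mulfI (rho_neq0 R)); rewrite mulr1.
move/eqP; rewrite pexprn_eq1 // ?divr_ge0 ?cmod_ge0 ?(ltW r0) //= => /eqP H1.
by rewrite -[cmod z](divfK (rho_neq0 R)) H1 mul1r.
Qed.

Lemma shrink_inside t z : 0 <= t -> t <= 1 -> cmod z <= t * rho ->
  cmod shrink.[z] <= t * cmod z.
Proof.
move=> t0 t1 zt; have r0 := rho_gt0 R.
apply: le_trans (shrink_le _) _.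
  by apply: le_trans zt _; rewrite ler_piMl // ltW.
by rewrite mulrC ler_wpM2r ?cmod_ge0 // ler_pdivrMr.
Qed.

Lemma iter_shrink_le t z n : 0 <= t -> t <= 1 -> cmod z <= t * rho ->
  cmod (iter n (horner shrink) z) <= t ^+ n * cmod z.
Proof.
move=> t0 t1 zt; elim: n => [|n IH]; first by rewrite expr0 mul1r.
have tn : t ^+ n <= 1 by exact: exprn_ile1.
have le1 : cmod (iter n (horner shrink) z) <= t * rho.
  by apply: le_trans IH _; apply: le_trans zt; rewrite ler_piMl ?cmod_ge0.
rewrite iterS exprS -mulrA; apply: le_trans (shrink_inside t0 t1 le1) _.
exact: ler_wpM2l.
Qed.

(** The circle is invariant under [shrink], while points just inside it are drawn to 0. A general
    [A] serves both [G] and the semigroup of [shrink] alone. *)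
Lemma circle_Julia (A : set {poly complex R}) z : A shrink -> cmod z = rho ->
  Julia (semigroup_gen A) (fin_pt z).
Proof.
move=> Ac zr /Fatou_locally_normal; have r0 := rho_gt0 R.
apply: (@not_normal_at R _ _ 0 rho (iter_comp shrink)) => //.
- by move=> n; exact: iter_comp_gen.
- move=> n; rewrite subr0 horner_iter_comp; elim: n.+1 => [|m IH]; first by rewrite /= zr.
  suff -> : cmod (iter m.+1 (horner shrink) z) = rho by [].
  elim: m {IH} => [|m IH]; rewrite iterS; first exact/shrink_on_circle.
  exact/shrink_on_circle.
move=> e e0; pose s := Num.min (1 / 2) (e / (2 * rho)).
have s0 : 0 < s.
  rewrite lt_min; apply/andP; split; first by lra.
  by rewrite divr_gt0 // mulr_gt0.
have s2 : s <= 1 / 2 by rewrite ge_min lexx.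
have se : s * rho < e.
  apply: (@le_lt_trans _ _ (e / (2 * rho) * rho)).
    by rewrite ler_pM2r // ge_min lexx orbT.
  have -> : e / (2 * rho) * rho = e / 2 by field; exact: rho_neq0.
  by lra.
have t0 : 0 <= 1 - s by lra.
have t1 : 1 - s < 1 by lra.
exists ((1 - s)%:C%C * z).
  rewrite (_ : _ - _ = (- s)%:C%C * z); last first.
    by rewrite rmorphB rmorphN rmorph1 /=; ring.
  by rewrite cmodM cmod_real normrN gtr0_norm // zr.
move=> r rr0.
have [N HN] := geometric_small t0 t1 (divr_gt0 rr0 r0).
exists N => n Nn; rewrite subr0 horner_iter_comp.
have xz : cmod ((1 - s)%:C%C * z) = (1 - s) * rho.
  by rewrite cmodM cmod_real ger0_norm // zr.
have := @iter_shrink_le (1 - s) ((1 - s)%:C%C * z) n.+1 t0 (ltW t1).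
rewrite xz => /(_ (lexx _)) /le_lt_trans; apply.
rewrite mulrA -exprSr -ltr_pdivlMr //; apply: HN.
exact: leqW (leqW _).
Qed.

Lemma circle_J z : cmod z = rho -> J z.
Proof. by move=> zr; exact: circle_Julia gen_shrink zr. Qed.

Lemma Julia_shrink :
  Julia (semigroup_gen [set shrink]) = @fin_pt R @` circle rho.
Proof.
have r0 := rho_gt0 R; apply/seteqP; split; last first.
  by move=> _ [z zr <-]; exact: circle_Julia.
move=> [z|] Jz; last first.
  exfalso; apply: Jz.
  (* [Fatou_infinity] speaks of three generators; here they coincide. *)
  have -> : [set shrink] = [set shrink; shrink; shrink].
    by rewrite !setUid.
  apply: (@Fatou_infinity R shrink shrink shrink 4 2) => //; try by lra.
  by move=> h y [[->|->]|->]; exact: shrink_expands.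
exists z => //; apply/eqP; rewrite eq_le; apply/andP; split;
    rewrite leNgt; apply/negP => zr; apply: Jz; apply/Fatou_locally_normal.
  have e0 : 0 < (cmod z - rho) / 2 by rewrite divr_gt0 // subr_gt0.
  apply: (@locally_normal_away R _ z _ rho e0 r0) => p Gp y yz.
  apply: ltW; apply: (@semigroup_gen_stable R [set shrink] [set y | rho < cmod y]) Gp _ _.
    by move=> _ -> w /= wr; exact: lt_trans (shrink_large wr).
  have := cmodD (z - y) y; rewrite subrK (cmod_distC z) /=.
  by move: yz zr; move: (cmod (y - z)) (cmod z) (cmod y) => a b c *; lra.
have e0 : 0 < rho - cmod z by rewrite subr_gt0.
apply: (@locally_normal_bounded R _ z _ rho e0) => p Gp y yz.
apply: (@semigroup_gen_stable R [set shrink] [set y | cmod y <= rho]) Gp _ _.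
  move=> _ -> w /= wr; apply: le_trans (@shrink_inside 1 _ _ _ _) _ => //.
    by rewrite mul1r.
  by rewrite mul1r.
have := cmodD (y - z) z; rewrite subrK /= => /le_trans; apply.
by rewrite -lerBrDr.
Qed.

(** * Levels of the Julia set and the rings inside them *)

Local Notation it n := (iter n (horner shrink)).

(** The set M of the overview; [level n] is its inverse image under the [n]-th iterate of h3. *)
Definition core : set (Cplane R) := [set z | J z /\ cmod z < 2].
Definition level n : set (Cplane R) := [set z | core (it n z)].

Lemma iter_small z n : cmod z <= 2 -> cmod (it n.+1 z) <= 1 / 8.
Proof.
move=> z2; elim: n => [|n IH]; first exact: shrink_small.
by rewrite iterS; apply: shrink_small; apply: le_trans IH _; lra.
Qed.

Lemma J_iter_neq2 n z : J z -> cmod (it n z) != 2.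
Proof.
elim: n z => [|n IH] z Jz; first exact: J_neq2.
have := J_neq2 Jz; rewrite neq_lt => /orP[z2|z2].
  rewrite lt_eqF //; apply: le_lt_trans (iter_small n (ltW z2)) _; lra.
by rewrite iterSr; apply: IH; exact: J_outer.
Qed.

Lemma J_iter_backward n z : J (it n z) -> J z.
Proof.
by elim: n z => [//|n IH] z; rewrite iterSr => /IH; exact: J_backward gen_shrink.
Qed.

Lemma level_J n : level n `<=` J.
Proof. by move=> z [/J_iter_backward]. Qed.

(** After an iterate of modulus at most 2 all later ones are at most [1/8], whereas Julia points
    have modulus at least [1/4]. So the orbit enters the disc of radius 2 exactly at time [n], and
    the levels are disjoint. *)
Lemma level_lt n z k : level n z -> (k < n)%N -> 2 < cmod (it k z).
Proof.
move=> [Jn _] kn; rewrite ltNge; apply/negP => k2.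
have /andP[+ _] := J_bounds Jn; apply/negP; rewrite -ltNge.
have -> : n = (k + (n - k.+1).+1)%N by rewrite addnS -addSn subnKC.
by rewrite addnC iterD; apply: le_lt_trans (iter_small _ k2) _; lra.
Qed.

Lemma J_iter n z : J z -> (forall k, (k < n)%N -> 2 < cmod (it k z)) -> J (it n z).
Proof.
move=> Jz; elim: n => [//|n IH] H; rewrite iterS; apply: J_outer; last exact: H.
by apply: IH => k kn; apply: H; exact: ltnW.
Qed.

Lemma levelP n z : level n z <->
  [/\ J z, (forall k, (k < n)%N -> 2 < cmod (it k z)) & cmod (it n z) < 2].
Proof.
split=> [nz|[Jz H n2]]; last by split => //; exact: J_iter.
by split; [exact: level_J nz|move=> k; exact: level_lt|case: nz].
Qed.

Lemma iter_continuous n : continuous (fun z : Cplane R => cmod (it n z) : R).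
Proof.
have c : continuous (fun z : Cplane R => it n z : Cplane R).
  elim: n => [|n IH] z; first exact: cvg_id.
  apply: (@continuous_comp _ _ _ (fun z : Cplane R => it n z : Cplane R)
    (fun z : Cplane R => shrink.[z] : Cplane R)); first exact: IH.
  exact: horner_continuous.
move=> z; apply: (@continuous_comp _ _ _ (fun z : Cplane R => it n z : Cplane R)
    (cmod : Cplane R -> R)); first exact: c.
exact: cmod_continuous.
Qed.

(** No iterate of a Julia point has modulus 2, so the time of entry into the disc is constant on a
    connected subset of J. *)
Lemma connected_level E n x : connected E -> E `<=` J -> E x -> level n x -> E `<=` level n.
Proof.
move=> cE EJ Ex nx y Ey.
have split k : (forall x, E x -> cmod (it k x) < 2) \/ (forall x, E x -> 2 < cmod (it k x)).
  apply: connected_real_avoid cE _; first exact: iter_continuous.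
  by move=> u /EJ; exact: J_iter_neq2.
apply/levelP; split; first exact: EJ.
  move=> k kn; have [H|H] := split k; last exact: H.
  by have := lt_trans (level_lt nx kn) (H x Ex); rewrite ltxx.
have [H|H] := split n; first exact: H.
by have [_ xn] := nx; have := lt_trans xn (H x Ex); rewrite ltxx.
Qed.

(** Inside the circle of radius [rho] the iterates of [shrink] contract geometrically; the first one
    of modulus below 2 determines the level. *)
Lemma J_cover z : J z -> cmod z = rho \/ exists n, level n z.
Proof.
move=> Jz; have /andP[_ zr] := J_bounds Jz; have r0 := rho_gt0 R.
have [|zn] := eqVneq (cmod z) rho; [by left|right].
have zr' : cmod z < rho by rewrite lt_neqAle zn.
pose t := cmod z / rho.
have t0 : 0 <= t by rewrite divr_ge0 ?cmod_ge0 // ltW.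
have t1 : t < 1 by rewrite ltr_pdivrMr // mul1r.
have [N HN] := geometric_small t0 t1 (divr_gt0 (ltr0n R 2 : 0 < 2 :> R) r0).
have ex : exists n, cmod (it n z) < 2.
  exists N; apply: le_lt_trans (@iter_shrink_le t z N t0 (ltW t1) _) _.
    by rewrite divfK ?gt_eqF.
  apply: (@le_lt_trans _ _ (t ^+ N * rho)); first by rewrite ler_wpM2l ?exprn_ge0.
  by rewrite -ltr_pdivlMr //; exact: HN.
case: (ex_minnP ex) => n n2 nmin; exists n; apply/levelP; split => // k kn.
rewrite lt_neqAle eq_sym J_iter_neq2 //= leNgt; apply/negP => k2.
by have := nmin _ k2; rewrite leqNgt kn.
Qed.

Lemma connected_circle E x : connected E -> E `<=` J -> E x -> cmod x = rho ->
  E `<=` circle rho.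
Proof.
move=> cE EJ Ex xr y Ey; have [//|[n yn]] := J_cover (EJ y Ey).
have [_] := connected_level cE EJ Ey yn Ex.
suff -> : cmod (it n x) = rho by rewrite /outer_radius; lra.
by elim: (n) => [//|m IH]; rewrite iterS; exact/shrink_on_circle.
Qed.

Lemma iter_radius n : exists2 s, tau <= s <= rho &
  forall z, cmod (it n z) = tau <-> cmod z = s.
Proof.
elim: n => [|n [s /andP[ts sr] Hs]].
  by exists tau => //; rewrite lexx /inner_radius /outer_radius; lra.
have [s' s'b Hs'] := shrink_circle ts sr.
exists s' => // z; rewrite iterSr; split.
  by move=> /(Hs shrink.[z])/Hs'.
by move=> /Hs' h; apply/(Hs shrink.[z]).
Qed.

Definition ring n : set (Cplane R) := [set z | cmod (it n z) = tau].

Lemma ring_circle n : exists2 s, tau <= s <= rho & ring n = circle s.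
Proof.
have [s sb Hs] := iter_radius n; exists s => //.
by apply/seteqP; split=> z; rewrite /ring /circle /= => /Hs.
Qed.

Lemma ring0_core : ring 0 `<=` core.
Proof.
move=> z; rewrite /ring /= => zt; split; last by rewrite zt /inner_radius; lra.
apply: (J_backward gen_square); apply: circle_J.
by rewrite cmod_square zt /inner_radius /outer_radius; lra.
Qed.

Lemma ring_level n : ring n `<=` level n.
Proof. by move=> z nz; exact: ring0_core. Qed.

Lemma circle_nonempty r : 0 <= r -> circle r !=set0.
Proof.
by move=> r0; exists (r%:C%C : Cplane R); exact: etrans (cmod_real r) (ger0_norm r0).
Qed.

Lemma ring_nonempty n : ring n !=set0.
Proof.
have [s /andP[ts _] ->] := ring_circle n; apply: circle_nonempty.
by apply: le_trans ts; rewrite /inner_radius; lra.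
Qed.

(** Points of modulus [rho] get their own clause, since they form a component that no ring meets. *)
Definition joined z := cmod z = rho \/
  exists n E, [/\ connected E, E `<=` J, E z & ring n `<=` E].

Lemma level_rho_J : cubic_level rho `<=` J.
Proof. by move=> z zr; apply: (J_backward gen_cubic); exact: circle_J. Qed.

(** On the circle of radius [7/4] the modulus of [cubic] runs from [49/32], below [tau], to
    [13/2 * rho]. *)
Lemma cubic_level_meets_ring0 L : tau <= L -> L <= rho -> cubic_level L `&` ring 0 !=set0.
Proof.
move=> tL Lr; have [||||z zt zL] := @cubic_on_circle R tau L.
- by rewrite /inner_radius; lra.
- by apply: le_trans tL; rewrite /inner_radius; lra.
- have L2 : tau ^+ 2 <= L ^+ 2.
    by rewrite ler_pXn2r ?nnegrE //; first (by rewrite /inner_radius; lra);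
      apply: le_trans tL; rewrite /inner_radius; lra.
  by apply: le_trans L2; rewrite /inner_radius; lra.
- by apply: le_trans Lr _; rewrite /inner_radius /outer_radius; lra.
by exists z.
Qed.

Lemma tau_le_rho : tau <= rho. Proof. by rewrite /inner_radius /outer_radius; lra. Qed.

Lemma level_union_connected : connected (cubic_level rho `|` ring 0).
Proof.
apply: connectedU; first exact: cubic_level_meets_ring0 tau_le_rho (lexx _).
  by apply: cubic_level_connected; rewrite /outer_radius; lra.
have [s /andP[ts _] ->] := ring_circle 0; apply: circle_connected.
by apply: le_trans ts; rewrite /inner_radius; lra.
Qed.

(** The preimage of [ring n], a circle of radius [s] in [[tau, rho]], is the connected level curve
    of level [s], so the preimage of [E] is connected. The curve also crosses [ring 0], to which the
    new link leads. *)
Lemma joined_cubic z : joined cubic.[z] -> joined z.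
Proof.
have ringJ : ring 0 `<=` J by apply: subset_trans (@level_J 0); exact: ring_level.
move=> [zr|[n [E [cE EJ Ez nE]]]]; right.
  exists 0%N, (cubic_level rho `|` ring 0); split; last by right.
  - exact: level_union_connected.
  - by rewrite subUset; split; [exact: level_rho_J|].
  - by left.
have [s /andP[ts sr] sE] := ring_circle n.
have s32 : 3 / 2 <= s by apply: le_trans ts; rewrite /inner_radius; lra.
exists 0%N, ((plane_map cubic @^-1` E) `|` ring 0); split; last by right.
- apply: connectedU.
  + have [y [yL y0]] := cubic_level_meets_ring0 ts sr; exists y; split => //.
    by apply: nE; rewrite sE.
  + apply: (connected_preimage (gens_size1 gen_cubic) cE nE (ring_nonempty n)).
    by rewrite sE; exact: cubic_level_connected.
  + have [s' /andP[ts' _] ->] := ring_circle 0; apply: circle_connected.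
    by apply: le_trans ts'; rewrite /inner_radius; lra.
- by rewrite subUset; split => // y /EJ; exact: J_backward gen_cubic.
- by left.
Qed.

(** The preimage of [ring n] is the circle of radius [Num.sqrt s], which may lie strictly inside
    [ring 0]. The level curve [cubic_level rho] crosses both circles and bridges the gap. *)
Lemma joined_square z : joined square.[z] -> joined z.
Proof.
have ringJ : ring 0 `<=` J by apply: subset_trans (@level_J 0); exact: ring_level.
have tau0 : 0 < tau by rewrite /inner_radius; lra.
move=> [zr|[n [E [cE EJ Ez nE]]]]; right.
  exists 0%N, (ring 0); split => //.
  - have [s' /andP[ts' _] ->] := ring_circle 0; apply: circle_connected.
    by apply: le_trans ts'; exact: ltW.
  - apply/eqP; rewrite /= -(eqrXn2 (n := 2)) ?cmod_ge0 ?(ltW tau0) //.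
    by rewrite -cmod_square zr /inner_radius /outer_radius; apply/eqP; lra.
have [s /andP[ts sr] sE] := ring_circle n.
have s0 : 0 <= s by apply: le_trans ts; exact: ltW.
have preE : plane_map square @^-1` ring n = circle (Num.sqrt s).
  rewrite sE; apply/seteqP; split=> y; rewrite /circle /= cmod_square.
    by move=> <-; rewrite sqrtr_sqr ger0_norm ?cmod_ge0.
  by move=> ->; rewrite sqr_sqrtr.
exists 0%N, ((plane_map square @^-1` E) `|` (cubic_level rho `|` ring 0)); split.
- apply: connectedU; last exact: level_union_connected.
    have t2 : Num.sqrt s ^+ 2 = s by rewrite sqr_sqrtr.
    have t0 : 0 <= Num.sqrt s by exact: sqrtr_ge0.
    have t1 : 1 < Num.sqrt s.
      by move: t2 t0 ts; move: (Num.sqrt s) => t t2 t0; rewrite -t2 /inner_radius; nra.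
    have tle : Num.sqrt s <= 7 / 4.
      by move: t2 t0 sr; move: (Num.sqrt s) => t t2 t0; rewrite -t2 /outer_radius; nra.
    have [||||y yt yL] := @cubic_on_circle R (Num.sqrt s) rho.
    + by lra.
    + exact: ltW (rho_gt0 R).
    (* For [t] between 1 and 2 one has [|3 - 2 t| <= 1], so the value of [|cubic|] at [t] is at most
       [t^2 = s]. *)
    + have b1 : (Num.sqrt s ^+ 2 * (3 - 2 * Num.sqrt s)) ^+ 2 <= (Num.sqrt s ^+ 2) ^+ 2.
        rewrite exprMn -[leRHS]mulr1; apply: ler_wpM2l; first exact: sqr_ge0.
        by move: t1 tle; move: (Num.sqrt s) => t t1 tle; rewrite expr2; nra.
      apply: le_trans b1 _; rewrite t2 ler_pXn2r ?nnegrE //.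
      exact: ltW (rho_gt0 R).
    + move: t1 t2 ts; rewrite /inner_radius /outer_radius; move: (Num.sqrt s) => t t1 <- ts; nra.
    exists y; split; last by left.
    suff : (plane_map square @^-1` ring n) y by exact: nE.
    by rewrite preE.
  apply: (connected_preimage (gens_size1 gen_square) cE nE (ring_nonempty n)).
  by rewrite preE; apply: circle_connected; exact: sqrtr_ge0.
- rewrite !subUset; split; first by move=> y /EJ; exact: J_backward gen_square.
  by split; [exact: level_rho_J|].
- by left.
- by move=> y y0; right; right.
Qed.

Lemma joined_shrink z : joined shrink.[z] -> joined z.
Proof.
move=> [/shrink_on_circle zr|[n [E [cE EJ Ez nE]]]]; [by left|right].
have preE : plane_map shrink @^-1` ring n = ring n.+1.
  by apply/seteqP; split=> y; rewrite /ring /plane_map /= -iterSr.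
exists n.+1, (plane_map shrink @^-1` E); split => //.
- apply: (connected_preimage (gens_size1 gen_shrink) cE nE (ring_nonempty n)).
  rewrite preE; have [s /andP[ts _] ->] := ring_circle n.+1; apply: circle_connected.
  by apply: le_trans ts; rewrite /inner_radius; lra.
- by move=> y /EJ; exact: J_backward gen_shrink.
- by rewrite -preE => y; exact: nE.
Qed.

Lemma joined_hit g z : G g -> cmod g.[z] = rho -> joined z.
Proof.
have step h y : gens h -> joined h.[y] -> joined y.
  move=> Ah; move: y; move: h Ah; apply: gens_case => y.
  - exact: joined_cubic.
  - exact: joined_square.
  - exact: joined_shrink.
move=> Gg; move: z; move: g Gg; apply: semigroup_gen_ind_right => [h Ah|g h Gg IH Ah] z.
  by move=> hz; apply: (step h) => //; left.
by rewrite horner_comp => /IH; exact: step.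
Qed.

(* Otherwise every element of [G] stays on one side of the circle of radius
   [rho] near [z], and both halves of [G] are normal there. *)
Lemma J_dense_hit z e : J z -> 0 < e ->
  exists2 x, cmod (x - z) < e & exists2 g, G g & cmod g.[x] = rho.
Proof.
move=> Jz e0; apply: contrapT => none.
have side g : G g -> (forall y, disc z e y -> cmod g.[y] < rho) \/
    (forall y, disc z e y -> rho < cmod g.[y]).
  move=> Gg; apply: (@connected_real_avoid R _ (fun y : Cplane R => cmod g.[y]) rho).
  - move=> y; apply: (@continuous_comp _ _ _ (fun y : Cplane R => g.[y] : Cplane R)
      (cmod : Cplane R -> R)); first exact: horner_continuous.
    exact: cmod_continuous.
  - exact: disc_connected.
  - by move=> y yz; apply/eqP => gy; apply: none; exists y => //; exists g.
have e2 : 0 < e / 2 by lra.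
have sub y : cmod (y - z) <= e / 2 -> disc z e y.
  by rewrite /disc /= => /le_lt_trans; apply; lra.
apply: Jz; apply/Fatou_locally_normal.
apply: (@locally_normalS R _ ([set g | forall y, disc z e y -> cmod g.[y] < rho] `|`
    [set g | forall y, disc z e y -> rho < cmod g.[y]])); first by move=> g /side.
apply: locally_normalU.
  apply: (@locally_normal_bounded R _ z (e / 2) rho e2) => p Hp y /sub yz.
  by apply: ltW; exact: Hp.
apply: (@locally_normal_away R _ z (e / 2) rho e2 (rho_gt0 R)) => p Hp y /sub yz.
by apply: ltW; exact: Hp.
Qed.

Lemma J_closed : closed J.
Proof. by have /continuous_closedP := @fin_pt_continuous R; apply; exact: Julia_closed. Qed.

(** The component of J through [ring 0] is closed, so backward-orbit points near a given core point
    suffice. Such a point is in [level 0], which its link [E] cannot leave; as [E] contains a ring,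
    that ring is [ring 0]. *)
Lemma core_connected : connected core.
Proof.
have [c0 c0r] := ring_nonempty 0.
have Jc0 : J c0 by have [] := ring0_core c0r.
suff -> : core = connected_component J c0 by exact: component_connected.
apply/seteqP; split; last first.
  move=> z [E [Ec EJ cE] Ez].
  by apply: (connected_level (n := 0) cE EJ Ec) => //; exact: ring_level.
move=> z [Jz z2]; apply: (component_closed J_closed) => U /nbhs_disc[e e0 eU].
have d0 : 0 < Num.min e (2 - cmod z) by rewrite lt_min e0 subr_gt0.
have [x xz [g Gg gx]] := J_dense_hit Jz d0.
exists x; move: xz; rewrite lt_min => /andP[xe x2]; split; last exact: eU.
have xlt : cmod x < 2.
  have := cmodD (x - z) z; rewrite subrK => /le_lt_trans; apply.
  by rewrite -ltrBrDr.
have [xr|[n [E [cE EJ Ex nE]]]] := joined_hit Gg gx.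
  by move: xlt; rewrite xr /outer_radius; lra.
have x0 : level 0 x by split => //; exact: EJ.
have E0 := connected_level cE EJ Ex x0.
have [y yn] := ring_nonempty n.
have n0 : n = 0%N.
  case: (n) yn nE => // m ym mE; have := level_lt (ring_level ym) (ltn0Sn m).
  have [_ /=] := E0 _ (mE _ ym) => h1 h2.
  by have := lt_trans h1 h2; rewrite ltxx.
by exists E => //; split => //; apply: nE; rewrite n0.
Qed.

Lemma level_connected n : connected (level n).
Proof.
elim: n => [|n IH]; first exact: core_connected.
have -> : level n.+1 = plane_map shrink @^-1` level n.
  by apply/seteqP; split=> y; rewrite /level /plane_map /= -iterSr.
apply: (connected_preimage (gens_size1 gen_shrink) IH (@ring_level n) (ring_nonempty n)).
have -> : plane_map shrink @^-1` ring n = ring n.+1.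
  by apply/seteqP; split=> y; rewrite /ring /plane_map /= -iterSr.
have [s /andP[ts _] ->] := ring_circle n.+1; apply: circle_connected.
by apply: le_trans ts; rewrite /inner_radius; lra.
Qed.

End JuliaSet.

Arguments generators : clear implicits.
Arguments example_semigroup : clear implicits.
Arguments Julia_plane : clear implicits.
Arguments core : clear implicits.
Arguments level : clear implicits.

(** * Components, surrounding order and postcritical set of the example *)

Section Conclusion.
Context (R : realType).
Implicit Types (z w : Cplane R) (E : set (Cplane R)) (K : set (sphere R)).

Local Notation rho := (outer_radius R).
Local Notation G := (example_semigroup R).
Local Notation gens := (generators R).
Local Notation J := (Julia_plane R).

Lemma planar_connected K : K `<=` range (@fin_pt R) -> connected K -> connected (planar K).
Proof.
move=> Kfin cK B [b Bb] [U oU BU] [F cF BF].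
suff H : @fin_pt R @` B = K.
  by rewrite -H planar_image.
have img V : @fin_pt R @` (planar K `&` V) = K `&` (@fin_pt R @` V).
  apply/seteqP; split=> [_ [y [Ky Vy] <-]|x [Kx [y Vy yx]]].
    by split => //; exists y.
  by exists y => //; split => //; rewrite /planar /= yx.
apply: cK; first by exists (fin_pt b); exists b.
  by exists (@fin_pt R @` U); [exact: open_fin_image|rewrite BU img].
exists (~` (@fin_pt R @` (~` F))).
  by apply: open_closedC; apply: open_fin_image; exact: closed_openC.
rewrite BF img; apply/seteqP; split=> x [Kx Fx]; split => //.
  by move=> [y nFy yx]; case: Fx => y' Fy' y'x; apply: nFy; rewrite (fin_pt_inj (etrans yx (esym y'x))).
have [y _ yx] := Kfin x Kx; exists y => //; apply: contrapT => nFy.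
by apply: Fx; exists y.
Qed.

Lemma image_connected E : connected E -> connected (@fin_pt R @` E).
Proof.
move=> cE; apply: connected_continuous_connected cE _.
exact/continuous_subspaceT/fin_pt_continuous.
Qed.

Lemma Julia_finite : Julia G `<=` range (@fin_pt R).
Proof. by move=> [z|] Jx; [exists z|case: Jx; exact: Fatou_inf]. Qed.

Definition one_or_small : set (complex R) := [set z | z = 1 \/ cmod z <= 1 / 4].

Lemma gens_one_or_small h : gens h -> forall z, one_or_small z -> one_or_small h.[z].
Proof.
move: h; apply: gens_case => z [->|z4].
- by left; rewrite cubicE; ring.
- by right; exact: cubic_small.
- by left; rewrite squareE expr1n.
- by right; exact: square_small.
- right; apply: le_trans (shrink_small _) _; last by lra.
  by rewrite cmod1 ler1n.
- right; apply: le_trans (shrink_small _) _; last by lra.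
  by apply: le_trans z4 _; lra.
Qed.

Lemma cubic_deriv (z : complex R) : (cubic R)^`().[z] = 6 * (z * (1 - z)).
Proof.
rewrite /cubic derivB !derivZ !derivXn hornerD hornerN !hornerZ !hornerMn !hornerXn /=.
by rewrite expr1; ring.
Qed.

(** By the chain rule a critical point of [p \Po q] is critical for [q], or [q] maps it to a
    critical point of [p]. In the first case forward invariance of [one_or_small] finishes, in the
    second the claim for [p] does. *)
Lemma critical_value_small g z : G g -> root g^`() z -> one_or_small g.[z].
Proof.
move=> Gg; elim: Gg z => {g} [h Ah|p q Gp IHp Gq IHq] z.
  move: z; move: h Ah; apply: gens_case => z.
  - rewrite /root cubic_deriv.
    rewrite !mulf_eq0 pnatr_eq0 /= subr_eq0 => /orP[/eqP ->|/eqP <-].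
      right; rewrite cubicE expr0n mul0r cmod0; lra.
    by left; rewrite cubicE; ring.
  - rewrite /square derivXn /root hornerMn hornerXn expr1 mulrn_eq0 /= => /eqP ->.
    by right; rewrite hornerXn expr0n cmod0; lra.
  - rewrite /shrink derivZ derivXn /root hornerZ hornerMn hornerXn mulf_eq0.
    rewrite mulrn_eq0 expf_eq0 /= => /orP[|/eqP ->].
      rewrite -cmod_eq0 cmod_real normr_eq0 invr_eq0 expf_eq0 /=.
      by rewrite (negPf (rho_neq0 R)).
    by right; rewrite hornerZ hornerXn expr0n mulr0 cmod0; lra.
rewrite deriv_comp rootM => /orP[|qz].
  by rewrite /root horner_comp horner_comp => qz; exact: IHp.
rewrite horner_comp; apply: (semigroup_gen_stable gens_one_or_small) => //.
exact: IHq.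
Qed.

Lemma postcritical_bounded : bounded_set (planar (postcritical G)).
Proof.
apply: (@bounded_disc R 1) => z Pz; rewrite leNgt; apply/negP => z1.
pose U := [set x : sphere R | if x is Some w then cmod w <= 1 else True].
have cU : open (@fin_pt R @` [set y | 1 < cmod (y - 0)]).
  exact/open_fin_image/codisc_open.
have [|x [[g Gg [y cy <-]] gy]] := Pz (@fin_pt R @` [set y | 1 < cmod (y - 0)]).
  by apply: open_nbhs_nbhs; split => //; exists z => //; rewrite /= subr0.
case: gy => w; rewrite /= subr0 => w1; case: y cy => [y|//] cy [wE].
have := critical_value_small Gg cy; rewrite -wE => -[w1'|w4].
  by move: w1; rewrite w1' cmod1 ltxx.
by move: w1; rewrite ltNge (le_trans w4) //; lra.
Qed.

Lemma G_class : classG G.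
Proof.
split; last exact: postcritical_bounded.
- exists gens; split => //; first by exists (square R); exact: gen_square.
  by move=> p; exact: gens_size1.
- by apply: semigroup_gen_size; exact: gens_size.
Qed.

(** Index 0 is J(h3), the maximal component; index 1 is [level 0], that is [core], the minimal
    one. *)
Definition component_seq n : set (Cplane R) := if n is n'.+1 then level R n' else circle rho.

Lemma component_seq_J n : component_seq n `<=` J.
Proof. by case: n => [|n]; [move=> z; exact: circle_J|exact: level_J]. Qed.

Lemma component_seq_connected n : connected (component_seq n).
Proof.
case: n => [|n]; last exact: level_connected.
by apply: circle_connected; exact: ltW (rho_gt0 R).
Qed.

Lemma component_seq_sub n z E : component_seq n z -> connected E -> E `<=` J -> E z ->
  E `<=` component_seq n.
Proof.
case: n => [|n] nz cE EJ Ez; first exact: connected_circle cE EJ Ez nz.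
exact: connected_level cE EJ Ez nz.
Qed.

Lemma component_seq_cover z : J z -> exists n, component_seq n z.
Proof. by move=> /J_cover[zr|[n nz]]; [exists 0%N|exists n.+1]. Qed.

Lemma Julia_component n z : component_seq n z ->
  connected_component (Julia G) (fin_pt z) = @fin_pt R @` component_seq n.
Proof.
move=> nz; apply: connected_component_eq.
- by exists z.
- by move=> _ [y ny <-]; exact: component_seq_J ny.
- exact/image_connected/component_seq_connected.
move=> K cK KJ Kz.
have Kfin : K `<=` range (@fin_pt R) by apply: subset_trans KJ _; exact: Julia_finite.
have sub : planar K `<=` component_seq n.
  apply: (component_seq_sub nz) => //; first exact: planar_connected.
  by move=> y /KJ.
by move=> x Kx; have [y _ yx] := Kfin x Kx; exists y => //; apply: sub; rewrite /planar /= yx.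
Qed.

Lemma component_seq_nonempty n : component_seq n !=set0.
Proof.
case: n => [|n]; first exact: circle_nonempty (ltW (rho_gt0 R)).
by have [z /ring_level nz] := ring_nonempty R n; exists z.
Qed.

Lemma components_Julia : components (Julia G) = range (fun n => @fin_pt R @` component_seq n).
Proof.
apply/seteqP; split=> [_ [[z|] Jz <-]|_ [n _ <-]].
- have [n nz] := component_seq_cover Jz; exists n => //.
  by rewrite (Julia_component nz).
- by case: Jz; exact: Fatou_inf.
- have [z nz] := component_seq_nonempty n; exists (fin_pt z).
    exact: component_seq_J nz.
  exact: Julia_component.
Qed.

Lemma component_seq_inj : injective component_seq.
Proof.
have lvl m n : level R m = level R n -> m = n.
  wlog mn : m n / (m < n)%N.
    by move=> H e; have [mn|nm|//] := ltngtP m n; [exact: H|exact/esym/H].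
  move=> e; have [z /ring_level nz] := ring_nonempty R n.
  have := level_lt nz mn; move: nz; rewrite -e => -[_ zm] zm'.
  by have := lt_trans zm zm'; rewrite ltxx.
have cl n : circle rho <> level R n.
  move=> e; have [z /ring_level nz] := ring_nonempty R n.
  have [_] := nz; suff -> : cmod (iter n (horner (shrink R)) z) = rho.
    by rewrite /outer_radius; lra.
  have zr : cmod z = rho by move: nz; rewrite -e.
  by elim: (n) => [//|k IH]; rewrite iterS; exact/shrink_on_circle.
move=> [|m] [|n] //= e; first by case: (cl n).
  by case: (cl m).
by rewrite (lvl _ _ e).
Qed.

Lemma components_Julia_card : components (Julia G) #= [set: nat].
Proof.
rewrite components_Julia; apply: inj_card_eq => m n _ _ e.
by apply: component_seq_inj; rewrite -(planar_image (component_seq m)) e planar_image.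
Qed.

Lemma Julia_disconnected : ~ connected (Julia G).
Proof.
move=> cJ; have cJp : connected J by apply: planar_connected cJ; exact: Julia_finite.
have [z z0] := component_seq_nonempty 0; have [w w1] := component_seq_nonempty 1.
have Jz := component_seq_J z0.
have [_ /=] := @component_seq_sub 1 w J w1 cJp (@subset_refl _ J) (component_seq_J w1) z Jz.
by rewrite z0 /outer_radius; lra.
Qed.

Lemma Jmin_core : is_Jmin G (@fin_pt R @` core R).
Proof.
split; first by rewrite components_Julia; exists 1%N.
move=> K; rewrite components_Julia => -[n _ <-]; rewrite !planar_image.
have core2 : core R `<=` disc 0 2 by move=> z [_ z2]; rewrite /disc /= subr0.
case: n => [|[|n]]; last 1 first.
(* The ring inside the level is a circle around the disc of radius 2, which contains [core]. *)
- have [s sb sE] := ring_circle R n.+1.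
  apply: (@surround_circle R _ _ 2 s) => //.
  + rewrite -subset0 => z [nz]; rewrite /disc /= subr0 => z2.
    by have := lt_trans z2 (level_lt nz (ltn0Sn n)); rewrite ltxx.
  + by rewrite -sE; exact: ring_level.
  + by have /andP[ts _] := sb; apply: lt_le_trans ts; rewrite /inner_radius; lra.
- apply: (@surround_circle R _ _ 2 rho) => //; last exact: rho_gt0.
  rewrite -subset0 => z [zr]; rewrite /disc /= subr0.
  by have -> : cmod z = rho by []; rewrite /outer_radius; lra.
- by left.
Qed.

Lemma Jmax_circle : is_Jmax G (@fin_pt R @` circle rho).
Proof.
split; first by rewrite components_Julia; exists 0%N.
move=> K; rewrite components_Julia => -[n _ <-]; rewrite !planar_image.
case: n => [|n]; first by left.
apply: (@surround_circle R _ _ rho rho) => //; try exact: rho_gt0.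
- move=> z nz; rewrite /disc /= subr0 lt_neqAle.
  have /andP[_ ->] := J_bounds (level_J nz); rewrite andbT; apply/eqP => zr.
  have zr0 : component_seq 0 z by [].
  have := @component_seq_sub 0 z _ zr0 (@level_connected R n) (@level_J R n) nz.
  have [y ny] := component_seq_nonempty n.+1 => H.
  have [_] := ny; suff -> : cmod (iter n (horner (shrink R)) y) = rho.
    by rewrite /outer_radius; lra.
  by elim: (n) => [|k IH]; [exact: H|rewrite iterS; exact/shrink_on_circle].
- rewrite -subset0 => z [zr]; rewrite /disc /= subr0.
  by have -> : cmod z = rho by []; rewrite ltxx.
Qed.

(** The punctured disc consists of Julia points, and its centre 1 is a limit of them. *)
Lemma disc_one_core : disc (1 : Cplane R) (1 / 16) `<=` core R.
Proof.
have J1 (y : Cplane R) : disc 1 (1 / 16) y -> y != 1 -> J y.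
  rewrite /disc /= => y16 yn1; rewrite /Julia_plane /planar /= -(subrK 1 y) addrC.
  apply: punctured_disc_Julia; [exact: gen_cubic|exact: gen_square| |exact: ltW].
  by rewrite subr_eq0.
move=> y y16; split; last first.
  move: y16; rewrite /disc /= => y16.
  by have := cmodD (y - 1) 1; rewrite subrK cmod1 => /le_lt_trans; apply; lra.
have [->|] := eqVneq y 1; last exact: J1.
apply: J_closed => U /nbhs_disc[e e0 eU].
pose s := Num.min (1 / 32) (e / 2).
have s0 : 0 < s by rewrite lt_min; apply/andP; split; lra.
have d1 : cmod ((1 + s%:C%C : Cplane R) - 1) = s.
  by rewrite addrAC subrr add0r cmod_real gtr0_norm.
exists (1 + s%:C%C); split.
  apply: J1; rewrite /disc /mkset ?d1.
    by apply: (@le_lt_trans _ _ (1 / 32)); [rewrite /s ge_min lexx|lra].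
  by rewrite -subr_eq0 -cmod_eq0 d1 gt_eqF.
apply: eU; rewrite /disc /mkset d1.
by apply: (@le_lt_trans _ _ (e / 2)); [rewrite /s ge_min lexx orbT|lra].
Qed.

(** Preimages of the circle are Julia points by backward invariance, and [far] confines them to
    [|z| < 2]. *)
Lemma preimage_circle_core (h : {poly complex R}) : gens h ->
  (forall z, 2 <= cmod z -> rho < cmod h.[z]) ->
  poly_map h @^-1` (@fin_pt R @` circle rho) `<=` @fin_pt R @` core R.
Proof.
move=> Ah far [z|] [w wr] //= [wz]; exists z => //; split.
  by apply: (J_backward Ah); apply: circle_J; rewrite -wz.
rewrite ltNge; apply/negP => /far; rewrite -wz.
by have -> : cmod w = rho by []; rewrite ltxx.
Qed.

Lemma superattracting_one : superattracting (cubic R) (fin_pt 1).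
Proof.
split; first by rewrite /= cubicE; congr fin_pt; ring.
by change (is_true (root (cubic R)^`() 1)); rewrite /root cubic_deriv subrr !mulr0.
Qed.

End Conclusion.

Theorem proposition2p29 (R : realType) :
  exists h1 h2 h3 : {poly complex R},
  let G := semigroup_gen [set h1; h2; h3] in
  classG_dis G /\
  exists Jmin Jmax : set (sphere R),
  [/\ is_Jmin G Jmin, is_Jmax G Jmax &
  [/\ poly_map h1 @^-1` Jmax `|` poly_map h2 @^-1` Jmax `<=` Jmin,
      Jmax = Julia (semigroup_gen [set h3]),
      components (Julia G) #= [set: nat],
      exists2 g, G g & exists2 z0, superattracting g z0 & Julia G z0 &
      Jmin° !=set0]].
Proof.
exists (cubic R), (square R), (shrink R) => Gr.
have J1 : core R 1 by apply: disc_one_core; apply: disc_center; lra.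
split; first by split; [exact: G_class|exact: Julia_disconnected].
exists (@fin_pt R @` core R), (@fin_pt R @` circle (outer_radius R)); split.
- exact: Jmin_core.
- exact: Jmax_circle.
split.
- rewrite subUset; split; apply: preimage_circle_core.
  + exact: gen_cubic.
  + by move=> z z2; apply: lt_le_trans (cubic_large z2); exact: sqr_gt_rho.
  + exact: gen_square.
  + by move=> z z2; rewrite cmod_square; exact: sqr_gt_rho.
- exact/esym/Julia_shrink.
- exact: components_Julia_card.
- exists (cubic R); first exact/semigroup_gen_in/gen_cubic.
  exists (fin_pt 1); first exact: superattracting_one.
  by have [] := J1.
exists (fin_pt 1); apply: (filterS (P := @fin_pt R @` disc 1 (1 / 16))).
  by apply: image_subset; exact: disc_one_core.
apply: open_nbhs_nbhs; split; first exact/open_fin_image/disc_open.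
by exists 1 => //; apply: disc_center; lra.
Qed.
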